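(* Let $(b_N)_N$ be a sequence of integers with $0\le b_N\le N-1$ and $b_N\to\infty$ as $N\to\infty$, and let $w_N:=\min(N,2b_N+1)$. Let $(W_N)_N$ and $(W_N^{\mathrm{per}})_N$ be, respectively, a strict and a periodic Wigner band ensemble with half-widths $b_N$, with arbitrary mean $m\in\mathbb{R}$ and variance $v\ge 0$. a) (1) The empirical eigenvalue measures $\mu_N^\omega$ of $\frac{1}{\sqrt{w_N}}W_N^{\mathrm{per}}$ converge weakly in probability to the semicircle law $\sigma_v$. (2) If in addition the scaled half-widths $\frac{b_N}{N}$ converge either to $0$ or to $1$ as $N\to\infty$, then the empirical eigenvalue measures $\mu_N^\omega$ of $\frac{1}{\sqrt{w_N}}W_N$ converge weakly in probability to $\sigma_v$. b) Suppose in addition that $\sum_{N:\,b_N\ge 1}(N b_N)^{-1}<\infty$. Then both statements (1) and (2) of part a) remain true with weak convergence in probability replaced by weak convergence $\mathbb{P}$-almost surely.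
   Context: A (full) Wigner ensemble with mean $m$ and variance $v$ is a sequence $(X_N)_{N\ge1}$ of random real symmetric $N\times N$ matrices on a common probability space $(\Omega,\mathcal{F},\mathbb{P})$ such that for each fixed $N$ the entries $X_N(i,j)$, $1\le i\le j\le N$, are independent, and all entries $X_N(i,j)$ (for all $N,i,j$) have one common distribution $\rho$ on $\mathbb{R}$ with finite moments of all orders; $m=\int x\,d\rho(x)$ and $v=\int x^2\,d\rho(x)-m^2$. Nothing is assumed about the joint dependence of $X_N$ and $X_M$ for $N\ne M$. The case $v=0$ is allowed. Band ensembles with half-widths $b_N$ are obtained from a Wigner ensemble $(X_N)_N$ as follows. Strict Wigner band ensemble: $W_N(i,j)=X_N(i,j)$ if $|i-j|\le b_N$ and $W_N(i,j)=0$ otherwise. Periodic Wigner band ensemble: $W_N^{\mathrm{per}}(i,j)=X_N(i,j)$ if $|i-j|_N\le b_N$ and $W_N^{\mathrm{per}}(i,j)=0$ otherwise, where $|i|_N:=\min(|i|,N-|i|)$ for $|i|\le N$. The mean and variance of the band ensemble are those of $(X_N)_N$. The number $w_N=\min(N,2b_N+1)$ is called the bandwidth. The eigenvalue distribution measure (empirical eigenvalue measure) of a real symmetric $N\times N$ matrix with eigenvalues $\lambda_1\le\dots\le\lambda_N$ (with multiplicity) is $\frac1N\sum_{j=1}^N\delta_{\lambda_j}$. For $v>0$, $\sigma_v$ is the probability measure on $\mathbb{R}$ with Lebesgue density $\frac{1}{2\pi v}\sqrt{(4v-x^2)_+}$, where $g_+=\max(g,0)$; $\sigma_0:=\delta_0$.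 Random probability measures $\mu_N^\omega$ on $\mathbb{R}$ converge to $\mu^\omega$ weakly in probability if for every bounded continuous $f:\mathbb{R}\to\mathbb{R}$ and every $\epsilon>0$, $\mathbb{P}(|\int f\,d\mu_N^\omega-\int f\,d\mu^\omega|>\epsilon)\to0$ as $N\to\infty$; they converge weakly $\mathbb{P}$-almost surely if there is $\Omega_0\subset\Omega$ with $\mathbb{P}(\Omega_0)=1$ such that for all $\omega\in\Omega_0$ and all bounded continuous $f$, $\int f\,d\mu_N^\omega\to\int f\,d\mu^\omega$. *)

(* Defs.v *)
From HB Require Import structures.
From mathcomp Require Import all_boot all_order all_algebra.
From mathcomp Require Import spectral complex.
From mathcomp Require Import all_classical all_reals all_analysis.
From mathcomp Require Import measurable_realfun.

Set Implicit Arguments.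
Unset Strict Implicit.
Unset Printing Implicit Defensive.

Import Order.TTheory GRing.Theory Num.Theory.
Import numFieldNormedType.Exports.

Local Open Scope classical_set_scope.
Local Open Scope ring_scope.

(* Mutual independence of the subfamily (Y i), i in D, of a finite family of
   real random variables: the product rule for all subfamilies and all Borel
   sets. *)
Definition mutually_independent d (Omega : measurableType d) (R : realType)
    (P : probability Omega R) (I : finType) (D : {set I})
    (Y : I -> {RV P >-> R}) : Prop :=
  forall (J : {set I}) (B : I -> set R), J \subset D ->
    (forall i, measurable (B i)) ->
    P (\bigcap_(i in [set` J]) (Y i @^-1` B i))
    = (\prod_(i in J) P (Y i @^-1` B i))%E.

(* Only the entries on and above the diagonal are required to be independent;
   nothing is said about the joint law of X N and X M for N <> M.  The size
   N = 0 carries no information since 'I_0 is empty. *)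
Record wigner_ensemble d (Omega : measurableType d) (R : realType)
    (P : probability Omega R) (X : forall N : nat, 'I_N -> 'I_N -> {RV P >-> R})
    (rho : probability R R) (m v : R) : Prop := WignerEnsemble {
  wigner_symmetric : forall N (i j : 'I_N) w, X N i j w = X N j i w ;
  wigner_independent : forall N,
    mutually_independent [set ij : 'I_N * 'I_N | (ij.1 <= ij.2)%N]
      (fun ij => X N ij.1 ij.2) ;
  wigner_distribution : forall N (i j : 'I_N) (B : set R), measurable B ->
    distribution P (X N i j) B = rho B ;
  wigner_moments : forall k : nat,
    rho.-integrable [set: R] (fun x => (x ^+ k)%:E) ;
  wigner_mean : m = \int[rho]_x x ;
  wigner_variance : v = \int[rho]_x (x ^+ 2) - m ^+ 2 }.

(* The distance |k|_N = min(|k|, N - |k|) of k to 0 on the cycle Z/N, for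
   0 <= k <= N; the truncated subtraction is harmless in this range. *)
Definition per_norm (N k : nat) : nat := minn k (N - k).

Definition strict_band d (Omega : measurableType d) (R : realType)
    (P : probability Omega R) (X : forall N : nat, 'I_N -> 'I_N -> {RV P >-> R})
    (b : nat -> nat) (N : nat) (w : Omega) : 'M[R]_N :=
  \matrix_(i, j) if (`|i - j|%N <= b N)%N then X N i j w : R else 0.

Definition periodic_band d (Omega : measurableType d) (R : realType)
    (P : probability Omega R) (X : forall N : nat, 'I_N -> 'I_N -> {RV P >-> R})
    (b : nat -> nat) (N : nat) (w : Omega) : 'M[R]_N :=
  \matrix_(i, j) if (per_norm N `|i - j|%N <= b N)%N then X N i j w : R else 0.

Definition bandwidth (b : nat -> nat) (N : nat) : nat :=
  minn N (2 * b N + 1).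

(* The eigenvalues in nondecreasing order, repeated according to their
   multiplicity; the list is [::] when the characteristic polynomial does not
   split over R, which eigenvaluesP rules out for symmetric A. *)
Definition eigenvalues (R : realType) (N : nat) (A : 'M[R]_N) : seq R :=
  xget [::] [set s | sorted <=%R s /\
                     char_poly A = \prod_(x <- s) ('X - x%:P)].

Lemma eigenvaluesP (R : realType) (N : nat) (A : 'M[R]_N) : A^T = A ->
  [/\ size (eigenvalues A) = N, sorted <=%R (eigenvalues A) &
      char_poly A = \prod_(x <- eigenvalues A) ('X - x%:P)].
Proof.
move=> symA; rewrite /eigenvalues; case: xgetP => [s _ [sorted_s eq_s]|noev].
  split=> //; apply/succn_inj.
  by rewrite -(size_char_poly A) eq_s size_prod_XsubC.
exfalso.
pose toC := real_complex R : {rmorphism R -> R[i]}.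
pose AC := map_mx toC A.
have hermAC : AC \is hermsymmx.
  rewrite is_hermitianmxE expr0 scale1r; apply/eqP/matrixP => i j.
  by rewrite !mxE -[in LHS]symA mxE; apply/esym/CrealP/complex_realP; eexists.
have /hermitian_normalmx/orthomx_spectralP AC_eq := hermAC.
have spec_real := hermitian_spectral_diag_real hermAC.
set P := spectralmx AC in AC_eq; set D := spectral_diag AC in AC_eq spec_real.
have Punit : P \in unitmx by exact: spectral_unit.
pose r i := complex.Re (D 0 i).
have rE i : D 0 i = toC (r i).
  by apply/esym/RRe_real; move/mxOverP : spec_real => /(_ 0 i).
have charE : char_poly A = \prod_(i < N) ('X - (r i)%:P).
  apply: (map_poly_inj toC); rewrite map_char_poly rmorph_prod/=.
  transitivity (char_poly (diag_mx D)).
    rewrite -/AC AC_eq /char_poly /char_poly_mx !map_mxM/=.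
    set Q := map_mx _ P; set Q' := map_mx _ (invmx P).
    have Q'Q : Q' *m Q = 1%:M by rewrite -map_mxM mulVmx// map_mx1.
    have XE : Q' *m 'X%:M *m Q = 'X%:M by rewrite scalar_mxC -mulmxA Q'Q mulmx1.
    rewrite -[X in \det (X - _) = _]XE -mulmxBl -mulmxBr !det_mulmx mulrAC.
    by rewrite -det_mulmx Q'Q det1 mul1r.
  rewrite char_poly_trig; last exact: diag_mx_is_trig.
  apply: eq_bigr => i _; rewrite mxE eqxx mulr1n rE.
  by rewrite rmorphB/= map_polyX map_polyC.
apply: (noev (sort <=%R [seq r i | i <- enum 'I_N])); split.
  by rewrite sort_sorted//; exact: le_total.
by rewrite charE (perm_big _ (permEl (perm_sort _ _)))/= big_map big_enum.
Qed.

(* For N = 0 this is the null measure, which does not affect limits in N. *)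
Definition empirical_measure (R : realType) (N : nat) (A : 'M[R]_N) :
    {measure set R -> \bar R} :=
  mscale (N%:R^-1)%:nng (msum (fun k => \d_((eigenvalues A)`_k)) N).

Definition semicircle_pdf (R : realType) (v x : R) : R :=
  (2 * pi * v)^-1 * Num.sqrt (Num.max (4 * v - x ^+ 2) 0).

Definition semicircle_law (R : realType) (v : R) : set R -> \bar R :=
  if 0 < v
  then fun A => (\int[lebesgue_measure]_(x in A) (semicircle_pdf v x)%:E)%E
  else \d_(0 : R).

Lemma semicircle_pdf_ge0 (R : realType) (v x : R) :
  0 < v -> 0 <= semicircle_pdf v x.
Proof.
move=> v0; rewrite /semicircle_pdf mulr_ge0 ?sqrtr_ge0// invr_ge0.
by rewrite !mulr_ge0 ?pi_ge0// ltW.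
Qed.

Lemma measurable_semicircle_pdf (R : realType) (v : R) :
  measurable_fun [set: R] (semicircle_pdf v).
Proof.
apply: measurable_funM => //.
apply: measurableT_comp.
  by apply: continuous_measurable_fun; exact: sqrt_continuous.
apply: measurable_maxr => //.
by apply: measurable_funB => //; exact: measurable_funX.
Qed.

Section semicircle_law_measure.
Variables (R : realType) (v : R).

Let semicircle_law0 : semicircle_law v set0 = 0%E.
Proof. by rewrite /semicircle_law; case: ifP; rewrite ?integral_set0. Qed.

Let semicircle_law_ge0 A : (0 <= semicircle_law v A)%E.
Proof.
rewrite /semicircle_law; case: ifP => // v0; apply: integral_ge0 => x _.
by rewrite lee_fin semicircle_pdf_ge0.
Qed.

Let semicircle_law_sigma_additive : semi_sigma_additive (semicircle_law v).
Proof.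
rewrite /semicircle_law; case: ifP => v0; last first.
  exact: measure_semi_sigma_additive.
move=> F; apply: (@semi_sigma_additive_nng_induced _ (measurableTypeR R)).
  by apply/measurable_EFinP; exact: measurable_semicircle_pdf.
by move=> x; rewrite lee_fin semicircle_pdf_ge0.
Qed.

HB.instance Definition _ := isMeasure.Build _ _ _ (semicircle_law v)
  semicircle_law0 semicircle_law_ge0 semicircle_law_sigma_additive.

End semicircle_law_measure.


Definition weak_cvg_in_probability d (Omega : measurableType d) (R : realType)
    (P : probability Omega R)
    (mu : nat -> Omega -> {measure set R -> \bar R})
    (nu : Omega -> {measure set R -> \bar R}) : Prop :=
  forall f : R -> R, continuous f -> bounded_fun f ->
  forall eps : R, 0 < eps ->
    P [set w | eps < `|\int[mu N w]_x f x - \int[nu w]_x f x|]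
      @[N --> \oo] --> 0%E.

Definition weak_cvg_almost_surely d (Omega : measurableType d) (R : realType)
    (P : probability Omega R)
    (mu : nat -> Omega -> {measure set R -> \bar R})
    (nu : Omega -> {measure set R -> \bar R}) : Prop :=
  exists Omega0 : set Omega, [/\ measurable Omega0, P Omega0 = 1%E &
    forall w, Omega0 w ->
    forall f : R -> R, continuous f -> bounded_fun f ->
      \int[mu N w]_x f x @[N --> \oo] --> \int[nu w]_x f x].

(* The empirical eigenvalue measures of w_N^{-1/2} W_N, for the strict and the
   periodic band ensemble. *)
Definition strict_band_esd d (Omega : measurableType d) (R : realType)
    (P : probability Omega R) (X : forall N : nat, 'I_N -> 'I_N -> {RV P >-> R})
    (b : nat -> nat) (N : nat) (w : Omega) : {measure set R -> \bar R} :=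
  empirical_measure
    ((Num.sqrt (bandwidth b N)%:R)^-1 *: strict_band X b N w).

Definition periodic_band_esd d (Omega : measurableType d) (R : realType)
    (P : probability Omega R) (X : forall N : nat, 'I_N -> 'I_N -> {RV P >-> R})
    (b : nat -> nat) (N : nat) (w : Omega) : {measure set R -> \bar R} :=
  empirical_measure
    ((Num.sqrt (bandwidth b N)%:R)^-1 *: periodic_band X b N w).

(* Main.v *)
Require Import Defs.
From mathcomp Require Import all_boot all_order all_algebra.
From mathcomp Require Import spectral complex.
From mathcomp Require Import all_classical all_reals all_analysis.
From mathcomp Require Import measurable_realfun.
From mathcomp Require Import zify ring lra.

(** The proof is by moments. Split each entry into its mean [m] and a centered
    variable, so that the scaled band matrix is the sum of a centered band matrix
    and of a band matrix with constant entries [m / sqrt w].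

    For the centered matrix, the normalized trace of the [n]-th power is a sum
    over closed walks of length [n] along the band, whose expectations are joint
    moments of the entries on the edges of the walk. They vanish when some edge is
    used once, and a walk that uses each edge twice has at most [n / 2 + 1]
    vertices. Only walks in which a new vertex is left by the edge that led to it
    count in the limit, and removing such a pair of steps leaves about [w] choices
    for the removed vertex. Instead of classifying walks by their shape, the sum of
    the walks whose first [h] steps reach distinct vertices is considered: it
    satisfies, up to a relative error [1 / sqrt w] and the proportion of missing
    neighbours, the same recursion in [h] as lattice paths from height [h] to [0]
    ([walk_sum_ballot]). The weighted number [ballot v 0 n] of these paths is the
    [n]-th moment of the semicircle law, for the Chebyshev polynomials satisfy this
    recursion too ([arc_moment]). For the variance, two closed walks are correlated
    only if they share an edge, and then have at most [n] vertices together
    ([nverts_pair]); hence the variance is of order [1 / (N w)], and Chebyshev's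
    inequality bounds the probability of a deviation of the trace by a constant
    times [1 / (N w)] ([trace_moment_deviation]). This tends to zero, and it is
    summable under the hypothesis of the second part, where the Borel-Cantelli lemma
    applies.

    The constant band matrix need not be small in norm, but up to an error of small
    norm it is constant on square blocks of side [L], hence of rank at most
    [N / L + 1] ([constant_band_shift]). By comparison of dimensions, such a
    perturbation moves few eigenvalues across any gap ([eigenvalue_count_perturb]),
    which does not change the limit of the spectral averages of a continuous bounded
    function ([average_transfer]).

    Convergence of the moments implies weak convergence because the semicircle law
    has compact support: a polynomial approximation on a larger interval suffices,
    the tails being controlled by a high even moment ([average_close_of_moments]).

    Periodic bands have no missing neighbours. In strict bands, the proportion of
    missing neighbours tends to zero when [b N / N] tends to [0] or to [1]
    ([strict_defect_cvg]). *)

Set Implicit Arguments.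
Unset Strict Implicit.
Unset Printing Implicit Defensive.

Import Order.TTheory GRing.Theory Num.Theory.
Import numFieldNormedType.Exports.

Local Open Scope classical_set_scope.
Local Open Scope ring_scope.


(** * Edges of walks and connectivity *)

Section WalkEdges.
Context {N : nat}.
Implicit Types (x y z a b : 'I_N) (p q u : seq 'I_N) (e : 'I_N * 'I_N)
  (F es s : seq ('I_N * 'I_N)).

(** Unoriented edges are encoded by nondecreasing pairs, the indices of the
    independent entries of a symmetric matrix. *)
Definition edge x y : 'I_N * 'I_N := if (x <= y)%N then (x, y) else (y, x).

Lemma edgeC x y : edge x y = edge y x.
Proof.
by rewrite /edge; case: (ltngtP x y) => // /val_inj ->.
Qed.

Lemma edge_ord x y : ((edge x y).1 <= (edge x y).2)%N.
Proof. by rewrite /edge; case: (leqP x y) => //= /ltnW. Qed.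

Lemma edge_inj x y a b : edge x y = edge a b -> (x = a /\ y = b) \/ (x = b /\ y = a).
Proof.
by rewrite /edge; case: ifP => _; case: ifP => _ [-> ->]; [left|right|right|left].
Qed.

Definition nverts p := size (undup p).
Definition nedges es := size (undup es).

Definition path_edges x p := pairmap edge x p.

Lemma size_path_edges x p : size (path_edges x p) = size p.
Proof. exact: size_pairmap. Qed.

Lemma path_edges_cat x p q :
  path_edges x (p ++ q) = path_edges x p ++ path_edges (last x p) q.
Proof. exact: pairmap_cat. Qed.

Lemma path_edges_rcons x p y :
  path_edges x (rcons p y) = rcons (path_edges x p) (edge (last x p) y).
Proof. by rewrite -!cats1 path_edges_cat. Qed.

Lemma path_edges_endpoints x p a b :
  edge a b \in path_edges x p -> (a \in x :: p) && (b \in x :: p).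
Proof.
elim: p x => //= y p IH x; rewrite inE => /predU1P[/edge_inj|/IH /andP[ha hb]].
  by case=> -[-> ->]; rewrite !inE !eqxx !orbT.
by rewrite inE ha orbT inE hb orbT.
Qed.

Definition edge_rel F := [rel a b | edge a b \in F].

Lemma edge_rel_sym F : connect_sym (edge_rel F).
Proof. by apply: sym_connect_sym => a b; rewrite /= edgeC. Qed.

Lemma connect_edge_sub F F' : {subset F <= F'} ->
  forall a b, connect (edge_rel F) a b -> connect (edge_rel F') a b.
Proof. by move=> FF'; apply: connect_sub => a b /= h; apply/connect1/FF'. Qed.

Lemma connect_path_edges F x p : {subset path_edges x p <= F} ->
  forall y, y \in x :: p -> connect (edge_rel F) x y.
Proof.
elim: p x => [|z p IH] x sF y; first by rewrite inE => /eqP->.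
rewrite inE => /predU1P[->//|yp].
apply: (@connect_trans _ _ z); first by apply/connect1/sF; rewrite /= inE eqxx.
by apply: IH => // f hf; apply: sF; rewrite /= inE hf orbT.
Qed.

(** A set [A] maximal among those containing [x0] and having at most one more
    vertex than inner edges is closed under adjacency, for a crossing edge would
    allow to adjoin its outer endpoint. *)
Lemma card_connected F x0 p :
  (forall x, x \in p -> connect (edge_rel F) x0 x) ->
  (nverts p <= (nedges F).+1)%N.
Proof.
move=> conn.
pose inner (A : {set 'I_N}) := [pred e | (e.1 \in A) && (e.2 \in A)] : pred ('I_N * 'I_N).
pose good (A : {set 'I_N}) := (x0 \in A) && (#|A| <= (count (inner A) (undup F)).+1)%N.
have good1 : good [set x0]%SET by rewrite /good inE eqxx cards1.
case: (arg_maxnP (fun A : {set 'I_N} => #|A|) good1) => A /andP[x0A cardA] maxA.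
have stepA a b : a \in A -> edge a b \in F -> b \in A.
  move=> aA eF; apply/negPn/negP => bA.
  suff /maxA : good (b |: A)%SET by rewrite cardsU1 bA /geq /= add1n ltnn.
  rewrite /good inE x0A orbT /= cardsU1 bA add1n ltnS (leq_trans cardA)//.
  have eU : edge a b \in undup F by rewrite mem_undup.
  rewrite !(permP (perm_to_rem eU)) /=.
  have -> : inner A (edge a b) = false.
    by rewrite /inner /edge /=; case: ifP => _ /=; rewrite (negPf bA) ?andbF.
  have -> : inner (b |: A)%SET (edge a b).
    by rewrite /inner /edge /=; case: ifP => _ /=; rewrite !inE eqxx aA !orbT.
  rewrite add0n add1n ltnS; apply: sub_count => e /= /andP[e1 e2].
  by rewrite /inner /= !finset.in_setU e1 e2 !orbT.
have clA : closed_mem (edge_rel F) (mem A).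
  by move=> a b /= ab; apply/idP/idP => h; apply: (stepA _ _ h); rewrite // edgeC.
have pA : {subset undup p <= A}.
  by move=> x; rewrite mem_undup => /conn h; rewrite -(closed_connect clA h).
apply: (@leq_trans #|A|); last by rewrite (leq_trans cardA)// ltnS count_size.
rewrite cardE; apply: uniq_leq_size; first exact: undup_uniq.
by move=> x /pA; rewrite mem_enum.
Qed.

Lemma nverts_le_nedges x p :
  (nverts (x :: p) <= (nedges (path_edges x p)).+1)%N.
Proof. by apply: (@card_connected _ x) => y; apply: connect_path_edges. Qed.

Lemma nedges_cons2 e s : nedges (e :: e :: s) = ((e \notin s) + nedges s)%N.
Proof. by rewrite /nedges /= inE eqxx; case: (e \in s). Qed.

Lemma nedges_rem e s : e \in s ->
  nedges s = (nedges [seq f <- s | f != e]).+1.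
Proof.
rewrite -mem_undup /nedges => es.
by rewrite (perm_size (perm_to_rem es)) /= rem_filter ?undup_uniq// filter_undup.
Qed.

Lemma sum_count_undup (T : eqType) (s : seq T) :
  (\sum_(t <- undup s) count_mem t s = size s)%N.
Proof.
rewrite -[RHS]sum1_size -(big_undup_iterop_count _ s xpredT (fun=> 1%N)) /=.
by apply: eq_bigr => t _; rewrite Monoid.iteropE iter_addn_0 mul1n.
Qed.

Lemma nedges_double s : {in s, forall t, 2 <= count_mem t s}%N ->
  (2 * nedges s <= size s)%N.
Proof.
rewrite /nedges => s2; rewrite -[leqRHS]sum_count_undup mulnC -sum1_size big_distrl /=.
by rewrite !big_seq; apply: leq_sum => t; rewrite mem_undup => /s2.
Qed.

Lemma nedges_triple s t :
  {in s, forall t, 2 <= count_mem t s}%N -> (3 <= count_mem t s)%N ->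
  (2 * nedges s < size s)%N.
Proof.
rewrite /nedges => s2 t3; have tU : t \in undup s.
  by rewrite mem_undup -has_pred1 has_count (leq_trans _ t3).
rewrite -[ltnRHS]sum_count_undup mulnC -sum1_size big_distrl /=.
rewrite (perm_big _ (perm_to_rem tU)) [ltnRHS](perm_big _ (perm_to_rem tU)) /=.
rewrite !big_cons -addSn leq_add// !big_seq; apply: leq_sum => t'.
by move=> /mem_rem; rewrite mem_undup => /s2.
Qed.

End WalkEdges.

(** These counts have to be generalized for [lia] to treat them as atoms. *)
Ltac counts_lia :=
  repeat match goal with
  | |- context [nverts ?u] => generalize (nverts u)
  | |- context [nedges ?es] => generalize (nedges es)
  | |- context [size ?s] => generalize (size s)
  end; clear; intros; lia.

(** * Joint moments of the edges of walks *)

Section JointMoment.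
Context {R : realFieldType} {N : nat} (mu : nat -> R).
Implicit Types (e : 'I_N * 'I_N) (es : seq ('I_N * 'I_N)).

(** The expectation of the product of the entries at [es], when the entries at
    distinct edges are independent with moments [mu]. *)
Definition joint_moment es : R := \prod_(e : 'I_N * 'I_N) mu (count_mem e es).

Lemma joint_moment_perm es es' : perm_eq es es' ->
  joint_moment es = joint_moment es'.
Proof. by move=> /permP E; apply: eq_bigr => e _; rewrite E. Qed.

Lemma joint_moment_neq0 es : mu 1 = 0 -> joint_moment es != 0 ->
  {in es, forall e, 2 <= count_mem e es}%N.
Proof.
move=> mu1 /prodf_neq0 h e; rewrite -has_pred1 has_count => e0.
have := h e isT; move: e0; case: (count_mem e es) => [//|[|//]] _.
by rewrite mu1 eqxx.
Qed.

Lemma joint_moment_cat es es' : mu 0 = 1 -> (forall e, e \in es -> e \notin es') ->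
  joint_moment (es ++ es') = joint_moment es * joint_moment es'.
Proof.
move=> mu0 dis; rewrite -big_split; apply: eq_bigr => e _ /=.
rewrite count_cat; have [/dis/count_memPn->|/count_memPn->] := boolP (e \in es).
  by rewrite addn0 mu0 mulr1.
by rewrite mu0 mul1r.
Qed.

Lemma joint_moment_pair e es : mu 0 = 1 -> e \notin es ->
  joint_moment (e :: e :: es) = mu 2 * joint_moment es.
Proof.
move=> mu0 ees; rewrite (@joint_moment_cat [:: e; e])//; last first.
  by move=> f; rewrite !inE orbb => /eqP->.
congr (_ * _); rewrite /joint_moment (bigD1 e)//= eqxx big1 ?mulr1// => f fe.
by rewrite eq_sym (negPf fe).
Qed.

Definition moment_bound n : R := (1 + \sum_(k < n.+1) `|mu k|) ^+ n.

Lemma moment_bound_ge0 n : 0 <= moment_bound n.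
Proof. by rewrite exprn_ge0// addr_ge0// sumr_ge0. Qed.

Lemma joint_moment_le es n : mu 0 = 1 -> (size es <= n)%N ->
  `|joint_moment es| <= moment_bound n.
Proof.
move=> mu0 esn; pose beta : R := 1 + \sum_(k < n.+1) `|mu k|.
have beta1 : 1 <= beta by rewrite lerDl sumr_ge0.
rewrite normr_prod (@le_trans _ _ (\prod_(e : 'I_N * 'I_N)
    if e \in undup es then beta else 1)) //.
  apply: ler_prod => e _; rewrite normr_ge0 /= mem_undup.
  case: ifPn => [_|/count_memPn->]; last by rewrite mu0 normr1.
  have ce : (count_mem e es < n.+1)%N by rewrite ltnS (leq_trans (count_size _ _)).
  rewrite /beta (bigD1 (Ordinal ce))//= addrCA lerDl addr_ge0//.
  exact: sumr_ge0.
rewrite -big_mkcond /= -big_uniq ?undup_uniq//= big_const_seq count_predT.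
rewrite iter_mulr_1 ler_weXn2l// (leq_trans _ esn)//.
exact: size_undup.
Qed.

End JointMoment.

(** * Vertex counts of walks contributing to the moments *)

Section VertexCounts.
Context {R : realFieldType} {N : nat} (mu : nat -> R).
Hypothesis mu1 : mu 1 = 0.
Implicit Types (x y z a b : 'I_N) (p q u : seq 'I_N) (e : 'I_N * 'I_N)
  (F es : seq ('I_N * 'I_N)).

Lemma nverts_perm u u' : perm_eq u u' -> nverts u = nverts u'.
Proof.
by move=> uu'; apply/perm_size/perm_undup => x; rewrite (perm_mem uu').
Qed.

(** Each edge of a contributing walk is used at least twice, and a connected graph
    has at most one more vertex than edges. *)
Lemma nverts_path x p : joint_moment mu (path_edges x p) != 0 ->
  (2 * nverts (x :: p) <= size p + 2)%N.
Proof.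
move=> /(joint_moment_neq0 mu1)/nedges_double.
rewrite size_path_edges; have := nverts_le_nedges x p; counts_lia.
Qed.

(** As [x] is on the walk, the edge [edge x y] is used a third time, or it is not
    needed to connect the vertices; both improve on the count of [nverts_path]. *)
Lemma nverts_backtrack x y p : x \in y :: p ->
  joint_moment mu (edge x y :: edge x y :: path_edges y p) != 0 ->
  (2 * nverts (y :: p) <= size p + 3)%N.
Proof.
move=> xp /(joint_moment_neq0 mu1) c2; have := nverts_le_nedges y p.
have := nedges_double c2.
have [ein|eout] := boolP (edge x y \in path_edges y p).
  have /(nedges_triple c2) : (3 <= count_mem (edge x y)
    (edge x y :: edge x y :: path_edges y p))%N.
    by rewrite /= eqxx !add1n !ltnS -has_count has_pred1.
  by rewrite nedges_cons2 ein /= size_path_edges; counts_lia.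
by rewrite nedges_cons2 eout /= size_path_edges; counts_lia.
Qed.

Lemma edge_last_uniq x p : uniq (x :: p) ->
  edge (last x p) x \in path_edges x p -> size p = 1%N.
Proof.
case: p => // y p /= /andP[xp /andP[yp up]].
rewrite inE => /predU1P[/edge_inj|/path_edges_endpoints /andP[_ h]]; last first.
  by rewrite h in xp.
case=> -[lx xl].
  by move: xp; rewrite -lx mem_last.
by case: p yp lx {xp up xl} => // z p yp lx; move: yp; rewrite -lx /= mem_last.
Qed.

(** The walk contains the cycle [x :: p1] closed by the edge [e] from its last
    vertex to [x]; deleting [e] keeps the vertices connected, which saves one
    edge in the comparison of vertices and edges. *)
Lemma nverts_cycle x p1 p2 : uniq (x :: p1) -> size p1 != 1%N ->
  last x (p1 ++ p2) = last x p1 ->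
  joint_moment mu (edge (last x p1) x :: path_edges x (p1 ++ p2)) != 0 ->
  (2 * nverts (x :: p1 ++ p2) <= size (p1 ++ p2) + 1)%N.
Proof.
set e := edge _ _; set p := p1 ++ p2; set es := e :: _ => up1 sp1 lxp.
move=> /(joint_moment_neq0 mu1) c2.
pose F := [seq f <- es | f != e].
have cut : connect (edge_rel F) x (last x p1).
  apply: (@connect_path_edges _ _ _ p1); last exact: mem_last.
  move=> f fp1; rewrite mem_filter inE path_edges_cat mem_cat fp1 orbT andbT.
  by apply: contra sp1 => /eqP fe; apply/eqP/(edge_last_uniq up1); move: fp1; rewrite fe.
have conn y : y \in x :: p -> connect (edge_rel F) x y.
  move=> yp; have : connect (edge_rel es) x y.
    by apply: connect_path_edges yp => f fp; rewrite inE fp orbT.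
  apply: connect_sub => a b /= abes.
  have [/edge_inj[] [-> ->]|abe] := eqVneq (edge a b) e.
  - by rewrite edge_rel_sym.
  - exact: cut.
  by apply: connect1; rewrite /= mem_filter abe.
have := card_connected conn; have := nedges_double c2.
have -> : nedges es = (nedges F).+1.
  by apply: nedges_rem; rewrite inE eqxx.
rewrite /= size_path_edges; counts_lia.
Qed.

Definition cycle_edges u := if u is x :: p then path_edges x (rcons p x) else [::].

Lemma size_cycle_edges u : size (cycle_edges u) = size u.
Proof. by case: u => //= x p; rewrite size_path_edges size_rcons. Qed.

Lemma cycle_edges_rot u i : cycle_edges (rot i u) = rot i (cycle_edges u).
Proof.
have [ui|iu] := leqP (size u) i; first by rewrite !rot_oversize ?size_cycle_edges.
elim: i iu => [_|i IH iu]; first by rewrite !rot0.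
rewrite (rotS (ltnW iu)) (@rotS _ i (cycle_edges u)) ?size_cycle_edges ?(ltnW iu)//.
rewrite -IH ?(ltnW iu)//.
case: (rot i u) => // x p; rewrite rot1_cons /=.
case: p => //= y p; rewrite rot1_cons.
by rewrite path_edges_rcons last_rcons.
Qed.

Lemma cycle_edges_endpoints u a b :
  edge a b \in cycle_edges u -> (a \in u) && (b \in u).
Proof.
case: u => //= x p /path_edges_endpoints.
by rewrite !inE !mem_rcons !inE !orbA !orbb.
Qed.

Lemma connect_cycle_edges F u : {subset cycle_edges u <= F} ->
  {in u &, forall a b, connect (edge_rel F) a b}.
Proof.
case: u => //= x p sF a b ap bp.
have h c : c \in x :: p -> connect (edge_rel F) x c.
  move=> cp; apply: (connect_path_edges sF).
  by move: cp; rewrite !inE mem_rcons inE => /predU1P[->|->]; rewrite ?eqxx ?orbT.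
by apply: (@connect_trans _ _ x); [rewrite edge_rel_sym|]; apply: h.
Qed.

Lemma edgeP e : (e.1 <= e.2)%N -> e = edge e.1 e.2.
Proof. by case: e => a b /=; rewrite /edge => ->. Qed.

Lemma cycle_edges_ord u e : e \in cycle_edges u -> (e.1 <= e.2)%N.
Proof.
case: u => //= x p; move: (rcons p x) => q; elim: q x => //= y q IH x.
by rewrite inE => /predU1P[->|/IH//]; exact: edge_ord.
Qed.

(** An edge that a closed walk uses only once can be bypassed by following the
    rest of the walk. *)
Lemma cycle_bypass u a b : count_mem (edge a b) (cycle_edges u) = 1%N ->
  connect (edge_rel [seq f <- cycle_edges u | f != edge a b]) a b.
Proof.
set e := edge a b => ce.
have ein : e \in cycle_edges u by rewrite -has_pred1 has_count ce.
have [i es' rotE] := rot_to ein.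
have rE := cycle_edges_rot u i.
have pE : perm_eq (cycle_edges u) (cycle_edges (rot i u)).
  by rewrite rE perm_sym; apply/permPl/perm_rot.
have memE f : f \in cycle_edges u = (f \in cycle_edges (rot i u)).
  by rewrite (perm_mem pE).
apply: (@connect_edge_sub _ [seq f <- cycle_edges (rot i u) | f != e]).
  by move=> f; rewrite !mem_filter memE.
rewrite (permP pE) in ce; rewrite rotE in rE.
case: (rot i u) ce rE {pE memE} => [//|x [|y p]] /= ce [].
  by move=> /edge_inj[] [<- <-].
move=> exy _; move: ce; rewrite exy eqxx add1n => -[] /count_memPn eout.
have cxy : connect (edge_rel [seq f <- e :: path_edges y (rcons p x) | f != e]) y x.
  apply: (@connect_path_edges _ _ _ (rcons p x)); last by rewrite inE mem_rcons inE eqxx orbT.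
  move=> f fp; rewrite mem_filter inE fp orbT andbT.
  by apply: contraNneq eout => <-.
rewrite /= eqxx /= in cxy *.
by move: exy => /edge_inj[] [xa yb]; rewrite -xa -yb // edge_rel_sym.
Qed.

(** Two closed walks of length [n] whose edges are correlated: each edge of the
    union is used at least twice, and a common edge is used three times or can
    be bypassed, so that the union has at most [n] vertices. *)
Lemma nverts_pair n u u' : mu 0 = 1 -> size u = n -> size u' = n ->
  joint_moment mu (cycle_edges u ++ cycle_edges u') !=
  joint_moment mu (cycle_edges u) * joint_moment mu (cycle_edges u') ->
  (exists2 a, a \in u & a \in u') /\ (nverts (u ++ u') <= n)%N.
Proof.
set es := cycle_edges u; set es' := cycle_edges u' => mu0 su su' neq.
have [e ees ees'] : exists2 e, e \in es & e \in es'.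
  apply/hasP/negPn/negP => /hasPn nh; move/eqP: neq; apply.
  by apply: joint_moment_cat => // e ein; apply/negP => /nh; rewrite ein.
have eE := edgeP (cycle_edges_ord ees).
set a := e.1 in eE; set b := e.2 in eE.
have c2 : {in es ++ es', forall f, 2 <= count_mem f (es ++ es')}%N.
  have [eq0|/(joint_moment_neq0 mu1)//] := eqVneq (joint_moment mu (es ++ es')) 0.
  move: neq; rewrite eq0 eq_sym mulf_eq0 negb_or => /andP[].
  move=> /(joint_moment_neq0 mu1) h /(joint_moment_neq0 mu1) h' f.
  by rewrite mem_cat count_cat => /orP[/h|/h']; lia.
have /andP[au bu] : (a \in u) && (b \in u).
  by apply: cycle_edges_endpoints; rewrite -eE.
have /andP[au' bu'] : (a \in u') && (b \in u').
  by apply: cycle_edges_endpoints; rewrite -eE.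
split; first by exists a.
have ses : size (es ++ es') = (2 * n)%N.
  by rewrite size_cat !size_cycle_edges su su'; lia.
have conn y : y \in u ++ u' -> connect (edge_rel (es ++ es')) a y.
  rewrite mem_cat => /orP[yu|yu'].
    by apply: (connect_cycle_edges _ au yu) => f; rewrite mem_cat => ->.
  by apply: (connect_cycle_edges _ au' yu') => f; rewrite mem_cat orbC => ->.
have [c3|c3] := leqP 3 (count_mem e (es ++ es')).
  have := nedges_triple c2 c3; have := card_connected conn.
  by rewrite ses; counts_lia.
have ce : count_mem e es = 1%N.
  move: c3; rewrite count_cat; move: ees ees'.
  by rewrite -!has_pred1 !has_count; lia.
pose F := [seq f <- es ++ es' | f != e].
have cut : connect (edge_rel F) a b.
  have := @cycle_bypass u a b; rewrite -eE -/es => /(_ ce).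
  apply: connect_edge_sub => f; rewrite !mem_filter mem_cat.
  by move=> /andP[-> ->].
have connF y : y \in u ++ u' -> connect (edge_rel F) a y.
  move=> /conn; apply: connect_sub => c d /= cdes.
  have [|cde] := eqVneq (edge c d) e.
    by rewrite eE => /edge_inj[] [-> ->] //; rewrite edge_rel_sym.
  by apply: connect1; rewrite /= mem_filter cde.
have := card_connected connF; have := nedges_double c2; rewrite ses.
have -> : nedges (es ++ es') = (nedges F).+1.
  by apply: nedges_rem; rewrite mem_cat ees.
counts_lia.
Qed.

End VertexCounts.

(** * Counting walks in a graph of bounded degree *)

Section TupleSums.
Context {V : nmodType} {T : finType}.
Implicit Types F : seq T -> V.

Lemma sum_tuple0 F : \sum_(t : 0.-tuple T) F t = F [::].
Proof.
rewrite (bigD1 [tuple])//= big1 ?addr0// => t /negP; case.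
by rewrite tuple0.
Qed.

Lemma sum_tuple_cons n F :
  \sum_(t : n.+1.-tuple T) F t = \sum_x \sum_(t : n.-tuple T) F (x :: t).
Proof.
rewrite pair_bigA (reindex (fun xt : T * n.-tuple T => cons_tuple xt.1 xt.2)) //=.
exists (fun t => (thead t, behead_tuple t)) => [[x t] _|t _] /=.
  by congr pair; apply: val_inj.
by case/tupleP: t => y t; apply: val_inj; rewrite /= theadE.
Qed.

Lemma sum_tuple_rcons n F :
  \sum_(t : n.+1.-tuple T) F t = \sum_x \sum_(t : n.-tuple T) F (rcons t x).
Proof.
elim: n F => [|n IH] F.
  rewrite sum_tuple_cons; apply: eq_bigr => x _.
  by rewrite (sum_tuple0 (fun t => F (x :: t))) (sum_tuple0 (fun t => F (rcons t x))).
rewrite sum_tuple_cons; under eq_bigr => x _ do rewrite (IH (fun t => F (x :: t))).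
rewrite exchange_big /=; apply: eq_bigr => y _.
by rewrite (sum_tuple_cons _ (fun t => F (rcons t y))).
Qed.

Lemma sum_tuple_rot n i F :
  \sum_(t : n.-tuple T) F (rot i t) = \sum_(t : n.-tuple T) F t.
Proof.
rewrite [RHS](reindex (fun t : n.-tuple T => [tuple of rot i t])) //=.
exists (fun t : n.-tuple T => [tuple of rotr i t]) => t _; apply: val_inj => /=.
  exact: rotK.
exact: rotrK.
Qed.

(** Closed walks are encoded by a base point [x] and the list [q] of the next
    vertices, whose last one is [x]; the two formulas below choose as base point
    either end of the step closing the walk. *)
Lemma sum_closed_rcons n (F : T -> seq T -> V) :
  \sum_x \sum_(q : n.+1.-tuple T) (if last x q == x then F x q else 0) =
  \sum_x \sum_(p : n.-tuple T) F x (rcons p x).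
Proof.
apply: eq_bigr => x _.
rewrite (sum_tuple_rcons _ (fun q => if last x q == x then F x q else 0)).
rewrite (bigD1 x)//= [X in _ + X]big1 ?addr0; last first.
  by move=> y yx; apply: big1 => p _; rewrite last_rcons (negPf yx).
by apply: eq_bigr => p _; rewrite last_rcons eqxx.
Qed.

Lemma sum_closed_cons n (F : T -> seq T -> V) :
  \sum_x \sum_(q : n.+1.-tuple T) (if last x q == x then F x q else 0) =
  \sum_x \sum_(p : n.-tuple T) F (last x p) (x :: p).
Proof.
under eq_bigr => x _ do
  rewrite (sum_tuple_cons _ (fun q => if last x q == x then F x q else 0)).
rewrite exchange_big /=; apply: eq_bigr => x _; rewrite exchange_big /=.
apply: eq_bigr => p _; rewrite (bigD1 (last x p))//= eqxx big1 ?addr0// => y.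
by rewrite eq_sym => /negPf->.
Qed.

End TupleSums.

Section CountWalks.
Context {N : nat} (B : rel 'I_N) (w : nat).
Hypothesis degB : forall x, (\sum_y B x y <= w)%N.
Hypothesis w0 : (0 < w)%N.
Implicit Types (x y : 'I_N) (s q : seq 'I_N).

Lemma nverts_cons x s : nverts (x :: s) = (nverts [seq y <- s | y != x]).+1.
Proof.
rewrite /nverts; have xU : x \in undup (x :: s) by rewrite mem_undup inE eqxx.
rewrite (perm_size (perm_to_rem xU)); congr _.+1.
by rewrite rem_filter ?undup_uniq// filter_undup /= eqxx.
Qed.

Lemma leq_expn2r m n e : (m <= n -> m ^ e <= n ^ e)%N.
Proof. by case: e => [|e] mn; rewrite ?expn0// leq_exp2r. Qed.

Lemma sum_mem_le s : (\sum_x (x \in s) <= size s)%N.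
Proof.
rewrite [X in (X <= _)%N](_ : _ = #|[pred x | x \in s]|); last first.
  by rewrite -sum1_card [RHS]big_mkcond /=; apply: eq_bigr => x _; case: (x \in s).
exact: card_size.
Qed.

(** Each step of a walk leads to one of at most [w] neighbours, and to one of
    boundedly many vertices if it does not discover a new one. *)
Lemma count_paths_avoiding n x s p :
  (\sum_(q : n.-tuple 'I_N)
     (path B x q && (nverts [seq y <- q | y \notin s] <= p)) <=
   (size s + n) ^ n * w ^ p)%N.
Proof.
pose f x s p q := nat_of_bool (path B x q && (nverts [seq y <- q | y \notin s] <= p)%N).
rewrite -/(f x s p _); elim: n x s p => [|n IH] x s p.
  rewrite (sum_tuple0 (f x s p)) expn0 mul1n /f /=.
  by rewrite expn_gt0 w0.
rewrite (sum_tuple_cons _ (f x s p)).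
pose C := ((size s + n.+1) ^ n * w ^ p)%N.
apply: (@leq_trans (\sum_y ((y \in s) * C + B x y * ((size s + n.+1) ^ n * w ^ p.-1) * (0 < p)))%N).
  apply: leq_sum => y _; rewrite /f /=.
  have [ys|ys] /= := boolP (y \in s).
    rewrite mul1n (leq_trans _ (leq_addr _ _))// (leq_trans _ (_ : (size s + n) ^ n * w ^ p <= C)%N)//.
      rewrite (leq_trans _ (IH y s p))// leq_sum// => q _.
      by rewrite /f; case: (B x y); case: (path _ _ _).
    by rewrite leq_mul2r leq_expn2r ?orbT// addnS.
  rewrite mul0n add0n; case Bxy: (B x y); last by rewrite big1.
  case: p {C} => [|p] /=; rewrite ?muln0 ?muln1 ?mul1n.
    by rewrite big1 // => q _; rewrite nverts_cons andbF.
  rewrite addnS -addSn (leq_trans _ (IH y (y :: s) p))// leq_sum// => q _.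
  rewrite /f nverts_cons ltnS -filter_predI.
  rewrite (@eq_filter _ (predI _ _) [pred z | z \notin y :: s]) // => z.
  by rewrite /= inE negb_or.
rewrite big_split /= -!big_distrl /=.
have -> : ((size s + n.+1) ^ n.+1 * w ^ p = (size s + n.+1) * C)%N.
  by rewrite expnS mulnA.
rewrite [leqRHS](_ : _ = size s * C + n.+1 * C)%N ?mulnDl//.
apply: leq_add; first by rewrite leq_mul2r sum_mem_le orbT.
rewrite (@leq_trans C)//; last by rewrite mulSn leq_addr.
case: p @C => [|p] C; first by rewrite muln0.
by rewrite muln1 /C expnS [leqRHS]mulnCA leq_mul2r degB orbT.
Qed.

Lemma count_paths n x p :
  (\sum_(q : n.-tuple 'I_N) (path B x q && (nverts (x :: q) <= p.+1)) <=
   n.+1 ^ n * w ^ p)%N.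
Proof.
rewrite (leq_trans _ (count_paths_avoiding n x [:: x] p))// leq_sum// => q _.
rewrite nverts_cons ltnS (@eq_filter _ _ [pred z | z \notin [:: x]])// => z.
by rewrite /= inE.
Qed.

End CountWalks.

(** * Recursion for the expected number of closed walks *)

(** [ballot v h k] is the weighted number of lattice paths of [k] steps from
    height [h] to [0] that stay nonnegative, a step down having weight [v]. *)
Fixpoint ballot {R : pzRingType} (v : R) (h k : nat) : R :=
  if k is k'.+1 then
    ballot v h.+1 k' + (if h is h'.+1 then v * ballot v h' k' else 0)
  else (h == 0%N)%:R.

Section MomentRecursion.
Context {R : realFieldType} {N : nat} (mu : nat -> R).
Hypotheses (mu0 : mu 0 = 1) (mu1 : mu 1 = 0).
Variables (B : rel 'I_N) (w : nat) (s : R).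
Hypotheses (symB : symmetric B) (w0 : (0 < w)%N).
Hypothesis degB : forall x, (\sum_y B x y <= w)%N.
Hypotheses (s1 : 1 <= s) (s2 : s ^+ 2 = w%:R).
Implicit Types (x y : 'I_N) (p q : seq 'I_N).

Definition defect x : nat := (w - \sum_y B x y)%N.

Definition total_defect : nat := (\sum_x defect x)%N.

(** The joint moments of the closed walks of length [n] whose first [h] steps
    reach pairwise distinct vertices; the index [h] plays the part of the height
    in a Dyck path. *)
Definition walk_sum (h n : nat) : R :=
  \sum_x \sum_(q : n.-tuple 'I_N)
    if last x q == x then
      if path B x q && uniq (x :: take h q) then joint_moment mu (path_edges x q)
      else 0
    else 0.

Lemma walk_sum_diag h : walk_sum h h = if h == 0%N then N%:R else 0.
Proof.
case: h => [|h] /=; rewrite /walk_sum.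
  rewrite (eq_bigr (fun=> 1)) ?sumr_const ?card_ord// => x _.
  rewrite (sum_tuple0 (fun q => if last x q == x then
      if path B x q && uniq (x :: take 0 q) then joint_moment mu (path_edges x q)
      else 0 else 0)) /= eqxx.
  by rewrite /joint_moment big1.
apply: big1 => x _; apply: big1 => q _; rewrite take_oversize ?size_tuple//.
case: ifPn => // /eqP lx.
suff -> : uniq (x :: q) = false by rewrite andbF.
case: q lx => [[//|y q] sq] /= lx.
by rewrite -lx mem_last.
Qed.

Let K n := moment_bound mu n.

Let jm_le n (es : seq ('I_N * 'I_N)) : (size es <= n)%N -> `|joint_moment mu es| <= K n.
Proof. exact: joint_moment_le. Qed.

Lemma count_paths_half n k x :
  \sum_(q : n.-tuple 'I_N)
    (path B x q && (2 * nverts (x :: q) <= k + 2)%N)%:R <= (n.+1 ^ n)%:R * s ^+ k.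
Proof.
rewrite (@le_trans _ _ ((n.+1 ^ n)%:R * w%:R ^+ k./2)) //; last first.
  rewrite ler_wpM2l// -s2 -exprM; apply: ler_weXn2l => //.
  by rewrite mul2n -[leqRHS]odd_double_half leq_addl.
rewrite -natrX -natrM -natr_sum ler_nat.
apply: leq_trans (count_paths degB w0 n x k./2); apply: leq_sum => q _.
case: (path _ _ _) => //=; have [h|//] := leqP (2 * _)%N.
suff -> : (nverts (x :: q) <= k./2.+1)%N by [].
move: h; move: (nverts _) => a.
by rewrite -{1}(odd_double_half k) -mul2n; case: (odd k); lia.
Qed.

Lemma weighted_count_half n k (phi : 'I_N -> R) : (forall x, 0 <= phi x) ->
  \sum_x \sum_(q : n.-tuple 'I_N)
    phi x * (path B x q && (2 * nverts (x :: q) <= k + 2)%N)%:R <=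
  (n.+1 ^ n)%:R * s ^+ k * \sum_x phi x.
Proof.
move=> phi0; rewrite mulr_sumr; apply: ler_sum => x _; rewrite -mulr_sumr mulrC.
by rewrite ler_wpM2r// count_paths_half.
Qed.

(** A closed walk with [h] distinct steps that returns to its base point by the
    edge it has just left forces this edge to be used twice, and the new vertex
    can be any of about [w] neighbours; the other ways to close up are rare. *)
Lemma backtrack_bound h n y q :
  size q = n -> path B y q ->
  `|\sum_x (if B x y && (x \notin y :: take h q)
      then joint_moment mu (edge x y :: edge x y :: path_edges y q) else 0) -
    mu 2 * w%:R * joint_moment mu (path_edges y q)| <=
  K n.+2 * (`|mu 2| * (defect y + n.+1)%:R * (2 * nverts (y :: q) <= n + 2)%N%:R +
            n.+1%:R * (2 * nverts (y :: q) <= n.+1 + 2)%N%:R).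
Proof.
move=> sq pq; set J := joint_moment mu (path_edges y q).
have JK : `|J| <= K n.+2 * (2 * nverts (y :: q) <= n + 2)%N%:R.
  have [->|/(nverts_path mu1)] := eqVneq J 0.
    by rewrite normr0 mulr_ge0// moment_bound_ge0.
  rewrite sq => ->; rewrite mulr1 jm_le// size_path_edges sq.
  by rewrite -addn2 leq_addr.
pose old x : R := if B x y && (x \notin y :: take h q) && (x \in y :: q)
      then joint_moment mu (edge x y :: edge x y :: path_edges y q) else 0.
have -> : \sum_x (if B x y && (x \notin y :: take h q)
      then joint_moment mu (edge x y :: edge x y :: path_edges y q) else 0) =
   mu 2 * J * (\sum_x (B x y && (x \notin y :: q)))%:R + \sum_x old x.
  rewrite natr_sum mulr_sumr -big_split; apply: eq_bigr => x _ /=.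
  rewrite /old; case: (B x y) => /=; last by rewrite mulr0 addr0.
  have [xq|xq] := boolP (x \in y :: q); first by rewrite mulr0 add0r andbT.
  rewrite andbF addr0 mulr1 joint_moment_pair//; last first.
    by apply: contra xq => /path_edges_endpoints /andP[].
  case: ifPn => //; rewrite negbK => xt; case/negP: xq; move: xt; rewrite !inE.
  by case/predU1P => [->|/mem_take ->]; rewrite ?eqxx ?orbT.
have sumB : (\sum_x B x y + defect y = w)%N.
  by rewrite /defect (eq_bigr (fun x => B y x : nat)) ?subnKC// => x _; rewrite symB.
have split_new : (\sum_x B x y = \sum_x (B x y && (x \notin y :: q)) +
    \sum_x (B x y && (x \in y :: q)))%N.
  rewrite -big_split; apply: eq_bigr => x _ /=.
  by case: (B x y); case: (x \in _).
have few : (\sum_x (B x y && (x \in y :: q)) <= n.+1)%N.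
  apply: leq_trans (_ : \sum_x (x \in y :: q) <= n.+1)%N.
    by apply: leq_sum => x _; case: (B x y).
  by rewrite (leq_trans (sum_mem_le _))//= sq.
have wE : w%:R = (\sum_x (B x y && (x \notin y :: q)))%:R +
   (\sum_x (B x y && (x \in y :: q)) + defect y)%:R :> R.
  by rewrite -natrD addnA -split_new sumB.
rewrite wE; set a : R := (\sum_x _)%:R; set c := (_ + _)%N.
rewrite [X in `|X|](_ : _ = - (mu 2 * c%:R * J) + \sum_x old x); last by ring.
rewrite (le_trans (ler_normD _ _))// mulrDr lerD//.
  rewrite normrN 2!normrM (ger0_norm (ler0n _ _)).
  rewrite [leRHS](_ : _ = `|mu 2| * (defect y + n.+1)%:R *
    (K n.+2 * (2 * nverts (y :: q) <= n + 2)%N%:R)); last by ring.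
  by rewrite ler_pM// ?mulr_ge0// ler_wpM2l// ler_nat /c [leqRHS]addnC leq_add2r.
rewrite (le_trans (ler_norm_sum _ _ _))//.
pose t : R := K n.+2 * (2 * nverts (y :: q) <= n.+1 + 2)%N%:R.
rewrite (@le_trans _ _ (\sum_x (B x y && (x \in y :: q))%:R * t))//; last first.
  rewrite -mulr_suml -natr_sum [leRHS]mulrCA ler_wpM2r//.
    by rewrite mulr_ge0// moment_bound_ge0.
  by rewrite ler_nat.
apply: ler_sum => x _; rewrite /old; case: (B x y) => /=; last by rewrite normr0 mul0r.
have [xq|xq] := boolP (x \in y :: q); last by rewrite andbF normr0 mul0r.
rewrite mul1r andbT; case: ifP => _; last first.
  by rewrite normr0 mulr_ge0// moment_bound_ge0.
set J' := joint_moment mu _.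
have [->|/(nverts_backtrack mu1 xq)] := eqVneq J' 0.
  by rewrite normr0 mulr_ge0// moment_bound_ge0.
by rewrite /t sq addSnnS => ->; rewrite mulr1 jm_le//= size_path_edges sq.
Qed.

(** Rotating the walk turns the condition on the first [h.+1] steps into one on
    the first [h] steps and on the last vertex. *)
Lemma walk_sum_rotate h m : (h <= m)%N ->
  walk_sum h m.+1 = walk_sum h.+1 m.+1 +
  \sum_x \sum_(p : m.-tuple 'I_N)
    if [&& path B x p, B (last x p) x, uniq (x :: take h p) & last x p \in x :: take h p]
    then joint_moment mu (edge (last x p) x :: path_edges x p) else 0.
Proof.
move=> hm; rewrite {1}/walk_sum (sum_closed_rcons _ (fun x q =>
  if path B x q && uniq (x :: take h q) then joint_moment mu (path_edges x q) else 0)).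
rewrite /walk_sum (sum_closed_cons _ (fun x q =>
  if path B x q && uniq (x :: take h.+1 q) then joint_moment mu (path_edges x q) else 0)).
rewrite -big_split; apply: eq_bigr => x _; rewrite -big_split; apply: eq_bigr => p _.
rewrite rcons_path -[in take _ _]cats1 takel_cat ?size_tuple//=.
have -> : joint_moment mu (path_edges x (rcons p x)) =
    joint_moment mu (edge (last x p) x :: path_edges x p).
  by apply: joint_moment_perm; rewrite path_edges_rcons perm_rcons.
case: (path B x p) => /=; last by rewrite andbF addr0.
case: (B _ x) => /=; last by rewrite addr0.
case: (uniq (take h p)); rewrite ?andbF ?andbT ?addr0//.
case: (x \notin take h p) => /=; rewrite ?andbF ?andbT ?addr0//.
by case: (last x p \in _); rewrite /= ?addr0 ?add0r.
Qed.

(** The last vertex lies on the initial segment without being the vertex after [x],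
    so that the closing edge completes a proper cycle or is a loop, which costs a
    vertex. *)
Lemma rare_closure h m x p :
  size p = m -> path B x p -> uniq (x :: take h p) ->
  last x p \in x :: take h p -> (h == 0%N) || (last x p != head x p) ->
  `|joint_moment mu (edge (last x p) x :: path_edges x p)| <=
  K m.+1 * (path B x p && (2 * nverts (x :: p) <= m + 2)%N)%:R.
Proof.
move=> sp pp up lp hl; rewrite pp /=.
have [p1 [p2 [pE lE up1 sp1]]] : exists p1 p2,
    [/\ p = p1 ++ p2, last x p1 = last x p, uniq (x :: p1) & size p1 != 1%N].
  have pE := cat_take_drop h p.
  have [p1 [p2 [tE lE]]] : exists p1 p2, take h p = p1 ++ p2 /\ last x p1 = last x p.
    by case/splitPl: lp => p1 p2 lp1; exists p1, p2.
  exists p1, (p2 ++ drop h p); rewrite catA -tE pE; split => //.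
    by move: up; rewrite tE -cat_cons cat_uniq => /andP[].
  apply/eqP => sp1; case/orP: hl => [/eqP h0|].
    by move: tE; rewrite h0 take0; case: p1 sp1 {lE}.
  case: p1 sp1 tE lE => [//|a [|//]] _ tE /= <-.
  by rewrite -pE tE /= eqxx.
set J := joint_moment mu _.
have : J != 0 -> (2 * nverts (x :: p) <= m + 1)%N.
  by rewrite /J -lE -sp pE; apply: nverts_cycle => //; rewrite -pE.
have [->|_ /(_ isT) h2] := eqVneq J 0.
  by rewrite normr0 mulr_ge0// moment_bound_ge0.
rewrite (leq_trans h2) ?mulr1 ?jm_le//= ?size_path_edges ?sp//.
by rewrite leq_add2l.
Qed.

Definition rec_const m : R :=
  K m.+1 * (m.+1 ^ m)%:R * (1 + `|mu 2| * m.+1%:R + m%:R).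

(** The error in one step of the recursion, to be compared with [N]: the first term
    comes from walks with fewer vertices, the second from missing neighbours. *)
Definition rec_error : R := N%:R / s + total_defect%:R / s ^+ 2.

(** The step closing the walk is moved to its beginning. If it comes from a new
    vertex, the walk is counted at height [h.+1]; if it is the reverse of the next
    step, removing both steps yields a walk at height [h.-1]; the other walks are
    rare. *)
Lemma walk_sum_rec h m : (h <= m)%N ->
  `|walk_sum h m.+1 - (walk_sum h.+1 m.+1 +
     if h is h'.+1 then mu 2 * w%:R * walk_sum h' m.-1 else 0)| <=
  rec_const m * s ^+ m.+1 * rec_error.
Proof.
move=> hm; rewrite (walk_sum_rotate hm) opprD addrACA subrr add0r.
have s0 : 0 < s by rewrite (lt_le_trans ltr01).
have sn0 : s != 0 by rewrite gt_eqF.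
have Kp : 0 <= K m.+1 by exact: moment_bound_ge0.
have NsE : s ^+ m * N%:R <= s ^+ m.+1 * rec_error.
  rewrite exprSr -mulrA ler_wpM2l ?exprn_ge0 ?(ltW s0)// /rec_error mulrDr.
  rewrite mulrCA divff// mulr1 lerDl mulr_ge0 ?(ltW s0)// divr_ge0// exprn_ge0// ltW//.
have rare : \sum_x \sum_(p : m.-tuple 'I_N)
    K m.+1 * (path B x p && (2 * nverts (x :: p) <= m + 2)%N)%:R <=
    K m.+1 * (m.+1 ^ m)%:R * (s ^+ m.+1 * rec_error).
  have := @weighted_count_half m m (fun=> K m.+1) (fun=> Kp).
  move=> /le_trans; apply; rewrite sumr_const card_ord -[K m.+1 *+ N]mulr_natr.
  rewrite [leLHS](_ : _ = K m.+1 * (m.+1 ^ m)%:R * (s ^+ m * N%:R)); last by ring.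
  by rewrite ler_wpM2l// mulr_ge0.
case: h hm => [|h] hm.
  rewrite subr0 (le_trans (ler_norm_sum _ _ _))//.
  apply: le_trans (_ : K m.+1 * (m.+1 ^ m)%:R * (s ^+ m.+1 * rec_error) <= _).
    apply: le_trans rare; apply: ler_sum => x _.
    rewrite (le_trans (ler_norm_sum _ _ _))//; apply: ler_sum => p _.
    case: ifPn => [/and4P[pp _ up lp]|_]; last by rewrite normr0 mulr_ge0.
    by apply: (@rare_closure 0); rewrite ?size_tuple.
  have E0 : 0 <= s ^+ m.+1 * rec_error.
    by apply: le_trans NsE; rewrite mulr_ge0// exprn_ge0// ltW.
  rewrite /rec_const -[leRHS]mulrA ler_wpM2r//.
  by rewrite ler_peMr ?mulr_ge0// -addrA lerDl addr_ge0// mulr_ge0.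
case: m hm NsE rare Kp => [//|m] hm NsE rare Kp /=.
pose G x p := if [&& path B x p, B (last x p) x, uniq (x :: take h.+1 p)
      & last x p \in x :: take h.+1 p]
    then joint_moment mu (edge (last x p) x :: path_edges x p) else 0 : R.
pose Tb := \sum_x \sum_(p : m.+1.-tuple 'I_N) if last x p == head x p then G x p else 0.
pose Tr := \sum_x \sum_(p : m.+1.-tuple 'I_N) if last x p != head x p then G x p else 0.
rewrite [X in X - _](_ : _ = Tb + Tr); last first.
  rewrite -big_split; apply: eq_bigr => x _; rewrite -big_split; apply: eq_bigr => p _ /=.
  by case: eqP; rewrite ?addr0 ?add0r.
have Tr_le : `|Tr| <= K m.+2 * (m.+2 ^ m.+1)%:R * (s ^+ m.+2 * rec_error).
  rewrite (le_trans (ler_norm_sum _ _ _))//.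
  apply: le_trans rare; apply: ler_sum => x _.
  rewrite (le_trans (ler_norm_sum _ _ _))//; apply: ler_sum => p _.
  case: ifPn => [lp|_]; last by rewrite normr0 mulr_ge0.
  rewrite /G; case: ifPn => [/and4P[pp _ up lt]|_]; last by rewrite normr0 mulr_ge0.
  by apply: (@rare_closure h.+1); rewrite ?size_tuple ?lp ?orbT.
have TbE : Tb = \sum_y \sum_(q : m.-tuple 'I_N)
    if last y q == y then if path B y q && uniq (y :: take h q) then
      \sum_x (if B x y && (x \notin y :: take h q)
      then joint_moment mu (edge x y :: edge x y :: path_edges y q) else 0) else 0 else 0.
  rewrite /Tb; under eq_bigr => x _ do rewrite (sum_tuple_cons _ (fun p =>
    if last x p == head x p then G x p else 0)).
  rewrite exchange_big /=; apply: eq_bigr => y _; rewrite exchange_big /=.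
  apply: eq_bigr => q _; case: eqP => [lq|_]; last by rewrite big1.
  transitivity (\sum_x if path B y q && uniq (y :: take h q) then
      (if B x y && (x \notin y :: take h q)
      then joint_moment mu (edge x y :: edge x y :: path_edges y q) else 0) else 0); last first.
    by case: ifP => _ //; rewrite big1.
  apply: eq_bigr => x _; rewrite /G /= lq (symB x y) (edgeC y x) !inE eqxx orbT andbT.
  case: (B y x) => /=; last by case: ifP.
  by case: (path B y q) => //=; rewrite andbC; case: (_ && uniq _).
pose b y (q : m.-tuple 'I_N) : R := K m.+2 * (`|mu 2| * (defect y + m.+1)%:R *
   (path B y q && (2 * nverts (y :: q) <= m + 2)%N)%:R +
            m.+1%:R * (path B y q && (2 * nverts (y :: q) <= m.+1 + 2)%N)%:R).
have Tb_le : `|Tb - mu 2 * w%:R * walk_sum h m| <= \sum_y \sum_(q : m.-tuple 'I_N) b y q.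
  rewrite TbE mulr_sumr -sumrB (le_trans (ler_norm_sum _ _ _))//; apply: ler_sum => y _.
  rewrite mulr_sumr -sumrB (le_trans (ler_norm_sum _ _ _))//; apply: ler_sum => q _.
  have b0 : 0 <= b y q by rewrite mulr_ge0// addr_ge0// !mulr_ge0.
  case: ifP => _; last by rewrite mulr0 subr0 normr0.
  case: ifPn => [/andP[pq _]|_]; last by rewrite mulr0 subr0 normr0.
  by rewrite (le_trans (backtrack_bound h (size_tuple q) pq))// /b pq.
have b_le : \sum_y \sum_(q : m.-tuple 'I_N) b y q <=
    K m.+2 * (m.+2 ^ m.+1)%:R * (`|mu 2| * m.+2%:R + m.+1%:R) * (s ^+ m.+2 * rec_error).
  pose phi1 y : R := `|mu 2| * (defect y + m.+1)%:R.
  have phi10 y : 0 <= phi1 y by rewrite mulr_ge0.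
  have := @weighted_count_half m m phi1 phi10.
  have := @weighted_count_half m m.+1 (fun=> m.+1%:R) (fun=> ler0n _ _).
  set W2 := \sum_x \sum_q _ => W2_le; set W1 := \sum_x \sum_q _ => W1_le.
  have -> : \sum_y \sum_(q : m.-tuple 'I_N) b y q = K m.+2 * (W1 + W2).
    rewrite mulrDr !mulr_sumr -big_split; apply: eq_bigr => y _ /=.
    by rewrite !mulr_sumr -big_split; apply: eq_bigr => q _ /=; rewrite -mulrDr.
  rewrite -[leRHS]mulrA -[leRHS]mulrA ler_wpM2l//.
  apply: (le_trans (lerD W1_le W2_le)).
  have -> : \sum_y phi1 y = `|mu 2| * (total_defect%:R + m.+1%:R * N%:R).
    rewrite -mulr_sumr; congr (_ * _); rewrite /total_defect -natrM -natrD -natr_sum.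
    by rewrite big_split /= sum_nat_const card_ord mulnC.
  rewrite sumr_const card_ord -[m.+1%:R *+ N]mulr_natr.
  have C_le : (m.+1 ^ m)%:R <= (m.+2 ^ m.+1)%:R :> R.
    by rewrite ler_nat (leq_trans (leq_expn2r _ (leqnSn _)))// leq_pexp2l.
  have E_eq : s ^+ m.+2 * rec_error = s ^+ m.+1 * N%:R + s ^+ m * total_defect%:R.
    by rewrite /rec_error !exprS expr0; field.
  have sm : s ^+ m <= s ^+ m.+1 by apply: ler_weXn2l.
  have sm0 : 0 <= s ^+ m by rewrite exprn_ge0// ltW.
  have A0 : 0 <= s ^+ m.+1 * N%:R by rewrite mulr_ge0// exprn_ge0// ltW.
  apply: le_trans (_ : (m.+1 ^ m)%:R * ((`|mu 2| * m.+2%:R + m.+1%:R) *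
      (s ^+ m.+2 * rec_error)) <= _); last first.
    by rewrite ler_wpM2r// E_eq; apply: mulr_ge0; rewrite addr_ge0// mulr_ge0.
  rewrite [leLHS](_ : _ = (m.+1 ^ m)%:R * (`|mu 2| * (s ^+ m * total_defect%:R +
      m.+1%:R * (s ^+ m * N%:R)) + m.+1%:R * (s ^+ m.+1 * N%:R))); last by ring.
  rewrite ler_wpM2l// E_eq.
  have : s ^+ m * N%:R <= s ^+ m.+1 * N%:R by rewrite ler_wpM2r.
  have : 0 <= s ^+ m * total_defect%:R by rewrite mulr_ge0.
  move: A0; set X' := s ^+ m.+1 * N%:R; set X := s ^+ m * N%:R.
  set Y := s ^+ m * _; set a := `|mu 2|; have a0 : 0 <= a by exact: normr_ge0.
  move=> X'0 Y0 XX'; rewrite -(natr1 m.+1).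
  have c0 : 0 <= m.+1%:R :> R by exact: ler0n.
  move: c0; set c := m.+1%:R => c0.
  have : a * (Y + c * X) <= a * (Y + c * X') by rewrite ler_wpM2l// lerD2l ler_wpM2l.
  have : 0 <= a * X' by rewrite mulr_ge0.
  have : 0 <= c * Y by rewrite mulr_ge0.
  have : 0 <= a * (c * Y) by rewrite !mulr_ge0.
  have : 0 <= a * Y by rewrite mulr_ge0.
  lra.
apply: le_trans (_ : `|Tb - mu 2 * w%:R * walk_sum h m| + `|Tr| <= _).
  by rewrite addrAC ler_normD.
rewrite (le_trans (lerD (le_trans Tb_le b_le) Tr_le))// /rec_const.
by rewrite le_eqVlt; apply/orP; left; apply/eqP; ring.
Qed.

Fixpoint walk_const (h k : nat) : R :=
  if k is k'.+1 then rec_const (h + k') +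
    (walk_const h.+1 k' + (if h is h'.+1 then `|mu 2| * walk_const h' k' else 0))
  else 0.

(** The recursions of [walk_sum] and of [ballot] agree up to the factor
    [N * s ^+ n], where [s ^+ 2 = w], and the errors of [k] steps add up. *)
Lemma walk_sum_ballot h k :
  `|walk_sum h (h + k) - ballot (mu 2) h k * (N%:R * s ^+ (h + k))| <=
  walk_const h k * (s ^+ (h + k) * rec_error).
Proof.
have s0 : 0 < s by rewrite (lt_le_trans ltr01).
elim: k h => [|k IH] h /=.
  rewrite addn0 walk_sum_diag mul0r; case: eqP => [->|_].
    by rewrite expr0 !mulr1 mul1r subrr normr0.
  by rewrite mul0r subrr normr0.
have T (W W1 c b1 b2 A e d : R) : `|W - (W1 + c)| <= A -> `|W1 - b1| <= e ->
    `|c - b2| <= d -> `|W - (b1 + b2)| <= A + (e + d).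
  move=> h1 h2 h3.
  have -> : W - (b1 + b2) = (W - (W1 + c)) + ((W1 - b1) + (c - b2)) by ring.
  by rewrite (le_trans (ler_normD _ _))// lerD// (le_trans (ler_normD _ _))// lerD.
have H := walk_sum_rec (leq_addr k h); rewrite -addnS -mulrA in H.
have H1 := IH h.+1; rewrite addSnnS in H1.
rewrite [_ * (N%:R * _)]mulrDl [leRHS]mulrDl [X in _ <= _ + X]mulrDl.
apply: (T _ _ _ _ _ _ _ _ H H1).
case: h {H H1} => [|h]; first by rewrite !mul0r subrr normr0.
have := IH h; rewrite addSn addnS /= -s2.
set W := walk_sum _ _; set b := ballot _ _ _; set C := walk_const _ _.
move=> H2; rewrite [X in `|X|](_ : _ =
    mu 2 * s ^+ 2 * (W - b * (N%:R * s ^+ (h + k)))); last first.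
  by rewrite !exprS expr0; ring.
rewrite normrM normrM [`|s ^+ 2|]ger0_norm ?sqr_ge0//.
rewrite [leRHS](_ : _ = `|mu 2| * s ^+ 2 * (C * (s ^+ (h + k) * rec_error))).
  by rewrite ler_wpM2l// mulr_ge0// sqr_ge0.
by rewrite addSn !exprS expr0; ring.
Qed.

End MomentRecursion.

(** * Correlated pairs of closed walks *)

Lemma sum_tuple_cat {V : nmodType} {T : finType} m n (F : seq T -> V) :
  \sum_(t : (m + n).-tuple T) F t =
  \sum_(p : m.-tuple T) \sum_(q : n.-tuple T) F (p ++ q).
Proof.
elim: m F => [|m IH] F; first by rewrite (sum_tuple0 (fun p => \sum_(q : n.-tuple T) F (p ++ q))).
rewrite (sum_tuple_cons (m + n)) (sum_tuple_cons m (fun p => \sum_(q : n.-tuple T) F (p ++ q))).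
by apply: eq_bigr => x _; rewrite (IH (fun t => F (x :: t))).
Qed.

Section PairCount.
Context {R : realFieldType} {N : nat} (mu : nat -> R).
Hypotheses (mu0 : mu 0 = 1) (mu1 : mu 1 = 0).
Variables (B : rel 'I_N) (w : nat).
Hypotheses (w0 : (0 < w)%N) (degB : forall x, (\sum_y B x y <= w)%N).
Implicit Types (x y : 'I_N) (p q u : seq 'I_N).

Let rooted_pair n u u' : nat :=
  [&& cycle B u, cycle B u', ohead u == ohead u' & (nverts (u ++ u') <= n)%N].

(** Two closed walks with a common base point make up one walk from this point. *)
Lemma count_rooted_pairs n :
  (\sum_(u : n.+1.-tuple 'I_N) \sum_(u' : n.+1.-tuple 'I_N) rooted_pair n.+1 u u' <=
   N * ((n + n.+1).+1 ^ (n + n.+1) * w ^ n))%N.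
Proof.
pose f x q : nat := path B x q && (nverts (x :: q) <= n.+1)%N.
apply: (@leq_trans (\sum_x \sum_(t : (n + n.+1).-tuple 'I_N) f x t)); last first.
  rewrite -[N in (N * _)%N]card_ord -sum_nat_const; apply: leq_sum => x _.
  exact: (count_paths degB w0).
rewrite (sum_tuple_cons n (fun u => \sum_(u' : n.+1.-tuple 'I_N) rooted_pair n.+1 u u')).
apply: leq_sum => x _; rewrite (sum_tuple_cat n n.+1 (f x)); apply: leq_sum => p _.
rewrite (sum_tuple_cons n (rooted_pair n.+1 (x :: p))).
rewrite (sum_tuple_cons n (fun q => f x (p ++ q))).
apply: leq_sum => y _; apply: leq_sum => q _.
rewrite /rooted_pair /f /=; have [[<-]|xy] := eqVneq (Some x) (Some y); last first.
  by rewrite /= !andbF.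
rewrite cat_path /= !rcons_path; case: (path B x p) => //=.
case: (B _ x) => //=; case: (path B x q) => //=.
by case: (B _ x).
Qed.

Definition pair_bound n : R :=
  (moment_bound mu (2 * n) + moment_bound mu n ^+ 2) * (n ^ 2)%:R *
  ((2 * n) ^ (2 * n))%:R.

Lemma pair_bound_ge0 n : 0 <= pair_bound n.
Proof.
rewrite mulr_ge0// mulr_ge0// addr_ge0 ?moment_bound_ge0//.
by rewrite exprn_ge0// moment_bound_ge0.
Qed.

(** Correlated closed walks share a vertex, so that a rotation of each gives them a
    common base point. Together they have at most [n.+1] vertices: one can be chosen
    freely, the others are reached by steps along the band. *)
Lemma correlated_pairs n :
  \sum_(u : n.+1.-tuple 'I_N) \sum_(u' : n.+1.-tuple 'I_N)
    (if cycle B u && cycle B u' then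
      `|joint_moment mu (cycle_edges u ++ cycle_edges u') -
        joint_moment mu (cycle_edges u) * joint_moment mu (cycle_edges u')|
     else 0) <= pair_bound n.+1 * (N * w ^ n)%:R.
Proof.
set k := n.+1.
pose K2 := moment_bound mu (2 * k) + moment_bound mu k ^+ 2.
have K20 : 0 <= K2 
  by rewrite addr_ge0 ?moment_bound_ge0// exprn_ge0// moment_bound_ge0.
apply: (@le_trans _ _ (\sum_(u : k.-tuple 'I_N) \sum_(u' : k.-tuple 'I_N)
   K2 * (\sum_(i < k) \sum_(j < k) rooted_pair k (rot i u) (rot j u'))%:R)).
  apply: ler_sum => u _; apply: ler_sum => u' _.
  have rhs0 : 0 <= K2 * (\sum_(i < k) \sum_(j < k) rooted_pair k (rot i u) (rot j u'))%:R.
    by rewrite mulr_ge0.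
  case: ifPn => // /andP[cu cu'].
  set d := _ - _; have [->|d0] := eqVneq d 0; first by rewrite normr0.
  have [] := @nverts_pair _ _ mu mu1 k u u' mu0 (size_tuple u) (size_tuple u').
    by rewrite -subr_eq0.
  move=> [a au au'] nv.
  apply: (@le_trans _ _ (K2 * 1)).
    rewrite mulr1 /d (le_trans (ler_normB _ _))// lerD//.
      by rewrite joint_moment_le// size_cat !size_cycle_edges !size_tuple mul2n addnn.
    by rewrite normrM expr2 ler_pM// joint_moment_le// size_cycle_edges size_tuple.
  rewrite ler_wpM2l// ler1n.
  have iu : (index a u < k)%N by rewrite -[X in (_ < X)%N](size_tuple u) index_mem.
  have iu' : (index a u' < k)%N by rewrite -[X in (_ < X)%N](size_tuple u') index_mem.
  rewrite (bigD1 (Ordinal iu))//= (bigD1 (Ordinal iu'))//= -addnA ltn_addr//.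
  have hd (v : seq 'I_N) : a \in v -> ohead (rot (index a v) v) = Some a.
    by move=> av; rewrite /rot (drop_nth a) ?index_mem// nth_index.
  rewrite /rooted_pair !rot_cycle cu cu' !hd// eqxx /= lt0b.
  rewrite (leq_trans _ nv)// (@nverts_perm _ _ (u ++ u'))//.
  by apply: perm_cat; rewrite perm_rot.
under eq_bigr => u _ do rewrite -mulr_sumr -natr_sum.
rewrite -mulr_sumr -natr_sum.
have -> : (\sum_(u : k.-tuple 'I_N) \sum_(u' : k.-tuple 'I_N)
    \sum_(i < k) \sum_(j < k) rooted_pair k (rot i u) (rot j u') =
    k ^ 2 * \sum_(u : k.-tuple 'I_N) \sum_(u' : k.-tuple 'I_N) rooted_pair k u u')%N.
  under eq_bigr => u _ do rewrite exchange_big.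
  rewrite exchange_big /=.
  under eq_bigr => i _ do (under eq_bigr => u _ do rewrite exchange_big; rewrite exchange_big /=).
  have E (i j : 'I_k) : (\sum_(u : k.-tuple 'I_N) \sum_(u' : k.-tuple 'I_N)
      rooted_pair k (rot i u) (rot j u') =
      \sum_(u : k.-tuple 'I_N) \sum_(u' : k.-tuple 'I_N) rooted_pair k u u')%N.
    under eq_bigr => u _ do rewrite (sum_tuple_rot k j (rooted_pair k (rot i u))).
    exact: (sum_tuple_rot k i (fun u => \sum_(u' : k.-tuple 'I_N) rooted_pair k u u')).
  under eq_bigr => i _ do under eq_bigr => j _ do rewrite E.
  by rewrite !sum_nat_const !card_ord mulnA.
rewrite /pair_bound -/K2 -[leRHS]mulrA -[leRHS]mulrA ler_wpM2l// -!natrM ler_nat.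
rewrite leq_mul2l; apply/orP; right.
rewrite (leq_trans (count_rooted_pairs n))// mulnCA.
rewrite leq_mul2r; apply/orP; right.
have -> : ((n + n.+1).+1 = 2 * k)%N by rewrite /k; lia.
by rewrite leq_pexp2l// /k; lia.
Qed.

End PairCount.

(** * Integration against a density and products of independent variables *)

Section Density.
Context d d' (T : measurableType d) (T' : measurableType d') (R : realType).
Variables (mu : {measure set T -> \bar R}) (nu : {measure set T' -> \bar R}).
Variables (Y : T -> T') (g : T -> R).
Hypotheses (mY : measurable_fun setT Y) (mg : measurable_fun setT g).
Hypothesis g0 : forall x, 0 <= g x.
Hypothesis nuE : forall A, measurable A ->
  nu A = (\int[mu]_x (\1_(Y @^-1` A) x * g x)%:E)%E.

Import HBNNSimple.

Let mYpre A : measurable A -> measurable (Y @^-1` A).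
Proof. by move=> mA; rewrite -[_ @^-1` _]setTI; exact: mY. Qed.

Let density_nnsfun (h : {nnsfun T' >-> R}) :
  (\int[nu]_x (h x)%:E = \int[mu]_x (h (Y x) * g x)%:E)%E.
Proof.
rewrite integralT_nnsfun sintegralE.
transitivity (\sum_(r \in range h)
    \int[mu]_x (r * (\1_(Y @^-1` (h @^-1` [set r])) x * g x))%:E)%E; last first.
  rewrite -ge0_integral_fsum//; last 2 first.
  - move=> r; apply/measurable_EFinP; apply: measurable_funM => //.
    apply: measurable_funM => //; exact/measurable_indic/mYpre.
  - move=> r x _; rewrite lee_fin; have [rh|rh] := pselect (range h r).
      by case: rh => y _ <-; rewrite mulr_ge0// mulr_ge0.
    rewrite indicE memNset ?mul0r ?mulr0// => yr.
    by apply: rh; exists (Y x).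
  apply: eq_integral => x _; rewrite fsumEFin//; congr EFin.
  by rewrite [in RHS]fimfunE mulr_fsuml; apply: eq_fsbigr => r _; rewrite mulrA.
apply: eq_fsbigr => r; rewrite inE => -[y _ <-].
under eq_integral => x _ do rewrite EFinM.
rewrite ge0_integralZl_EFin//.
- by rewrite nuE.
- by move=> x _; rewrite lee_fin mulr_ge0.
- by apply/measurable_EFinP/measurable_funM => //; exact/measurable_indic/mYpre.
Qed.

(** This combines a change of variable with the integration against a density, and
    serves both for the laws of the entries and for the semicircle law. *)
Lemma ge0_integral_density (f : T' -> R) : measurable_fun setT f ->
  (forall x, 0 <= f x) ->
  (\int[nu]_x (f x)%:E = \int[mu]_x (f (Y x) * g x)%:E)%E.
Proof.
move=> mf f0; have mf' : measurable_fun setT (EFin \o f) by exact/measurable_EFinP.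
have f0' x : setT x -> (0 <= (EFin \o f) x)%E by rewrite lee_fin.
pose f_ := nnsfun_approx measurableT mf'.
have mono : forall x, {homo f_^~ x : m n / (m <= n)%N >-> (m <= n)%R}.
  by move=> x m n mn; exact/lefP/nd_nnsfun_approx.
transitivity (limn (fun n => \int[nu]_x (f_ n x)%:E)%E).
  rewrite -monotone_convergence//.
  - apply: eq_integral => y _; apply/esym/cvg_lim => //.
    exact: (@cvg_nnsfun_approx _ _ _ _ measurableT _ mf' f0').
  - by move=> n; exact/measurable_EFinP/measurable_funP.
  - by move=> n y _; rewrite lee_fin.
  - by move=> y _ m n mn; rewrite lee_fin mono.
transitivity (limn (fun n => \int[mu]_x (f_ n (Y x) * g x)%:E)%E).
  by congr (limn _); apply/funext => n; exact: density_nnsfun.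
rewrite -monotone_convergence//.
- apply: eq_integral => x _; apply/cvg_lim => //=.
  rewrite EFinM; under eq_fun do rewrite EFinM.
  apply: cvgeZr => //.
  exact: (@cvg_nnsfun_approx _ _ _ _ measurableT _ mf' f0').
- move=> n; apply/measurable_EFinP/measurable_funM => //.
  by apply: measurableT_comp => //; exact: measurable_funP.
- by move=> n x _; rewrite lee_fin mulr_ge0.
- by move=> x _ m n mn; rewrite lee_fin ler_wpM2r// mono.
Qed.

Lemma integral_density (f : T' -> R) : measurable_fun setT f ->
  (\int[nu]_x (f x)%:E = \int[mu]_x (f (Y x) * g x)%:E)%E.
Proof.
move=> mf; rewrite integralE [RHS]integralE.
have posE : (fun x => (f (Y x) * g x)%:E)^\+%E =
    (fun x => (Num.max (f (Y x)) 0 * g x)%:E).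
  by apply/funext => x; rewrite funeposE -EFin_max maxr_pMl// mul0r.
have negE : (fun x => (f (Y x) * g x)%:E)^\-%E =
    (fun x => (Num.max (- f (Y x)) 0 * g x)%:E).
  by apply/funext => x; rewrite funenegE -EFinN -EFin_max maxr_pMl// mul0r mulNr.
rewrite posE negE -(@ge0_integral_density (fun y => Num.max (f y) 0)); last 2 first.
- exact: measurable_maxr.
- by move=> y; rewrite le_max lexx orbT.
rewrite -(@ge0_integral_density (fun y => Num.max (- f y) 0)); last 2 first.
- by apply: measurable_maxr => //; exact: measurableT_comp.
- by move=> y; rewrite le_max lexx orbT.
congr (_ - _)%E; apply: eq_integral => y _.
  by rewrite funeposE EFin_max.
by rewrite funenegE -EFinN EFin_max.
Qed.

End Density.

Section IndependentProducts.
Context d (Omega : measurableType d) (R : realType) (P : probability Omega R).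
Context (I : finType) (D : {set I}) (Y : I -> {RV P >-> R}).
Hypothesis indY : mutually_independent D Y.
Implicit Types (J : {set I}) (f : I -> R -> R).

Let mcomp (f : R -> R) i : measurable_fun setT f ->
  measurable_fun setT (fun w => f (Y i w)).
Proof. by move=> mf; apply: measurableT_comp => //; exact: measurable_funP. Qed.

Let mprod J f : (forall i, measurable_fun setT (f i)) ->
  measurable_fun setT (fun w => \prod_(i in J) f i (Y i w)).
Proof.
move=> mf; under eq_fun do rewrite -big_enum.
by apply: measurable_prod => i _; exact: mcomp.
Qed.

Lemma prod_fin_num J (u : I -> \bar R) : (forall i, i \in J -> u i \is a fin_num) ->
  (\prod_(i in J) u i)%E = (\prod_(i in J) fine (u i))%:E.
Proof.
move=> fu; rewrite -prodEFin; apply: eq_bigr => i iJ.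
by rewrite fineK// fu.
Qed.

(** The product rule for indicators is the definition of independence; one
    factor at a time is then replaced by an arbitrary function, both sides
    being integrals of this factor against the same measure. *)
Lemma ge0_integral_indep_prod (s : seq I) J f : J \subset D ->
  (forall i, measurable_fun setT (f i)) -> (forall i x, 0 <= f i x) ->
  (forall i, i \in J -> (\int[P]_w (f i (Y i w))%:E < +oo)%E) ->
  (forall i, i \in J -> i \notin s ->
    exists2 B, measurable B & f i = \1_B :> (R -> R)) ->
  (\int[P]_w (\prod_(i in J) f i (Y i w))%:E =
   \prod_(i in J) \int[P]_w (f i (Y i w))%:E)%E.
Proof.
move=> JD; elim: s f => [|i0 s IH] f mf f0 fi hs.
  pose B i := f i @^-1` [set 1].
  have mB i : measurable (B i) by rewrite -[B i]setTI; exact: mf.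
  have fE i : i \in J -> f i = \1_(B i).
    move=> /hs/(_ isT)[C mC fC]; rewrite /B fC; congr indic; apply/seteqP.
    split=> x; rewrite /= indicE.
      by move=> xC; rewrite mem_set.
    case: (boolP (x \in C)); first by rewrite inE.
    by move=> _ /eqP; rewrite eq_sym oner_eq0.
  transitivity (\int[P]_w (\1_(\bigcap_(i in [set` J]) (Y i @^-1` B i)) w)%:E)%E.
    apply: eq_integral => w _; congr EFin; rewrite indicE.
    have [/set_mem wJ|/negP wJ] := boolP (w \in _).
      by rewrite big1// => i iJ; rewrite fE// indicE mem_set//; exact: wJ.
    have [i [iJ nB]] : exists i, i \in J /\ ~ B i (Y i w).
      apply: contrapT => /forallNP h; apply: wJ; apply/mem_set => i /= iJ.
      by apply: contrapT => nB; apply: (h i).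
    by rewrite (bigD1 i)//= fE// indicE memNset// mul0r.
  have mYB i : measurable (Y i @^-1` B i).
    by rewrite -[_ @^-1` _]setTI; exact: measurable_funP.
  rewrite integral_indic//; last by apply: fin_bigcap_measurable.
  rewrite setIT; apply: (etrans (indY JD mB)); apply: eq_bigr => i iJ.
  rewrite -[Y i @^-1` B i]setIT -integral_indic//; apply: eq_integral => w _.
  by rewrite fE.
have [i0J|i0J] := boolP (i0 \in J); last first.
  apply: IH => // i iJ si; apply: hs => //; rewrite inE negb_or si andbT.
  by apply: contraNneq i0J => <-.
pose g w := \prod_(i in J | i != i0) f i (Y i w).
pose u i := (\int[P]_w (f i (Y i w))%:E)%E.
have u0 i : (0 <= u i)%E by apply: integral_ge0 => w _; rewrite lee_fin.
have ufin i : i \in J -> u i \is a fin_num.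
  by move=> iJ; rewrite ge0_fin_numE// fi.
have c0 : 0 <= \prod_(i in J | i != i0) fine (u i).
  by apply: prodr_ge0 => i _; exact: fine_ge0.
pose nu := mscale (NngNum c0) (distribution P (Y i0)).
have gE : (\prod_(i in J | i != i0) u i)%E = (\prod_(i in J | i != i0) fine (u i))%:E.
  by rewrite -prodEFin; apply: eq_bigr => i /andP[iJ _]; rewrite fineK// ufin.
have mg : measurable_fun setT g.
  rewrite (_ : g = fun w => \prod_(i in J :\ i0) f i (Y i w))%SET; first exact: mprod.
  by apply/funext => w; apply: eq_bigl => i; rewrite !inE andbC.
have g0 w : 0 <= g w by apply: prodr_ge0 => i _.
have nuE A : measurable A -> nu A = (\int[P]_w (\1_(Y i0 @^-1` A) w * g w)%:E)%E.
  move=> mA; pose f' i := if i == i0 then \1_A : R -> R else f i.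
  have mYA : measurable (Y i0 @^-1` A).
    by rewrite -[_ @^-1` _]setTI; exact: measurable_funP.
  have f'0 : (\int[P]_w (f' i0 (Y i0 w))%:E)%E = P (Y i0 @^-1` A).
    by rewrite /f' eqxx -[X in P X]setIT -integral_indic.
  have := IH f'; rewrite (bigD1 i0)//= f'0 => IH'.
  transitivity (\int[P]_w (\prod_(i in J) f' i (Y i w))%:E)%E; last first.
    apply: eq_integral => w _; congr EFin; rewrite (bigD1 i0)//= /f' eqxx.
    by congr (_ * _); apply: eq_bigr => i /andP[_ /negPf->].
  rewrite IH'.
  - rewrite /nu /mscale /= muleC -gE; congr (_ * _)%E.
    by apply: eq_bigr => i /andP[_ /negPf ii0]; rewrite /f' ii0.
  - by move=> i; rewrite /f'; case: eqP => // _; exact: measurable_indic.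
  - by move=> i x; rewrite /f'; case: eqP => // _; rewrite indicE.
  - move=> i iJ; have [->|ii0] := eqVneq i i0.
      by rewrite f'0 ltey_eq fin_num_measure.
    by rewrite /f' (negPf ii0); exact: fi.
  - move=> i iJ si; rewrite /f'; case: eqP => [_|/eqP ii0]; first by exists A.
    by apply: hs => //; rewrite inE (negPf ii0).
rewrite [RHS](bigD1 i0)//= -/(u i0) [X in (_ * X)%E]gE.
transitivity (\int[nu]_x (f i0 x)%:E)%E.
  have mYi0 : measurable_fun setT (Y i0) by exact: measurable_funP.
  rewrite (ge0_integral_density mYi0 mg g0 nuE (mf i0) (f0 i0)).
  by apply: eq_integral => w _; rewrite (bigD1 i0).
rewrite ge0_integral_mscale//=; last 2 first.
- exact/measurable_EFinP.
- by move=> x _; rewrite lee_fin.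
rewrite ge0_integral_distribution//; last 2 first.
- exact/measurable_EFinP.
- by move=> x; rewrite lee_fin.
by rewrite muleC.
Qed.

Let integrableR (h : Omega -> R) := P.-integrable setT (fun w => (h w)%:E).

Lemma integrable_indep_prod J f : J \subset D ->
  (forall i, measurable_fun setT (f i)) ->
  (forall i, i \in J -> integrableR (fun w => f i (Y i w))) ->
  integrableR (fun w => \prod_(i in J) f i (Y i w)).
Proof.
move=> JD mf fi; apply/integrableP; split.
  by apply/measurable_EFinP; exact: mprod.
rewrite (_ : (fun w => _) = (fun w => (\prod_(i in J) `|f i (Y i w)|)%:E)); last first.
  by apply/funext => w; rewrite /= normr_prod.
have mabs i : measurable_fun setT (fun x => `|f i x|) by exact: measurableT_comp.
have abs_fi i : i \in J -> (\int[P]_w (`|f i (Y i w)|)%:E < +oo)%E.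
  by move=> /fi /integrableP[].
rewrite (@ge0_integral_indep_prod (enum I) J (fun i x => `|f i x|))//; last first.
  by move=> i _; rewrite mem_enum.
rewrite ltey_eq prode_fin_num// => i iJ.
by rewrite ge0_fin_numE ?abs_fi// integral_ge0// => w _; rewrite lee_fin.
Qed.

Lemma Rintegral_indep_prod J f : J \subset D ->
  (forall i, measurable_fun setT (f i)) ->
  (forall i, i \in J -> integrableR (fun w => f i (Y i w))) ->
  \int[P]_w (\prod_(i in J) f i (Y i w)) = \prod_(i in J) \int[P]_w f i (Y i w).
Proof.
move=> JD; suff H (s : seq I) (g : I -> R -> R) : (forall i, measurable_fun setT (g i)) ->
  (forall i, i \in J -> integrableR (fun w => g i (Y i w))) ->
  (forall i x, i \notin s -> 0 <= g i x) ->
  \int[P]_w (\prod_(i in J) g i (Y i w)) = \prod_(i in J) \int[P]_w g i (Y i w).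
  by move=> mf fi; apply: (H (enum I)) => // i x; rewrite mem_enum.
elim: s g => [|i0 s IH] g mg gi g0.
  rewrite /Rintegral (@ge0_integral_indep_prod (enum I) J g)//.
  - rewrite prod_fin_num// => i iJ; exact: integrable_fin_num (gi i iJ).
  - by move=> i x; exact: g0.
  - by move=> i iJ; rewrite ltey_eq (integrable_fin_num _ (gi i iJ)).
  - by move=> i _; rewrite mem_enum.
pose gp i x := if i == i0 then Num.max (g i x) 0 else g i x.
pose gn i x := if i == i0 then Num.max (- g i x) 0 else g i x.
have [i0J|i0J] := boolP (i0 \in J); last first.
  pose g' i x := if i == i0 then 0 else g i x.
  have E i : i \in J -> g' i = g i.
    by move=> iJ; apply/funext => x; rewrite /g'; case: eqP iJ i0J => // -> ->.
  have := IH g'.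
  rewrite (@eq_Rintegral _ _ _ P setT (fun w => \prod_(i in J) g i (Y i w))); last first.
    by move=> w _; apply: eq_bigr => i iJ; rewrite E.
  rewrite [X in _ = X](eq_bigr (fun i => \int[P]_w g i (Y i w))); last first.
    by move=> i iJ; rewrite E.
  apply.
  - by move=> i; rewrite /g'; case: eqP => // _; exact: measurable_cst.
  - by move=> i iJ; rewrite E//; exact: gi.
  - move=> i x si; rewrite /g'; case: eqP => // /eqP ii0.
    by apply: g0; rewrite inE negb_or ii0.
have mgp i : measurable_fun setT (gp i).
  by rewrite /gp; case: eqP => // _; exact: measurable_maxr.
have mgn i : measurable_fun setT (gn i).
  rewrite /gn; case: eqP => // _; apply: measurable_maxr => //.
  exact: measurableT_comp.
have gpi i : i \in J -> integrableR (fun w => gp i (Y i w)).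
  move=> iJ; rewrite /gp; case: eqP => [_|_]; last exact: gi.
  by have := integrable_funrpos measurableT (gi i iJ).
have gni i : i \in J -> integrableR (fun w => gn i (Y i w)).
  move=> iJ; rewrite /gn; case: eqP => [_|_]; last exact: gi.
  by have := integrable_funrneg measurableT (gi i iJ).
have gp0 i x : i \notin s -> 0 <= gp i x.
  move=> si; rewrite /gp; case: eqP => [_|/eqP ii0].
    by rewrite le_max lexx orbT.
  by apply: g0; rewrite inE negb_or ii0.
have gn0 i x : i \notin s -> 0 <= gn i x.
  move=> si; rewrite /gn; case: eqP => [_|/eqP ii0].
    by rewrite le_max lexx orbT.
  by apply: g0; rewrite inE negb_or ii0.
have gE x : g i0 x = gp i0 x - gn i0 x.
  rewrite /gp /gn eqxx; case: (leP (g i0 x) 0) => [h|h].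
    by rewrite max_l ?oppr_ge0// sub0r opprK.
  by rewrite max_r ?oppr_le0 ?ltW// subr0.
rewrite (@eq_Rintegral _ _ _ P setT (fun w => \prod_(i in J) gp i (Y i w) -
    \prod_(i in J) gn i (Y i w))); last first.
  move=> w _; rewrite !(bigD1 i0 i0J) /= gE mulrBl; congr (_ * _ - _ * _).
    by apply: eq_bigr => i /andP[_ /negPf ii0]; rewrite /gp ii0.
  by apply: eq_bigr => i /andP[_ /negPf ii0]; rewrite /gn ii0.
rewrite RintegralB//; last 2 first.
- exact: integrable_indep_prod.
- exact: integrable_indep_prod.
rewrite (IH gp)// (IH gn)//.
rewrite !(bigD1 i0 i0J) /= (_ : \int[P]_w g i0 (Y i0 w) =
    \int[P]_w gp i0 (Y i0 w) - \int[P]_w gn i0 (Y i0 w)); last first.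
  rewrite -RintegralB//; last 2 first.
  - exact: gpi.
  - exact: gni.
  by apply: eq_Rintegral => w _; rewrite -gE.
rewrite mulrBl; congr (_ * _ - _ * _).
  by apply: eq_bigr => i /andP[_ /negPf ii0]; rewrite /gp ii0.
by apply: eq_bigr => i /andP[_ /negPf ii0]; rewrite /gn ii0.
Qed.

End IndependentProducts.

(** * Traces of powers as sums over closed walks *)

Section TraceWalks.
Context {R : fieldType} {N : nat}.
Variables (B : rel 'I_N) (s : R) (z : 'I_N -> 'I_N -> R).
Hypothesis zC : forall x y, z x y = z y x.

Definition walk_weight (es : seq ('I_N * 'I_N)) : R := \prod_(e <- es) z e.1 e.2.

Lemma edge_weight x y : z (edge x y).1 (edge x y).2 = z x y.
Proof. by rewrite /edge; case: ifP. Qed.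

Definition band_matrix : 'M[R]_N := \matrix_(x, y) if B x y then z x y else 0.

Lemma band_matrix_pow n x y : ((s *: band_matrix) ^+ n) x y =
  \sum_(q : n.-tuple 'I_N) if last x q == y then
    if path B x q then s ^+ n * walk_weight (path_edges x q) else 0 else 0.
Proof.
elim: n x y => [|n IH] x y.
  rewrite (sum_tuple0 (fun q => if last x q == y then
    if path B x q then s ^+ 0 * walk_weight (path_edges x q) else 0 else 0)) /=.
  rewrite expr0 mxE /walk_weight big_nil mul1r.
  by case: eqP.
rewrite exprS mxE (sum_tuple_cons n (fun q => if last x q == y then
    if path B x q then s ^+ n.+1 * walk_weight (path_edges x q) else 0 else 0)).
apply: eq_bigr => a _; rewrite !mxE IH mulr_sumr; apply: eq_bigr => q _ /=.
case: eqP => _; rewrite ?mulr0//; case: (B x a) => /=; last by rewrite mulr0 mul0r.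
case: (path B a q); rewrite ?mulr0//.
by rewrite /walk_weight big_cons edge_weight exprS; ring.
Qed.

Lemma trace_band_matrix_pow n : \tr ((s *: band_matrix) ^+ n.+1) =
  s ^+ n.+1 * \sum_(u : n.+1.-tuple 'I_N)
    if cycle B u then walk_weight (cycle_edges u) else 0.
Proof.
rewrite /mxtrace; under eq_bigr => x _ do rewrite band_matrix_pow.
rewrite (sum_closed_rcons n (fun x q =>
  if path B x q then s ^+ n.+1 * walk_weight (path_edges x q) else 0)).
rewrite mulr_sumr (sum_tuple_cons n (fun u => s ^+ n.+1 *
    if cycle B u then walk_weight (cycle_edges u) else 0)).
by apply: eq_bigr => x _; apply: eq_bigr => p _ /=; case: ifP; rewrite ?mulr0.
Qed.

End TraceWalks.

(** * Moments of the centered band matrices *)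

Lemma Rintegral_sum_seq d (T : measurableType d) (R : realType)
    (mu : {measure set T -> \bar R}) (I : Type) (r : seq I) (F : I -> T -> R) :
  (forall i, mu.-integrable setT (fun x => (F i x)%:E)) ->
  \int[mu]_x (\sum_(i <- r) F i x) = \sum_(i <- r) \int[mu]_x F i x /\
  mu.-integrable setT (fun x => (\sum_(i <- r) F i x)%:E).
Proof.
move=> iF; elim: r => [|i r [IH1 IH2]].
  rewrite (_ : (fun x => _) = cst 0); last first.
    by apply/funext => x; rewrite big_nil.
  rewrite (_ : (fun x => _) = cst 0%E); last by apply/funext => x; rewrite big_nil.
  by rewrite Rintegral_cst// mul0r big_nil; split => //; exact: integrable0.
rewrite (_ : (fun x => \sum_(k <- _) _) = fun x => F i x + \sum_(k <- r) F k x); last first.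
  by apply/funext => x; rewrite big_cons.
rewrite (_ : (fun x => _%:E) = (fun x => (F i x)%:E + (\sum_(k <- r) F k x)%:E)%E); last first.
  by apply/funext => x; rewrite big_cons EFinD.
rewrite RintegralD//=; last exact: iF.
by rewrite big_cons; split; [congr (_ + _); exact: IH1|exact: integrableD].
Qed.

Lemma Rintegral_probability_cst d (T : measurableType d) (R : realType)
  (Q : probability T R) (c : R) : \int[Q]_x c = c.
Proof. by rewrite Rintegral_cst// [X in fine X](probability_setT Q) mulr1. Qed.

Section CenteredMoments.
Context d (Omega : measurableType d) (R : realType) (P : probability Omega R).
Context (N : nat) (X : 'I_N -> 'I_N -> {RV P >-> R}).
Context (rho : probability R R) (m v : R).
Hypothesis symX : forall (i j : 'I_N) w, X i j w = X j i w.
Hypothesis indX : mutually_independent [set ij : 'I_N * 'I_N | (ij.1 <= ij.2)%N]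
  (fun ij => X ij.1 ij.2).
Hypothesis distX : forall (i j : 'I_N) (B : set R), measurable B ->
    distribution P (X i j) B = rho B.
Hypothesis intrho : forall k : nat, rho.-integrable [set: R] (fun x => (x ^+ k)%:E).
Hypothesis mE : m = \int[rho]_x x.
Hypothesis vE : v = \int[rho]_x (x ^+ 2) - m ^+ 2.

Definition central_moment (k : nat) : R := \int[rho]_x (x - m) ^+ k.

Lemma integrable_central k : rho.-integrable [set: R] (fun x => ((x - m) ^+ k)%:E).
Proof.
pose F (i : 'I_k.+1) (x : R) := x ^+ (k - i) * (- m) ^+ i *+ 'C(k, i).
have := @Rintegral_sum_seq _ _ _ rho _ (index_enum _) F.
case=> [i|_]; last first.
  by under eq_fun do rewrite -exprDn.
rewrite /F; under eq_fun do rewrite -mulrnAr mulrC EFinM.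
exact: integrableZl.
Qed.

Lemma central_moment0 : central_moment 0 = 1.
Proof.
exact: Rintegral_probability_cst.
Qed.

Let intX : rho.-integrable setT (fun x => x%:E).
Proof. exact: (intrho 1). Qed.

Let intC (c : R) : rho.-integrable setT (fun x => c%:E).
Proof. exact: finite_measure_integrable_cst. Qed.

Lemma central_moment1 : central_moment 1 = 0.
Proof.
transitivity (\int[rho]_x x - \int[rho]_x m); first exact: (RintegralB measurableT intX (intC m)).
by rewrite -mE (Rintegral_probability_cst rho) subrr.
Qed.

Lemma central_moment2 : central_moment 2 = v.
Proof.
rewrite /central_moment vE.
rewrite (@eq_Rintegral _ _ _ rho setT (fun x => x ^+ 2 - (2 * m * x - m ^+ 2))); last first.
  by move=> x _; ring.
have i2 := intrho 2.
have i1 : rho.-integrable setT (fun x => (2 * m * x)%:E).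
  by under eq_fun do rewrite EFinM; exact: integrableZl.
have i3 : rho.-integrable setT (fun x => (2 * m * x - m ^+ 2)%:E).
  by under eq_fun do rewrite EFinB; exact: integrableB.
transitivity (\int[rho]_x (x ^+ 2) - (\int[rho]_x (2 * m * x) - \int[rho]_x (m ^+ 2))).
  rewrite (RintegralB measurableT i2 i3); congr (_ - _).
  exact: (RintegralB measurableT i1 (intC _)).
have -> : \int[rho]_x (2 * m * x) = 2 * m * m.
  by rewrite [X in _ = _ * X]mE; exact: (RintegralZl _ measurableT intX).
by rewrite (Rintegral_probability_cst rho); ring.
Qed.

Let D : {set 'I_N * 'I_N} := finset (fun e : 'I_N * 'I_N => (e.1 <= e.2)%N).
Let Y (e : 'I_N * 'I_N) := X e.1 e.2.

Let mcentral k : measurable_fun setT (fun x : R => (x - m) ^+ k).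
Proof. by apply: measurable_funX; exact: measurable_funB. Qed.

Let integral_entry e (f : R -> R) : measurable_fun setT f ->
  (\int[P]_w (f (Y e w))%:E = \int[rho]_x (f x)%:E)%E.
Proof.
move=> mf; have mY : measurable_fun setT (Y e) by exact: measurable_funP.
rewrite (@integral_density _ _ _ _ _ P rho (Y e) (fun=> 1) mY)//.
- by apply: eq_integral => w _; rewrite mulr1.
- move=> A mA; transitivity (distribution P (X e.1 e.2) A); first exact/esym/distX.
  rewrite /distribution /pushforward.
  rewrite -[in LHS](setIT (_ @^-1` A)) -integral_indic//; last first.
    by rewrite -[_ @^-1` _]setTI; exact: mY.
  by apply: eq_integral => w _; rewrite mulr1.
Qed.

Let integrable_entry e k : P.-integrable setT (fun w => ((Y e w - m) ^+ k)%:E).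
Proof.
have mY : measurable_fun setT (Y e) by exact: measurable_funP.
apply/integrableP; split.
  by apply/measurable_EFinP; apply: (measurableT_comp (mcentral k) mY).
have /integrableP[_] := integrable_central k.
rewrite (_ : (\int[rho]_x `|((x - m) ^+ k)%:E| = \int[P]_w `|((Y e w - m) ^+ k)%:E|)%E)//.
by apply/esym/(@integral_entry e (fun x => `|(x - m) ^+ k|)); exact: measurableT_comp.
Qed.

Let Rintegral_entry e k : \int[P]_w (Y e w - m) ^+ k = central_moment k.
Proof. by rewrite /Rintegral (integral_entry e (mcentral k)). Qed.

Definition centered w (i j : 'I_N) : R := X i j w - m.

Let walk_weight_count (es : seq ('I_N * 'I_N)) w : {in es, forall e : 'I_N * 'I_N, (e.1 <= e.2)%N} ->
  walk_weight (centered w) es = \prod_(e in D) (Y e w - m) ^+ count_mem e es.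
Proof.
move=> ord; rewrite /walk_weight -prodr_undup_exp_count big_uniq ?undup_uniq//=.
rewrite big_mkcond [RHS]big_mkcond; apply: eq_bigr => e _.
rewrite mem_undup inE; case: ifPn => [ees|]; first by rewrite ord.
by move=> /count_memPn ->; rewrite expr0; case: ifP.
Qed.

(** The edges of a walk are grouped by multiplicity; the powers of distinct entries
    are independent. *)
Lemma expectation_walk_weight (es : seq ('I_N * 'I_N)) : {in es, forall e : 'I_N * 'I_N, (e.1 <= e.2)%N} ->
  P.-integrable setT (fun w => (walk_weight (centered w) es)%:E) /\
  \int[P]_w walk_weight (centered w) es = joint_moment central_moment es.
Proof.
move=> ord; rewrite (_ : (fun w => walk_weight _ es) =
    fun w => \prod_(e in D) (Y e w - m) ^+ count_mem e es); last first.
  by apply/funext => w; exact: walk_weight_count.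
rewrite (_ : (fun w => (walk_weight _ es)%:E) =
    fun w => (\prod_(e in D) (Y e w - m) ^+ count_mem e es)%:E); last first.
  by apply/funext => w; rewrite walk_weight_count.
pose f (e : 'I_N * 'I_N) x : R := (x - m) ^+ count_mem e es.
split.
  by apply: (integrable_indep_prod indX (subxx D) (f := f)) => e *;
    [exact: mcentral|exact: integrable_entry].
have := Rintegral_indep_prod indX (subxx D) (f := f) (fun e => mcentral _)
  (fun e _ => integrable_entry e _).
move=> H; apply: (etrans H).
rewrite /joint_moment big_mkcond /=; apply: eq_bigr => e _.
rewrite inE /f; case: ifPn => [_|eD]; first exact: Rintegral_entry.
have /count_memPn -> : e \notin es by apply: contra eD; exact: ord.
by rewrite central_moment0.
Qed.

Variables (B : rel 'I_N) (w : nat) (s : R).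
Hypotheses (symB : symmetric B) (w0 : (0 < w)%N) (N0 : (0 < N)%N).
Hypothesis degB : forall x, (\sum_y B x y <= w)%N.
Hypotheses (s1 : 1 <= s) (s2 : s ^+ 2 = w%:R).

Let mu := central_moment.

Definition centered_band (t : Omega) : 'M[R]_N := s^-1 *: band_matrix B (centered t).

Definition trace_moment (k : nat) (t : Omega) : R :=
  N%:R^-1 * \tr (centered_band t ^+ k).

Section FixedPower.
Variable n : nat.

Let F (u : n.+1.-tuple 'I_N) t : R :=
  if cycle B u then walk_weight (centered t) (cycle_edges u) else 0.
Let a (u : n.+1.-tuple 'I_N) : R :=
  if cycle B u then joint_moment mu (cycle_edges u) else 0.

Let integral_F u : P.-integrable setT (fun t => (F u t)%:E) /\ \int[P]_t F u t = a u.
Proof.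
rewrite /F /a; case: ifP => _.
  by apply: expectation_walk_weight => e; exact: cycle_edges_ord.
by split; [exact: integrable0|exact: Rintegral_probability_cst].
Qed.

Let integral_FF u u' : P.-integrable setT (fun t => (F u t * F u' t)%:E) /\
  \int[P]_t (F u t * F u' t) = if cycle B u && cycle B u' then
    joint_moment mu (cycle_edges u ++ cycle_edges u') else 0.
Proof.
have zeroP : P.-integrable setT (fun t => (0 : R)%:E) /\ \int[P]_t (0 : R) = 0.
  by split; [exact: integrable0|exact: Rintegral_probability_cst].
rewrite /F; case: (cycle B u) => /=; last first.
  by under eq_fun do rewrite mul0r; under [in X in _ /\ X]eq_fun do rewrite mul0r.
case: (cycle B u') => /=; last first.
  by under eq_fun do rewrite mulr0; under [in X in _ /\ X]eq_fun do rewrite mulr0.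
have [] := @expectation_walk_weight (cycle_edges u ++ cycle_edges u').
  by move=> e; rewrite mem_cat => /orP[]; exact: cycle_edges_ord.
rewrite /walk_weight; under eq_fun do rewrite big_cat.
move=> i1; under [in X in X = _ -> _]eq_fun do rewrite big_cat.
by move=> i2; split.
Qed.

Let trace_momentE t : trace_moment n.+1 t = N%:R^-1 * s^-1 ^+ n.+1 * \sum_u F u t.
Proof.
rewrite /trace_moment trace_band_matrix_pow ?mulrA// => x y.
by rewrite /centered symX.
Qed.

Let sum_a : \sum_u a u = walk_sum mu B 0 n.+1.
Proof.
rewrite /walk_sum (sum_closed_rcons n (fun x q => if path B x q && uniq (x :: take 0 q)
  then joint_moment mu (path_edges x q) else 0)).
rewrite (sum_tuple_cons n (fun u =>
  if cycle B u then joint_moment mu (cycle_edges u) else 0)).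
by apply: eq_bigr => x _; apply: eq_bigr => p _ /=; rewrite take0 andbT.
Qed.

Let mean : R := N%:R^-1 * s^-1 ^+ n.+1 * walk_sum mu B 0 n.+1.

Lemma measurable_trace_moment : measurable_fun setT (trace_moment n.+1).
Proof.
rewrite (_ : trace_moment n.+1 = fun t => N%:R^-1 * s^-1 ^+ n.+1 * \sum_u F u t); last first.
  by apply/funext => t; rewrite trace_momentE.
apply: measurable_funM => //; apply: measurable_sum => u.
by apply/measurable_EFinP; have [/measurable_int] := integral_F u.
Qed.

Let s0 : 0 < s. Proof. by rewrite (lt_le_trans ltr01). Qed.

Let mean_close : `|mean - ballot v 0 n.+1| <=
  walk_const mu 0 n.+1 * (rec_error B w s / N%:R).
Proof.
have := @walk_sum_ballot R N mu central_moment0 central_moment1 B w s symB w0 degB s1 s2 0 n.+1.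
rewrite add0n (_ : mu 2 = v); last exact: central_moment2.
set W := walk_sum _ _ _ _; set b := ballot _ _ _; set C := walk_const _ _ _.
have sn0 : s ^+ n.+1 != 0 by rewrite expf_neq0// gt_eqF.
have Nn0 : N%:R != 0 :> R by rewrite pnatr_eq0 -lt0n.
have -> : mean - b = N%:R^-1 * (s ^+ n.+1)^-1 * (W - b * (N%:R * s ^+ n.+1)).
  by rewrite /mean -/W exprVn; field; rewrite sn0 Nn0.
move=> H; have c0 : 0 <= N%:R^-1 * (s ^+ n.+1)^-1.
  by rewrite mulr_ge0// invr_ge0// exprn_ge0// ltW.
rewrite normrM (ger0_norm c0).
apply: le_trans (ler_wpM2l c0 H) _.
by rewrite le_eqVlt; apply/orP; left; apply/eqP; field; rewrite sn0 Nn0.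
Qed.

Let variance_le : \int[P]_t ((trace_moment n.+1 t - mean) ^+ 2) <=
    pair_bound mu n.+1 / (N * w)%:R /\
  P.-integrable setT (fun t => ((trace_moment n.+1 t - mean) ^+ 2)%:E).
Proof.
pose c := N%:R^-1 * s^-1 ^+ n.+1.
pose T := (n.+1.-tuple 'I_N * n.+1.-tuple 'I_N)%type.
pose G (u : T) t := c ^+ 2 * ((F u.1 t * F u.2 t - a u.1 * F u.2 t) -
  (a u.2 * F u.1 t - a u.1 * a u.2)).
have GE t : (trace_moment n.+1 t - mean) ^+ 2 = \sum_(u <- index_enum T) G u t.
  rewrite trace_momentE /mean -sum_a -/c -mulrBr exprMn -sumrB /G -mulr_sumr.
  congr (_ * _); rewrite expr2 mulr_suml.
  rewrite -(pair_bigA _ (fun u u' => (F u t * F u' t - a u * F u' t) -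
    (a u' * F u t - a u * a u'))) /=.
  apply: eq_bigr => u _; rewrite mulr_sumr; apply: eq_bigr => u' _; ring.
have intG u : P.-integrable setT (fun t => (G u t)%:E) /\ \int[P]_t G u t =
   c ^+ 2 * (if cycle B u.1 && cycle B u.2 then
    joint_moment mu (cycle_edges u.1 ++ cycle_edges u.2) -
    joint_moment mu (cycle_edges u.1) * joint_moment mu (cycle_edges u.2) else 0).
  have [i1 e1] := integral_F u.1; have [i2 e2] := integral_F u.2.
  have [i12 e12] := integral_FF u.1 u.2.
  have ia2 : P.-integrable setT (fun t => (a u.1 * F u.2 t)%:E).
    by under eq_fun do rewrite EFinM; exact: integrableZl.
  have ia1 : P.-integrable setT (fun t => (a u.2 * F u.1 t)%:E).
    by under eq_fun do rewrite EFinM; exact: integrableZl.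
  have ic : P.-integrable setT (fun t => (a u.1 * a u.2)%:E).
    exact: finite_measure_integrable_cst.
  have j1 : P.-integrable setT (fun t => (F u.1 t * F u.2 t - a u.1 * F u.2 t)%:E).
    by under eq_fun do rewrite EFinB; exact: integrableB.
  have j2 : P.-integrable setT (fun t => (a u.2 * F u.1 t - a u.1 * a u.2)%:E).
    by under eq_fun do rewrite EFinB; exact: integrableB.
  have j3 : P.-integrable setT (fun t => ((F u.1 t * F u.2 t - a u.1 * F u.2 t) -
     (a u.2 * F u.1 t - a u.1 * a u.2))%:E).
    by under eq_fun do rewrite EFinB; exact: integrableB.
  split; first by rewrite /G; under eq_fun do rewrite EFinM; exact: integrableZl.
  apply: (etrans (RintegralZl _ measurableT j3)); congr (_ * _).
  apply: (etrans (RintegralB measurableT j1 j2)).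
  rewrite (RintegralB measurableT i12 ia2) (RintegralB measurableT ia1 ic).
  rewrite (RintegralZl _ measurableT i2) (RintegralZl _ measurableT i1).
  rewrite e12 e1 e2 (Rintegral_probability_cst P) /a.
  by case: (cycle B u.1); case: (cycle B u.2) => /=; ring.
have [sumE sumI] := @Rintegral_sum_seq _ _ _ P T (index_enum T) G (fun u => (intG u).1).
rewrite (_ : (fun t => (trace_moment _ t - mean) ^+ 2) =
  fun t => \sum_(u <- index_enum T) G u t); last by apply/funext => t; exact: GE.
rewrite (_ : (fun t => ((trace_moment _ t - mean) ^+ 2)%:E) =
  fun t => (\sum_(u <- index_enum T) G u t)%:E); last by apply/funext => t; rewrite GE.
split => //; rewrite sumE.
apply: le_trans (_ : c ^+ 2 * (pair_bound mu n.+1 * (N * w ^ n)%:R) <= _); last first.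
  have sn0 : s ^+ n.+1 != 0 by rewrite expf_neq0// gt_eqF.
  have Nn0 : N%:R != 0 :> R by rewrite pnatr_eq0 -lt0n.
  have wn0 : w%:R != 0 :> R by rewrite pnatr_eq0 -lt0n.
  rewrite /c exprMn exprAC !exprVn s2 !natrM natrX le_eqVlt; apply/orP; left; apply/eqP.
  have := expf_neq0 n wn0; rewrite [_ ^+ n.+1]exprS; set W := w%:R ^+ n => Wn0.
  by field; rewrite Nn0 wn0 Wn0.
have := @correlated_pairs R N mu central_moment0 central_moment1 B w w0 degB n.
move=> /(ler_wpM2l (sqr_ge0 c)); apply: le_trans.
rewrite (pair_bigA _ (fun u u' : n.+1.-tuple 'I_N => if cycle B u && cycle B u' then
      `|joint_moment mu (cycle_edges u ++ cycle_edges u') -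
        joint_moment mu (cycle_edges u) * joint_moment mu (cycle_edges u')|
     else 0)) mulr_sumr; apply: ler_sum => u _; rewrite (intG u).2.
by rewrite ler_wpM2l ?sqr_ge0//; case: ifP => // _; exact: ler_norm.
Qed.

(** By Chebyshev's inequality: the mean is within [delta / 2] of the limit, and the
    variance is the sum of the covariances of pairs of closed walks, of which only
    the correlated ones contribute. *)
Lemma trace_moment_deviation (delta : R) : 0 < delta ->
  walk_const mu 0 n.+1 * (rec_error B w s / N%:R) <= delta / 2 ->
  (P [set t | (delta <= `|trace_moment n.+1 t - ballot v 0 n.+1|)%R] <=
   (4 / delta ^+ 2 * pair_bound mu n.+1 / (N * w)%:R)%:E)%E.
Proof.
move=> d0 small; have [vle vint] := variance_le.
set S := [set t | _]; have mM := measurable_trace_moment.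
have mS : measurable S.
  rewrite /S -[X in measurable X]setTI.
  apply: (@measurable_fun_le _ _ _ setT (cst delta)) => //.
  by apply: measurableT_comp => //; exact: measurable_funB.
have dd : 0 < delta ^+ 2 / 4 by rewrite divr_gt0// exprn_gt0.
have : (\int[P]_t ((delta ^+ 2 / 4) * \1_S t)%:E <=
    \int[P]_t ((trace_moment n.+1 t - mean) ^+ 2)%:E)%E.
  apply: ge0_le_integral => //.
  - by move=> t _; rewrite lee_fin mulr_ge0// ltW.
  - by apply/measurable_EFinP; apply: measurable_funM => //; exact: measurable_indic.
  - exact: measurable_int vint.
  move=> t _; rewrite lee_fin indicE; case: (boolP (t \in S)); last by rewrite mulr0 sqr_ge0.
  rewrite inE mulr1 => /= St.
  have h : delta / 2 <= `|trace_moment n.+1 t - mean|.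
    have near_mean := le_trans mean_close small.
    have E : trace_moment n.+1 t - ballot v 0 n.+1 =
      (trace_moment n.+1 t - mean) + (mean - ballot v 0 n.+1) by ring.
    have : delta <= `|trace_moment n.+1 t - mean| + `|mean - ballot v 0 n.+1|.
      by rewrite (le_trans St)// E ler_normD.
    by move: near_mean; lra.
  rewrite -(real_normK (num_real (_ - mean))) (_ : delta ^+ 2 / 4 = (delta / 2) ^+ 2).
    by rewrite ler_pXn2r// nnegrE divr_ge0// ltW.
  by field.
under eq_integral do rewrite EFinM.
rewrite ge0_integralZl_EFin//; last 2 first.
- by apply/measurable_EFinP; exact: measurable_indic.
- exact: ltW.
rewrite integral_indic// setIT.
have -> : (\int[P]_t ((trace_moment n.+1 t - mean) ^+ 2)%:E)%E =
  (\int[P]_t (trace_moment n.+1 t - mean) ^+ 2)%:E.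
  by rewrite /Rintegral fineK//; exact: integrable_fin_num vint.
move=> H; rewrite -(lee_pmul2l _ (_ : 0 < (delta ^+ 2 / 4)%:E)%E) ?lte_fin//.
apply: (le_trans H); rewrite -EFinM lee_fin (le_trans vle)//.
rewrite le_eqVlt; apply/orP; left; apply/eqP.
have Nn0 : N%:R != 0 :> R by rewrite pnatr_eq0 -lt0n.
have wn0 : w%:R != 0 :> R by rewrite pnatr_eq0 -lt0n.
by rewrite natrM; field; rewrite Nn0 wn0 gt_eqF.
Qed.

End FixedPower.

End CenteredMoments.

(** * Moments of the semicircle law *)

Lemma integrableZl_EFin d (T : measurableType d) (R : realType)
    (mu : {measure set T -> \bar R}) (D : set T) (f : T -> R) (a : R) :
  measurable D -> mu.-integrable D (fun x => (f x)%:E) ->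
  mu.-integrable D (fun x => (a * f x)%:E).
Proof.
by move=> mD fi; under eq_fun do rewrite EFinM; exact: integrableZl.
Qed.

Section ArcIntegral.
Context {R : realType}.
Notation leb := (@lebesgue_measure R).
Implicit Types (v : R) (f g : R -> R).

(** The image of the semicircle law under the parametrization
    [x = 2 sqrt v cos t] of its support; this includes the point mass for
    [v = 0]. *)
Definition arc_integral v f : R :=
  \int[leb]_(t in `[0, pi]) (2 / pi * sin t ^+ 2 * f (2 * Num.sqrt v * cos t)).

Let mI : @measurable _ (measurableTypeR R) `[0, pi]%classic.
Proof. exact: measurable_itv. Qed.

Let pi0 : 0 < pi :> R. Proof. exact: pi_gt0. Qed.

Let arc_continuous v f : continuous f ->
  continuous (fun t : R => 2 / pi * sin t ^+ 2 * f (2 * Num.sqrt v * cos t)).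
Proof.
move=> cf t; apply: cvgM.
  apply: cvgM; first exact: cvg_cst.
  by apply: (@continuous_comp _ _ _ sin (fun x => x ^+ 2));
    [exact: continuous_sin|exact: exprn_continuous].
apply: (@continuous_comp _ _ _ (fun t : R => 2 * Num.sqrt v * cos t) f); last exact: cf.
by apply: cvgM; [exact: cvg_cst|exact: continuous_cos].
Qed.

Lemma arc_integrable v f : continuous f -> leb.-integrable `[0, pi]
  (fun t => (2 / pi * sin t ^+ 2 * f (2 * Num.sqrt v * cos t))%:E).
Proof.
move=> cf; apply: continuous_compact_integrable; first exact: segment_compact.
by apply: continuous_subspaceT; exact: arc_continuous.
Qed.

Lemma arc_integralD v f g (a : R) : continuous f -> continuous g ->
  arc_integral v (fun x => a * f x + g x) = a * arc_integral v f + arc_integral v g.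
Proof.
move=> cf cg; have i1 := arc_integrable v cf; have i2 := arc_integrable v cg.
have i3 := integrableZl_EFin a mI i1.
rewrite /arc_integral -(RintegralZl a mI i1).
rewrite -(RintegralD mI i3 i2).
by apply: eq_Rintegral => t _ /=; ring.
Qed.

Lemma is_derive_sin_mul (c t : R) :
  is_derive t (1 : R) (fun t => sin (c * t)) (c * cos (c * t)).
Proof.
have h : is_derive t (1 : R) (fun t => c * t) c.
  by apply: is_derive_eq; rewrite /GRing.scale /= mulr1.
by have := @is_derive1_comp R sin ( *%R c) t _ _ (is_derive_sin (c * t)) h; rewrite mulrC.
Qed.

Lemma is_derive_sin_div (c t : R) : c != 0 ->
  is_derive t (1 : R) (fun t => c^-1 * sin (c * t)) (cos (c * t)).
Proof.
move=> c0; have D := is_deriveZ (c^-1 : R) (is_derive_sin_mul c t).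
by rewrite [X in is_derive _ _ _ X](_ : _ = c^-1 *: (c * cos (c * t)))// /GRing.scale /= mulKf.
Qed.

Lemma sin_natpi n : sin (n%:R * pi) = 0 :> R.
Proof.
elim: n => [|n IH]; first by rewrite mul0r sin0.
by rewrite -natr1 mulrDl mul1r sinDpi IH oppr0.
Qed.

Lemma arc_trig h : \int[leb]_(t in `[0, pi]) (2 / pi * (sin (h.+1%:R * t) * sin t)) =
  (h == 0%N)%:R.
Proof.
pose f t : R := 2 / pi * (sin (h.+1%:R * t) * sin t).
have cf : continuous f.
  move=> t; apply: cvgM; [exact: cvg_cst|apply: cvgM; last exact: continuous_sin].
  apply: (@continuous_comp _ _ _ (fun t : R => h.+1%:R * t) sin);
    [exact: mulrl_continuous|exact: continuous_sin].
pose A (t : R) : R := if h is h'.+1 then (h%:R)^-1 * sin (h%:R * t) else t.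
pose F t : R := (A t - (h.+2%:R)^-1 * sin (h.+2%:R * t)) / pi.
have dA t : is_derive t (1 : R) A (cos (h%:R * t)).
  rewrite /A; case: h {f cf A F} => [|h].
    by rewrite mul0r cos0; exact: is_derive_id.
  by apply: is_derive_sin_div; rewrite pnatr_eq0.
have dF t : is_derive t (1 : R) F (f t).
  have n0 : h.+2%:R != 0 :> R by rewrite pnatr_eq0.
  have D := is_deriveB (dA t) (is_derive_sin_div t n0).
  rewrite (_ : F = pi^-1 *: (A - (fun t => h.+2%:R^-1 * sin (h.+2%:R * t)))); last first.
    by apply/funext => x; rewrite /F mulrC.
  rewrite [X in is_derive _ _ _ X](_ : _ = pi^-1 *: (cos (h%:R * t) - cos (h.+2%:R * t))).
    exact: is_deriveZ.
  rewrite /f /GRing.scale /=.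
  have -> : h%:R * t = h.+1%:R * t - t by rewrite -natr1; ring.
  have -> : h.+2%:R * t = h.+1%:R * t + t by rewrite -(natr1 h.+1); ring.
  by rewrite cosB cosD; ring.
have cF : continuous F.
  by move=> t; apply/differentiable_continuous/derivable1_diffP; exact: ex_derive.
have := @continuous_FTC2 R f F 0 pi pi0 (continuous_subspaceT cf).
rewrite /Rintegral -/f => ->.
- rewrite -EFinB /= /F /A; case: h {f cf A F dA dF cF} => [|h].
    by rewrite !mulr0 sin0 mulr0 subrr mul0r subr0 sin_natpi mulr0 subr0 divff// gt_eqF.
  by rewrite !mulr0 sin0 !mulr0 subrr mul0r subr0 !sin_natpi !mulr0 subrr mul0r.
- split; first by move=> t _; exact: ex_derive.
    exact/cvg_at_right_filter/cF.
  exact/cvg_at_left_filter/cF.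
- by move=> t _; rewrite derive1E; exact: derive_val.
Qed.

(** Chebyshev polynomials of the second kind, rescaled to the support of the
    semicircle law. *)
Fixpoint cheb v h (x : R) : R := match h with
  | 0 => 1
  | h'.+1 => x * cheb v h' x - (if h' is h''.+1 then v * cheb v h'' x else 0)
  end.

Lemma cheb_continuous v h : continuous (cheb v h).
Proof.
suff : continuous (cheb v h) /\ continuous (cheb v h.+1) by case.
elim: h => [|h [IH1 IH2]].
  split; first exact: cst_continuous.
  move=> x /=; apply: cvgB; last exact: cvg_cst.
  by apply: cvgM; [exact: cvg_id|exact: cvg_cst].
split=> // x; apply: cvgB; first by apply: cvgM; [exact: cvg_id|exact: IH2].
by apply: cvgM; [exact: cvg_cst|exact: IH1].
Qed.

Lemma cheb_cos v h (t : R) : 0 <= v ->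
  cheb v h (2 * Num.sqrt v * cos t) * sin t = Num.sqrt v ^+ h * sin (h.+1%:R * t).
Proof.
move=> v0; set r := Num.sqrt v; have rr : v = r ^+ 2 by rewrite sqr_sqrtr.
suff : cheb v h (2 * r * cos t) * sin t = r ^+ h * sin (h.+1%:R * t) /\
  cheb v h.+1 (2 * r * cos t) * sin t = r ^+ h.+1 * sin (h.+2%:R * t) by case.
have step n : sin (n.+2%:R * t) = 2 * cos t * sin (n.+1%:R * t) - sin (n%:R * t).
  have -> : n%:R * t = n.+1%:R * t - t by rewrite -natr1; ring.
  have -> : n.+2%:R * t = n.+1%:R * t + t by rewrite -(natr1 n.+1); ring.
  by rewrite sinB sinD; ring.
elim: h => [|h [IH1 IH2]].
  rewrite /= !mul1r; split => //; rewrite step mul1r mul0r sin0; ring.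
split=> //; rewrite step [cheb _ _ _]/= -/(cheb v h.+1 _).
transitivity (2 * r * cos t * (cheb v h.+1 (2 * r * cos t) * sin t) -
   v * (cheb v h (2 * r * cos t) * sin t)); first by rewrite /=; ring.
by rewrite IH2 IH1 rr !exprS; ring.
Qed.

(** The Chebyshev polynomials are orthogonal to [1] for the semicircle law, and
    multiplication by [x] acts on them as a step of a lattice path. *)
Lemma arc_cheb v h k : 0 <= v ->
  arc_integral v (fun x => x ^+ k * cheb v h x) = ballot v h k.
Proof.
move=> v0; elim: k h => [|k IH] h.
  rewrite /= /arc_integral.
  rewrite (@eq_Rintegral _ _ _ leb _ (fun t =>
     Num.sqrt v ^+ h * (2 / pi * (sin (h.+1%:R * t) * sin t)))); last first.
    move=> t _; rewrite expr0 mul1r.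
    transitivity (2 / pi * sin t * (cheb v h (2 * Num.sqrt v * cos t) * sin t)).
      by ring.
    rewrite cheb_cos// mulrCA; congr (_ * _); rewrite -[LHS]mulrA; congr (_ * _).
    exact: mulrC.
  rewrite RintegralZl//; last first.
    apply: continuous_compact_integrable; first exact: segment_compact.
    apply: continuous_subspaceT => t.
    apply: cvgM; [exact: cvg_cst|apply: cvgM; last exact: continuous_sin].
    apply: (@continuous_comp _ _ _ (fun t : R => h.+1%:R * t) sin);
      [exact: mulrl_continuous|exact: continuous_sin].
  by rewrite arc_trig; case: h => [|h]; rewrite ?mulr1 ?mulr0.
have cxk j h' : continuous (fun x : R => x ^+ j * cheb v h' x).
  move=> x; apply: cvgM; [exact: exprn_continuous|exact: cheb_continuous].
rewrite [RHS]/= -IH; case: h => [|h].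
  rewrite addr0; congr arc_integral; apply/funext => x /=.
  by rewrite subr0 mulr1 mulr1 exprSr.
rewrite -IH addrC -arc_integralD//; congr arc_integral; apply/funext => x.
rewrite exprSr (_ : cheb v h.+2 x = x * cheb v h.+1 x - v * cheb v h x)//.
by move: (x ^+ k) (cheb v h.+1 x) (cheb v h x) => a b c; ring.
Qed.

Lemma arc_moment v k : 0 <= v -> arc_integral v (fun x => x ^+ k) = ballot v 0 k.
Proof.
move=> v0; rewrite -(arc_cheb 0 k v0); congr arc_integral.
by apply/funext => x; rewrite mulr1.
Qed.

Lemma arc_integral_le v f (eta : R) : 0 <= v -> continuous f ->
  (forall x, `|x| <= 2 * Num.sqrt v -> `|f x| <= eta) -> `|arc_integral v f| <= eta.
Proof.
move=> v0 cf fe; have i1 := arc_integrable v cf.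
rewrite (le_trans (le_normr_Rintegral _ i1))//.
have ie : leb.-integrable `[0, pi] (fun t => (2 / pi * sin t ^+ 2 * eta)%:E).
  by apply: (arc_integrable v (f := fun=> eta)); exact: cst_continuous.
rewrite (@le_trans _ _ (arc_integral v (fun=> eta)))//.
  apply: le_Rintegral => //; first exact: integrable_norm i1.
  move=> t _; have c0 : 0 <= 2 / pi * sin t ^+ 2 :> R.
    by rewrite mulr_ge0 ?sqr_ge0// divr_ge0// ltW.
  rewrite normrM (ger0_norm c0) ler_wpM2l// fe//.
  have rt0 : 0 <= 2 * Num.sqrt v by rewrite mulr_ge0// sqrtr_ge0.
  rewrite normrM (ger0_norm rt0) ler_piMr//.
  by rewrite ler_norml cos_geN1 cos_le1.
have -> : arc_integral v (fun=> eta) =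
    eta * arc_integral v (fun=> 1) + arc_integral v (fun=> 0).
  rewrite -arc_integralD; [|exact: cst_continuous|exact: cst_continuous].
  by congr arc_integral; apply/funext => x; rewrite mulr1 addr0.
have -> : arc_integral v (fun=> 1) = 1.
  rewrite -[RHS](_ : ballot v 0 0 = 1)// -arc_moment//; congr arc_integral.
have -> : arc_integral v (fun=> 0) = 0.
  rewrite /arc_integral (@eq_Rintegral _ _ _ leb _ (cst 0)).
    by rewrite Rintegral_cst// mul0r.
  by move=> t _; rewrite mulr0.
by rewrite mulr1 addr0.
Qed.

End ArcIntegral.

Section SemicircleIntegral.
Context {R : realType}.
Notation leb := (@lebesgue_measure R).
Implicit Types (v : R) (f : R -> R).

Let law0E (A : set R) : semicircle_law (0 : R) A = (\1_A (0 : R))%:E.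
Proof. by rewrite /semicircle_law ltxx. Qed.

Let law_posE v (A : set R) : 0 < v ->
  semicircle_law v A = (\int[leb]_(x in A) (semicircle_pdf v x)%:E)%E.
Proof. by rewrite /semicircle_law => ->. Qed.

Let semicircle0 f : continuous f ->
  (\int[semicircle_law (0 : R)]_x (f x)%:E = (f 0)%:E)%E.
Proof.
move=> cf; have mf : measurable_fun setT f by exact: continuous_measurable_fun.
rewrite (@integral_density _ _ _ _ R \d_(0 : R) (semicircle_law (0:R)) id (fun=> 1))//.
  rewrite integral_dirac//; first by rewrite diracT mul1e mulr1.
  by apply/measurable_EFinP; apply: measurable_funM.
move=> A mA; rewrite integral_dirac//.
  by rewrite diracT mul1e mulr1 preimage_id; exact: law0E.
by apply/measurable_EFinP; apply: measurable_funM => //; exact: measurable_indic.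
Qed.

Lemma semicircle_pdf_cos v (t : R) : 0 < v -> 0 <= t <= pi ->
  semicircle_pdf v (2 * Num.sqrt v * cos t) = (2 * pi * v)^-1 * (2 * Num.sqrt v * sin t).
Proof.
move=> v0 t0; rewrite /semicircle_pdf; congr (_ * _).
have E : 4 * v - (2 * Num.sqrt v * cos t) ^+ 2 = (2 * Num.sqrt v * sin t) ^+ 2.
  rewrite !exprMn sqr_sqrtr ?(ltW v0)// sin2cos2; ring.
rewrite E max_l ?sqr_ge0// sqrtr_sqr ger0_norm// !mulr_ge0// ?sqrtr_ge0//.
exact: sin_ge0_pi.
Qed.

Lemma semicircle_pdf_out v (x : R) : 0 < v -> ~~ (- (2 * Num.sqrt v) <= x <= 2 * Num.sqrt v) ->
  semicircle_pdf v x = 0.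
Proof.
move=> v0; rewrite -ler_norml -ltNge => h; rewrite /semicircle_pdf max_r ?sqrtr0 ?mulr0//.
rewrite subr_le0 -(real_normK (num_real x)).
have -> : 4 * v = (2 * Num.sqrt v) ^+ 2 by rewrite exprMn sqr_sqrtr ?(ltW v0)//; ring.
by rewrite ler_pXn2r ?nnegrE ?mulr_ge0 ?sqrtr_ge0// ltW.
Qed.

Let semicircle_pos v f : 0 < v -> continuous f ->
  (\int[semicircle_law v]_x (f x)%:E = (arc_integral v f)%:E)%E.
Proof.
move=> v0 cf; have mf : measurable_fun setT f by exact: continuous_measurable_fun.
rewrite (@integral_density _ _ (measurableTypeR R) R R leb (semicircle_law v) id (semicircle_pdf v))//; last 3 first.
- exact: measurable_semicircle_pdf.
- by move=> x; exact: semicircle_pdf_ge0.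
- move=> A mA; apply: (etrans (law_posE A v0)); rewrite preimage_id.
  rewrite [LHS]integral_mkcond; apply: eq_integral => x _.
  by rewrite patchE indicE; case: ifP; rewrite ?mul1r ?mul0r.
set r2 := 2 * Num.sqrt v; have r0 : 0 < r2 by rewrite mulr_gt0// sqrtr_gt0.
pose F (t : R) := r2 * cos t.
have dF t : is_derive t (1 : R) F (r2 * - sin t).
  exact: (is_deriveZ r2 (is_derive_cos t)).
have F0 : F 0 = r2 by rewrite /F cos0 mulr1.
have Fpi : F pi = - r2 by rewrite /F cospi mulrN1.
have cpdf : continuous (semicircle_pdf v).
  move=> x; apply: cvgM; first exact: cvg_cst.
  apply: continuous_cvg; first exact: sqrt_continuous.
  apply: (@continuous_max _ _ (fun x : R => 4 * v - x ^+ 2) (fun=> 0)).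
    by apply: cvgB; [exact: cvg_cst|exact: exprn_continuous].
  exact: cvg_cst.
transitivity (\int[leb]_(x in `[F pi, F (0:R)%R]) (f x * semicircle_pdf v x)%:E)%E.
  rewrite [RHS]integral_mkcond; apply: eq_integral => x _ /=.
  rewrite patchE; case: ifPn => //; rewrite notin_setE /= in_itv /= F0 Fpi => /negP h.
  by rewrite (semicircle_pdf_out v0 h) mulr0.
have F'E t : (derive1 F) t = r2 * - sin t by rewrite derive1E; exact: derive_val.
have cF' : continuous (derive1 F).
  rewrite (_ : (derive1 F) = fun t => r2 * - sin t); last by apply/funext.
  by move=> t; apply: cvgM; [exact: cvg_cst|apply: cvgN; exact: continuous_sin].
have cF : continuous F.
  by move=> t; apply/differentiable_continuous/derivable1_diffP; exact: ex_derive.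
rewrite (@integration_by_substitution_decreasing R F (fun x => f x * semicircle_pdf v x))//.
- rewrite /arc_integral /Rintegral fineK; last first.
    exact: (integrable_fin_num _ (arc_integrable v cf)).
  apply: eq_integral => t; rewrite inE /= in_itv /= => tpi; congr EFin.
  rewrite [LHS](_ : _ = f (F t) * semicircle_pdf v (F t) * - (derive1 F t))// F'E.
  rewrite /F semicircle_pdf_cos// -/r2.
  have vv : v = r2 ^+ 2 / 4 by rewrite /r2 exprMn sqr_sqrtr ?(ltW v0)//; field.
  rewrite vv; move: (@pi R) (@pi_gt0 R) => p p0.
  by field; rewrite !gt_eqF.
- exact: pi_ge0.
- by move=> x y xI yI xy; rewrite /F ltr_pM2l// ltr_cos.
- apply: cvgP; apply: cvg_at_right_filter; exact: cF'.
- apply: cvgP; apply: cvg_at_left_filter; exact: cF'.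
- split; first by move=> t _; exact: ex_derive.
    exact/cvg_at_right_filter/cF.
  exact/cvg_at_left_filter/cF.
- apply: continuous_subspaceT => x; apply: cvgM; [exact: cf|exact: cpdf].
Qed.

(** By the substitution [x = 2 sqrt v cos t]. *)
Lemma Rintegral_semicircle v f : 0 <= v -> continuous f ->
  \int[semicircle_law v]_x f x = arc_integral v f.
Proof.
rewrite le_eqVlt => /predU1P[<-|v0] cf; rewrite /Rintegral; last by rewrite semicircle_pos.
rewrite semicircle0//=.
have -> : arc_integral 0 f = f 0 * arc_integral 0 (fun=> 1) + arc_integral 0 (fun=> 0).
  rewrite -arc_integralD; [|exact: cst_continuous|exact: cst_continuous].
  by apply: eq_Rintegral => t _; rewrite sqrtr0 !mulr0 mul0r !mulr1 addr0.
have -> : arc_integral 0 (fun=> 1 : R) = 1.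
  by rewrite -[RHS](_ : ballot (0 : R) 0 0 = 1)// -arc_moment.
have -> : arc_integral 0 (fun=> 0 : R) = 0.
  rewrite /arc_integral (@eq_Rintegral _ _ _ leb _ (cst 0)).
    by rewrite Rintegral_cst// mul0r.
  by move=> t _; rewrite mulr0.
by rewrite mulr1 addr0.
Qed.

End SemicircleIntegral.

(** * Eigenvalues of symmetric matrices under perturbation *)

Section SpectralForm.
Context {R : realType}.
Local Notation C := R[i].
Local Notation toC := (real_complex R).

Definition adjmx m n (M : 'M[C]_(m, n)) : 'M[C]_(n, m) := map_mx Num.conj M^T.

Lemma adjmxM m n p (M : 'M[C]_(m, n)) (M' : 'M[C]_(n, p)) :
  adjmx (M *m M') = adjmx M' *m adjmx M.
Proof. by rewrite /adjmx trmx_mul map_mxM. Qed.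

Lemma adjmxK m n (M : 'M[C]_(m, n)) : adjmx (adjmx M) = M.
Proof. by apply/matrixP => i j; rewrite !mxE conjCK. Qed.

(** The spectral theorem, with the listed eigenvalues on the diagonal. *)
Lemma spectral_real N (A : 'M[R]_N) : A^T = A ->
  exists (U : 'M[C]_N) (r : 'I_N -> R), [/\ U *m adjmx U = 1%:M, adjmx U *m U = 1%:M,
    map_mx toC A = adjmx U *m diag_mx (\row_i toC (r i)) *m U &
    perm_eq (eigenvalues A) [seq r i | i <- enum 'I_N]].
Proof.
move=> symA; pose AC := map_mx toC A.
have hermAC : AC \is hermsymmx.
  rewrite is_hermitianmxE expr0 scale1r; apply/eqP/matrixP => i j.
  by rewrite !mxE -[in LHS]symA mxE; apply/esym/CrealP/complex_realP; eexists.
have /hermitian_normalmx/orthomx_spectralP AC_eq := hermAC.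
have spec_real := hermitian_spectral_diag_real hermAC.
pose U := spectralmx AC.
have Uu : U \is unitarymx by exact: spectral_unitarymx.
have UU : U *m adjmx U = 1%:M by move/unitarymxP : Uu.
have UU' : adjmx U *m U = 1%:M by exact: mulmx1C.
pose r i := complex.Re (spectral_diag AC 0 i).
have rE i : spectral_diag AC 0 i = toC (r i).
  by apply/esym/RRe_real; move/mxOverP : spec_real => /(_ 0 i).
have dE : spectral_diag AC = \row_i toC (r i).
  by apply/rowP => i; rewrite mxE rE.
have ACE : AC = adjmx U *m diag_mx (\row_i toC (r i)) *m U.
  by rewrite -dE {1}AC_eq; congr (_ *m _ *m _); rewrite invmx_unitary.
exists U, r; split=> //.
have [_ _ charE] := eigenvaluesP symA.
apply: prod_XsubC_eq; rewrite -charE big_map big_enum /=.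
apply: (map_poly_inj toC); rewrite map_char_poly rmorph_prod/= -/AC ACE.
transitivity (char_poly (diag_mx (\row_i toC (r i)))).
  rewrite /char_poly /char_poly_mx !map_mxM/=.
  set Q := map_mx _ U; set Q' := map_mx _ (adjmx U).
  have Q'Q : Q' *m Q = 1%:M by rewrite -map_mxM UU' map_mx1.
  have XE : Q' *m 'X%:M *m Q = 'X%:M by rewrite scalar_mxC -mulmxA Q'Q mulmx1.
  rewrite -[X in \det (X - _) = _]XE -mulmxBl -mulmxBr !det_mulmx mulrAC.
  by rewrite -det_mulmx Q'Q det1 mul1r.
rewrite char_poly_trig; last exact: diag_mx_is_trig.
apply: eq_bigr => i _; rewrite !mxE eqxx mulr1n.
by rewrite rmorphB/= map_polyX map_polyC.
Qed.

Lemma trace_pow_eigenvalues N (A : 'M[R]_N) k : A^T = A ->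
  \tr (A ^+ k) = \sum_(x <- eigenvalues A) x ^+ k.
Proof.
move=> symA; have [U [r [UU UU' AE evE]]] := spectral_real symA.
rewrite (perm_big _ evE) /= big_map big_enum /=.
apply: (@complexI R); rewrite -[LHS](trace_map_mx toC) rmorph_sum /=.
have powE : map_mx toC (A ^+ k) = adjmx U *m diag_mx (\row_i toC (r i) ^+ k) *m U.
  elim: k => [|k IH].
    rewrite expr0 (_ : map_mx toC 1 = 1%:M); last exact: map_mx1.
    rewrite (_ : \row_i _ = const_mx 1); last by apply/rowP => i; rewrite !mxE expr0.
    by rewrite diag_const_mx mulmx1 UU'.
  rewrite exprS (_ : A * A ^+ k = A *m A ^+ k)// map_mxM IH AE.
  rewrite -!mulmxA (mulmxA U) UU mul1mx; congr (_ *m _); rewrite !mulmxA; congr (_ *m _).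
  rewrite mulmx_diag; congr diag_mx; apply/rowP => i; rewrite !mxE.
  by rewrite exprS.
rewrite powE -mulmxA mxtrace_mulC -mulmxA UU mulmx1 mxtrace_diag.
by apply: eq_bigr => i _; rewrite mxE rmorphXn.
Qed.

Implicit Types N : nat.

Definition qform N (M : 'M[C]_N) (u : 'rV[C]_N) : C := (u *m M *m adjmx u) 0 0.
Definition sqnorm N (u : 'rV[C]_N) : C := \sum_i `|u 0 i| ^+ 2.

Lemma qform_diag N (D : 'rV[C]_N) (u : 'rV[C]_N) :
  qform (diag_mx D) u = \sum_i D 0 i * `|u 0 i| ^+ 2.
Proof.
rewrite /qform mul_mx_diag mxE; apply: eq_bigr => i _.
by rewrite !mxE normCK; ring.
Qed.

Lemma qform1 N (u : 'rV[C]_N) : qform 1%:M u = sqnorm u.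
Proof.
rewrite -diag_const_mx qform_diag; apply: eq_bigr => i _.
by rewrite mxE mul1r.
Qed.

Lemma qform_conj N (U M : 'M[C]_N) (u : 'rV[C]_N) :
  qform (adjmx U *m M *m U) u = qform M (u *m adjmx U).
Proof. by rewrite /qform adjmxM adjmxK !mulmxA. Qed.

Lemma sqnorm_unitary N (U : 'M[C]_N) (u : 'rV[C]_N) : adjmx U *m U = 1%:M ->
  sqnorm (u *m adjmx U) = sqnorm u.
Proof. by move=> UU; rewrite -!qform1 -qform_conj mulmx1 UU. Qed.

Lemma count_enum (T : finType) (p : pred T) : count p (enum T) = #|p|.
Proof. by rewrite -sum1_count big_enum_cond /= sum1_card. Qed.

Lemma norm_realC (x : R) : `|toC x| = toC `|x|.
Proof. by rewrite normc_def /= expr0n addr0 sqrtr_sqr. Qed.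

(** The Schur test, for a symmetric matrix: the product of two coordinates is at
    most the mean of their squares. *)
Lemma qform_rowsum N (E : 'M[R]_N) (eps : R) (u : 'rV[C]_N) :
  E^T = E -> (forall i, \sum_j `|E i j| <= eps) ->
  `|qform (map_mx toC E) u| <= toC eps * sqnorm u.
Proof.
move=> symE rowE; rewrite /qform mxE.
pose t i j : C := toC `|E i j| * `|u 0 i| ^+ 2 / 2.
have tsum : \sum_i \sum_j t i j <= toC eps * sqnorm u / 2.
  rewrite /sqnorm mulr_sumr mulr_suml; apply: ler_sum => i _.
  rewrite -!mulr_suml ler_wpM2r ?invr_ge0// ler_wpM2r ?exprn_ge0//.
  by rewrite -rmorph_sum lecR.
apply: (@le_trans _ _ (\sum_j \sum_i (t i j + t j i))); last first.
  under eq_bigr => j _ do rewrite big_split /=.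
  rewrite big_split /= exchange_big /= [leRHS]splitr.
  by rewrite lerD.
rewrite (le_trans (ler_norm_sum _ _ _))//; apply: ler_sum => j _.
rewrite mxE mulr_suml (le_trans (ler_norm_sum _ _ _))//; apply: ler_sum => i _.
rewrite !mxE !normrM norm_conjC norm_realC.
have -> : t i j + t j i = toC `|E i j| * ((`|u 0 i| ^+ 2 + `|u 0 j| ^+ 2) / 2).
  have symij : E j i = E i j by rewrite -[in LHS]symE mxE.
  by rewrite /t symij [RHS]mulrA mulrDr mulrDl.
have a0 : 0 <= `|u 0 i| by []; have b0 : 0 <= `|u 0 j| by [].
have e0 : 0 <= toC `|E i j| by rewrite -norm_realC.
rewrite [`|u 0 i| * _]mulrC -mulrA ler_wpM2l// -subr_ge0.
have -> : (`|u 0 i| ^+ 2 + `|u 0 j| ^+ 2) / 2 - `|u 0 i| * `|u 0 j| =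
   (`|u 0 i| - `|u 0 j|) ^+ 2 / 2.
  move: (`|u 0 i|) (`|u 0 j|) => a b; rewrite sqrrB -[a * b in LHS](@mulfK _ 2)//.
  by rewrite -mulrBl mulr_natr addrAC.
rewrite divr_ge0// real_exprn_even_ge0// rpredB// ger0_real.
Qed.

(** Consider the vectors that are annihilated by the part of rank [r], orthogonal to
    the eigenvectors of [A] for eigenvalues above [x] and to those of [A'] for
    eigenvalues at most [x + eps]. If the inequality failed, these would be fewer
    than [N] linear conditions. On a nonzero solution the form of [A] is at most [x]
    and that of [A'] exceeds [x + eps], although they differ by that of [E]. *)
Lemma eigenvalue_count_perturb N r (A A' E : 'M[R]_N) (Q : 'M[R]_(N, r))
    (T : 'M[R]_(r, N)) (eps x : R) :
  A^T = A -> A'^T = A' -> E^T = E -> A' = A + Q *m T + E ->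
  (forall i, \sum_j `|E i j| <= eps) -> 
  (count [pred t | t <= x]%R (eigenvalues A) <=
   count [pred t | t <= x + eps]%R (eigenvalues A') + r)%N.
Proof.
move=> symA symA' symE A'E rowE.
have [U [l [UU UU' AE evE]]] := spectral_real symA.
have [U' [l' [VV VV' AE' evE']]] := spectral_real symA'.
rewrite (permP evE) (permP evE') [count _ (map l _)]count_map [count _ (map l' _)]count_map.
set y := x + eps.
pose out := [pred i | ~~ (l i <= x)]; pose out' := [pred i | l' i <= y].
rewrite !count_enum.
have -> : #|preim l [pred t | t <= x]| = (N - #|out|)%N.
  rewrite -[N in (N - _)%N]card_ord -(cardC out) addKn; apply: eq_card => i.
  by rewrite !inE negbK.
rewrite -[#|preim l' _|]/#|out'| leq_subLR leqNgt; apply/negP => few.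
pose M := row_mx (map_mx toC Q) (row_mx (colsub (enum_val : 'I_#|out| -> 'I_N) (adjmx U))
  (colsub (enum_val : 'I_#|out'| -> 'I_N) (adjmx U'))).
have kerM : kermx M != 0.
  rewrite -mxrank_eq0 mxrank_ker subn_eq0 -ltnNge (leq_ltn_trans (rank_leq_col _))//.
  by rewrite addnC -addnA.
have /rowV0Pn[u uM u0] := kerM.
move/sub_kermxP : uM; rewrite !mul_mx_row.
move/eqP; rewrite -!row_mx0 => /eqP /eq_row_mx[uQ /eq_row_mx[uU uU']].
have cU i : x < l i -> (u *m adjmx U) 0 i = 0.
  rewrite ltNge => iout; have io : i \in out by [].
  have := congr1 (fun B : 'rV[C]_(_) => B 0 (enum_rank_in io i)) uU.
  rewrite /= mxE [X in _ = X]mxE => <-; rewrite mxE.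
  by apply: eq_bigr => j _; rewrite [colsub _ _ _ _]mxE enum_rankK_in.
have cU' i : l' i <= y -> (u *m adjmx U') 0 i = 0.
  move=> iout; have io : i \in out' by [].
  have := congr1 (fun B : 'rV[C]_(_) => B 0 (enum_rank_in io i)) uU'.
  rewrite /= mxE [X in _ = X]mxE => <-; rewrite mxE.
  by apply: eq_bigr => j _; rewrite [colsub _ _ _ _]mxE enum_rankK_in.
have qA : qform (map_mx toC A) u <= toC x * sqnorm u.
  rewrite AE qform_conj qform_diag -(sqnorm_unitary u UU') /sqnorm mulr_sumr.
  apply: ler_sum => i _; rewrite mxE.
  have [h|/cU->] := leP (l i) x; last by rewrite normr0 expr0n !mulr0.
  by rewrite ler_wpM2r ?exprn_ge0// lecR.
have qA' : toC y * sqnorm u < qform (map_mx toC A') u.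
  rewrite AE' qform_conj qform_diag -(sqnorm_unitary u VV') /sqnorm mulr_sumr.
  set c := u *m adjmx U'; have [i ci] : exists i, c 0 i != 0.
    apply/rV0Pn; apply: contra u0 => /eqP c0.
    by rewrite -[u]mulmx1 -VV' mulmxA -/c c0 mul0mx.
  rewrite -subr_gt0 -sumrB (bigD1 i)//= ltr_pwDl//.
    rewrite mxE -mulrBl mulr_gt0 ?exprn_gt0 ?normr_gt0// subr_gt0 ltcR ltNge.
    by apply: contra ci => /cU'->.
  apply: sumr_ge0 => j _; rewrite mxE subr_ge0.
  have [/cU'->|h] := leP (l' j) y; first by rewrite normr0 expr0n !mulr0.
  by rewrite ler_wpM2r ?exprn_ge0// lecR ltW.
have qE := qform_rowsum u symE rowE.
have split_q : qform (map_mx toC A') u = qform (map_mx toC A) u + qform (map_mx toC E) u.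
  rewrite A'E !map_mxD map_mxM /qform !mulmxDr !mulmxDl mulmxA uQ mul0mx mul0mx addr0.
  by rewrite mxE.
have lt_q : toC eps * sqnorm u < qform (map_mx toC E) u.
  rewrite -(ltrD2l (toC x * sqnorm u)) -mulrDl -rmorphD (lt_le_trans qA')//.
  by rewrite split_q lerD2r.
have q0 : 0 <= qform (map_mx toC E) u.
  by rewrite (le_trans _ (ltW lt_q))// (le_trans _ qE).
have q_le : qform (map_mx toC E) u <= toC eps * sqnorm u by rewrite -(ger0_norm q0).
by have := lt_le_trans lt_q q_le; rewrite ltxx.
Qed.

End SpectralForm.

(** * Polynomial approximation *)

Section Weierstrass.
Context {R : realType}.
Implicit Types (f g : R -> R) (K : R).

Definition clamp K (x : R) : R := Num.max (- K) (Num.min x K).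

Lemma clamp_id K x : `|x| <= K -> clamp K x = x.
Proof. by rewrite ler_norml => /andP[? ?]; rewrite /clamp min_l// max_r. Qed.

Lemma clamp_bound K x : 0 <= K -> `|clamp K x| <= K.
Proof.
move=> K0; rewrite ler_norml /clamp le_max lexx /= ge_max ge_min lexx orbT andbT.
by rewrite (le_trans _ K0)// oppr_le0.
Qed.

Lemma clamp_mono K : {homo clamp K : x y / x <= y}.
Proof.
move=> x y xy; rewrite /clamp ge_max le_max lexx /= le_max; apply/orP; right.
by rewrite le_min !ge_min xy lexx orbT.
Qed.

Lemma clampD K x e : 0 <= e -> clamp K (x + e) <= clamp K x + e.
Proof.
move=> e0; rewrite /clamp maxEle minEle (maxEle (- K)) (minEle x).
by do !case: ifPn; rewrite -?ltNge; move=> *; lra.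
Qed.

Lemma clamp_lip K x y : `|clamp K x - clamp K y| <= `|x - y|.
Proof.
wlog xy : x y / x <= y.
  move=> H; have [/H//|/ltW/H] := leP x y.
  by rewrite distrC [leRHS]distrC.
rewrite distrC ger0_norm ?subr_ge0 ?clamp_mono// distrC ger0_norm ?subr_ge0//.
by rewrite lerBlDl (le_trans _ (clampD _ _ _)) ?subr_ge0// addrC subrK.
Qed.

Lemma clamp_continuous K : continuous (clamp K).
Proof.
move=> x; apply: (@continuous_max _ _ (fun=> - K) (fun x => Num.min x K)).
  exact: cvg_cst.
apply: (@continuous_min _ _ id (fun=> K)); [exact: cvg_id|exact: cvg_cst].
Qed.

Lemma continuous_bounded f K : 0 <= K -> continuous f ->
  exists2 M, 0 <= M & forall x, `|x| <= K -> `|f x| <= M.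
Proof.
move=> K0 cf; have KK : - K <= K by rewrite (le_trans _ K0)// oppr_le0.
have cnf : continuous (fun x => `|f x|) by move=> x; apply: cvg_norm; exact: cf.
have [c _ cM] := EVT_max KK (continuous_subspaceT cnf).
by exists `|f c| => // x xK; apply: cM; rewrite in_itv /= -ler_norml.
Qed.

(** Uniform continuity, in a form that can be averaged against a variance. *)
Lemma continuous_le_quadratic f K (eta : R) : 0 <= K -> continuous f -> 0 < eta ->
  exists2 C, 0 <= C & forall x y, `|x| <= K -> `|y| <= K ->
    `|f x - f y| <= eta + C * (x - y) ^+ 2.
Proof.
move=> K0 cf e0; have e2 : 0 < eta / 2 by rewrite divr_gt0.
have cK : compact (`[- K, K]%classic : set R) by exact: segment_compact.
have [M M0 fM] := continuous_bounded K0 cf.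
pose Q (delta x : R) := forall y, `|x - y| < delta -> `|f x - f y| <= eta.
have covQ : forall x, `[- K, K]%classic x -> \forall x' \near x & delta \near (0 : R)^'+, Q delta x'.
  move=> x _; have /cvgrPdist_lt /(_ _ e2) := cf x.
  move=> /nbhs_ballP[d /= d0 dP]; have d2 : 0 < d / 2 by rewrite divr_gt0.
  exists (ball x (d / 2), [set delta | 0 < delta < d / 2]) => /=.
    split; first exact: nbhsx_ballx.
    by near=> delta; apply/andP; split; near: delta; [exact: nbhs_right_gt|exact: nbhs_right_lt].
  move=> [x' delta] /= [xx' /andP[_ dd]] y x'y.
  have h1 : `|f x - f x'| < eta / 2.
    by apply: dP; rewrite /ball /= (lt_trans xx')// ltr_pdivrMr// ltr_pMr// ltr1n.
  have h2 : `|f x - f y| < eta / 2.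
    apply: dP; rewrite /ball /= (_ : x - y = (x - x') + (x' - y)); last by ring.
    rewrite (le_lt_trans (ler_normD _ _))// [ltRHS](splitr d) ltrD// (lt_trans x'y)//.
  rewrite (_ : f x' - f y = (f x - f y) - (f x - f x')); last by ring.
  by rewrite (le_trans (ler_normB _ _))// [leRHS](splitr eta) ltW// ltrD.
have [delta [delta0 covD]] : exists delta : R, 0 < delta /\ forall x, `|x| <= K -> Q delta x.
  have /compact_near_coveringP/(_ R (0^'+) Q _ covQ) nearQ := cK.
  near (0 : R)^'+ => delta; exists delta; split; first by near: delta; exact: nbhs_right_gt.
  move=> x xK; have : `[- K, K]%classic x by rewrite /= in_itv /= -ler_norml.
  by move: x {xK}; near: delta; exact: nearQ.
have C0 : 0 <= 2 * M / delta ^+ 2.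
  by apply: mulr_ge0; [exact: mulr_ge0|rewrite invr_ge0 sqr_ge0].
exists (2 * M / delta ^+ 2) => //.
move=> x y xK yK; have [xy|xy] := ltP `|x - y| delta.
  by rewrite (le_trans (covD _ xK _ xy))// lerDl; apply: mulr_ge0 => //; exact: sqr_ge0.
rewrite (le_trans (ler_normB _ _))// (le_trans (lerD (fM _ xK) (fM _ yK)))//.
apply: (@le_trans _ _ (2 * M / delta ^+ 2 * (x - y) ^+ 2)); last by rewrite lerDr ltW.
rewrite -mulrA (_ : M + M = 2 * M * 1); last by ring.
rewrite ler_wpM2l ?mulr_ge0// mulrC ler_pdivlMr ?exprn_gt0// mul1r.
by rewrite -[leRHS]real_normK ?num_real// ler_pXn2r ?nnegrE// ltW.
Unshelve. all: by end_near.
Qed.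

(** Bernstein polynomials: [bern U n g] is the mean of [g] for the number of
    successes in [n] independent trials of success probability [U]. *)
Fixpoint bern (U : {poly R}) n (g : nat -> R) : {poly R} :=
  if n is n'.+1 then U * bern U n' (g \o S) + (1 - U) * bern U n' g
  else (g 0%N)%:P.

Lemma bern_le U n (g h : nat -> R) (t : R) : 0 <= U.[t] <= 1 ->
  (forall k, `|g k| <= h k) -> `|(bern U n g).[t]| <= (bern U n h).[t].
Proof.
move=> /andP[U0 U1]; elim: n g h => [|n IH] g h gh /=.
  by rewrite !hornerC.
rewrite !(hornerD, hornerM, hornerN, hornerC) (le_trans (ler_normD _ _))//.
have V0 : 0 <= 1 - U.[t] by rewrite subr_ge0.
rewrite !normrM (ger0_norm U0) (ger0_norm V0).
by rewrite lerD// ler_wpM2l// IH// => k /=; exact: gh.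
Qed.

Lemma bern_affine U n (g : nat -> R) (a b t : R) :
  (bern U n (fun k => a * g k + b)).[t] = a * (bern U n g).[t] + b.
Proof.
elim: n g => [|n IH] g /=; first by rewrite !hornerC.
rewrite !(hornerD, hornerM, hornerN, hornerC) (IH g).
have -> : (bern U n ((fun k => a * g k + b) \o S)).[t] =
  a * (bern U n (g \o S)).[t] + b := IH (g \o S).
by ring.
Qed.

Lemma bern_variance U n (c t : R) :
  (bern U n (fun k => (k%:R - c) ^+ 2)).[t] =
  n%:R * (U.[t] * (1 - U.[t])) + (n%:R * U.[t] - c) ^+ 2.
Proof.
elim: n c => [|n IH] c /=; first by rewrite hornerC; ring.
rewrite !(hornerD, hornerM, hornerN, hornerC) IH.
rewrite (_ : _ \o S = fun k : nat => (k%:R - (c - 1)) ^+ 2); last first.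
  by apply/funext => k /=; rewrite -natr1; congr (_ ^+ 2); ring.
by rewrite IH -natr1; ring.
Qed.

(** For the success probability [(x + K) / (2 * K)], the proportion of successes in
    [n] trials has variance at most [1 / n], so that [f] at the rescaled proportion
    is close to [f x] in mean. *)
Lemma weierstrass f K (eta : R) : 0 < K -> continuous f -> 0 < eta ->
  exists p : {poly R}, forall x, `|x| <= K -> `|f x - p.[x]| <= eta.
Proof.
move=> K0 cf e0; have e2 : 0 < eta / 2 by rewrite divr_gt0.
have [C C0 fC] := continuous_le_quadratic (ltW K0) cf e2.
pose n := (Num.truncn (C * (2 * K) ^+ 2 / (eta / 2))).+1.
have nC : C * (2 * K) ^+ 2 / n%:R <= eta / 2.
  have n0 : 0 < n%:R :> R by rewrite ltr0n.
  rewrite ler_pdivrMr// [leRHS]mulrC -ler_pdivrMr//; apply/ltW.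
  exact: truncnS_gt.
pose U : {poly R} := (2 * K)^-1 *: ('X + K%:P).
pose node (k : nat) : R := clamp K (2 * K * (k%:R / n%:R) - K).
exists (bern U n (f \o node)) => x xK.
set t := U.[x]; have tE : t = (x + K) / (2 * K).
  by rewrite /t /U hornerZ hornerD hornerX hornerC mulrC.
have xE : x = 2 * K * t - K by rewrite tE; field; rewrite gt_eqF.
have t01 : 0 <= t <= 1.
  move: xK; rewrite ler_norml => /andP[h1 h2]; rewrite tE divr_ge0 ?mulr_ge0 ?(ltW K0)//=.
    by rewrite ler_pdivrMr ?mulr_gt0//; lra.
  by lra.
have n0 : n%:R != 0 :> R by rewrite pnatr_eq0.
pose h k := C * (2 * K) ^+ 2 / n%:R ^+ 2 * (k%:R - n%:R * t) ^+ 2 + eta / 2.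
have -> : f x - (bern U n (f \o node)).[x] = - (bern U n (fun k => 1 * f (node k) - f x)).[x].
  by rewrite bern_affine mul1r opprB.
rewrite normrN (le_trans (@bern_le U n _ h x _ _))//.
  move=> k; rewrite mul1r (le_trans (fC _ _ _ xK))//; first by rewrite clamp_bound// ltW.
  rewrite /h addrC lerD2r -mulrA -[X in _ <= X]mulrA ler_wpM2l//.
  rewrite -[X in node k - X](clamp_id xK) -real_normK ?num_real//.
  rewrite (@le_trans _ _ (`|(2 * K * (k%:R / n%:R) - K) - x| ^+ 2))//.
    by rewrite ler_pXn2r ?nnegrE// clamp_lip.
  rewrite real_normK ?num_real// xE le_eqVlt; apply/orP; left; apply/eqP.
  by field.
rewrite bern_affine bern_variance -/t.
have -> : n%:R * (t * (1 - t)) + (n%:R * t - n%:R * t) ^+ 2 = n%:R * (t * (1 - t)) by ring.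
have tt : t * (1 - t) <= 1 by move: t01 => /andP[? ?]; nra.
rewrite [leRHS](splitr eta) lerD2r (le_trans _ nC)//.
have -> : C * (2 * K) ^+ 2 / n%:R ^+ 2 * (n%:R * (t * (1 - t))) =
  C * (2 * K) ^+ 2 / n%:R * (t * (1 - t)) by field.
by rewrite ler_piMr// divr_ge0// mulr_ge0// sqr_ge0.
Qed.

End Weierstrass.

(** * Comparison of sorted spectra *)

Section SortedShift.
Context {R : realType}.
Implicit Types (s : seq R) (x y e K : R).

Lemma sorted_count_gt s i y : sorted <=%R s -> (i < count [pred t | (t <= y)%R] s)%N ->
  s`_i <= y.
Proof.
move=> ss ic; rewrite leNgt; apply/negP => yi.
have isz : (i < size s)%N by rewrite (leq_trans ic)// count_size.
suff : (count [pred t | (t <= y)%R] s <= i)%N by rewrite leqNgt ic.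
rewrite -{1}(cat_take_drop i s) count_cat.
rewrite [X in (_ + X)%N](_ : _ = 0%N) ?addn0.
  by rewrite (leq_trans (count_size _ _))// size_take isz.
apply/eqP; rewrite -leqn0 leqNgt -has_count; apply/hasPn => t /(nthP 0)[j].
rewrite size_drop => jsz <-; rewrite nth_drop /= -ltNge (lt_le_trans yi)//.
apply: (sorted_leq_nth le_trans le_refl) => //; rewrite ?inE ?leq_addr//.
by rewrite -ltn_subRL.
Qed.

Lemma sorted_count_le s i : sorted <=%R s -> (i < size s)%N ->
  (i < count [pred t | (t <= s`_i)%R] s)%N.
Proof.
move=> ss isz; rewrite -{2}(cat_take_drop i.+1 s) count_cat.
rewrite (leq_trans _ (leq_addr _ _))// (_ : count _ _ = i.+1)//.
rewrite -[RHS](_ : size (take i.+1 s) = i.+1); last by rewrite size_takel.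
apply/eqP; rewrite -all_count; apply/allP => t /(nthP 0)[j].
rewrite size_takel// => ji <-; rewrite nth_take//=.
by apply: (sorted_leq_nth le_trans le_refl) => //; rewrite inE (leq_ltn_trans _ isz).
Qed.

(** Up to [r] exceptions and a translation by [e], the list [s] lies above [s'];
    it is the conclusion of the comparison of perturbed spectra. *)
Definition spectral_shift r e s s' := forall x,
  (count [pred t | (t <= x)%R] s <= count [pred t | (t <= x + e)%R] s' + r)%N.

Lemma sorted_shift r e s s' i : sorted <=%R s -> sorted <=%R s' ->
  spectral_shift r e s s' -> (i + r < size s)%N -> s'`_i <= s`_(i + r) + e.
Proof.
move=> ss ss' sh ir; apply: sorted_count_gt => //.
have := leq_trans (sorted_count_le ss ir) (sh _).
by rewrite addnC -addnS addnC leq_add2r.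
Qed.

Lemma sum_shift_le (G : nat -> R) N k K : (forall i, `|G i| <= K) ->
  \sum_(i < N) (G (i + k)%N - G i) <= k%:R * (2 * K).
Proof.
move=> GK; elim: k => [|k IH].
  by rewrite mul0r big1// => i _; rewrite addn0 subrr.
rewrite (eq_bigr (fun i : 'I_N => (G (i + k).+1 - G (i + k)%N) + (G (i + k)%N - G i))); last first.
  by move=> i _; rewrite addnS; ring.
rewrite big_split /= -natr1 mulrDl mul1r addrC lerD//.
rewrite -(big_mkord xpredT (fun i => G (i + k).+1 - G (i + k)%N)).
rewrite (telescope_sumr (fun i => G (i + k)%N))//.
have := GK (N + k)%N; have := GK (0 + k)%N; rewrite !ler_norml.
by move=> /andP[? ?] /andP[? ?]; lra.
Qed.

(** Matching the sorted spectra, the clamped eigenvalues differ little in mean,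
    for their differences are bounded by a telescoping sum. *)
Lemma clamp_matching r e s s' K : 0 <= K -> 0 <= e -> size s' = size s ->
  sorted <=%R s -> sorted <=%R s' -> spectral_shift r e s s' -> spectral_shift r e s' s ->
  \sum_(i < size s) `|clamp K s'`_i - clamp K s`_i| <=
  (4 * K) * r%:R + e * (size s)%:R.
Proof.
move=> K0 e0 szE ss ss' sh sh'; set N := size s.
pose G j : R := if (j < r)%N then - K else if (j < N + r)%N then clamp K s`_(j - r) else K.
have GK j : `|G j| <= K.
  rewrite /G; case: ifP => _; first by rewrite normrN ger0_norm.
  by case: ifP => _; [exact: clamp_bound|rewrite ger0_norm].
have lowK x : - K <= clamp K x by have := clamp_bound x K0; rewrite ler_norml => /andP[].
have upK x : clamp K x <= K by have := clamp_bound x K0; rewrite ler_norml => /andP[].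
have GE (i : 'I_N) : G (i + r)%N = clamp K s`_i.
  by rewrite /G ltnNge leq_addl /= ltn_add2r ltn_ord addnK.
have mono i j : (i <= j < N)%N -> clamp K s`_i <= clamp K s`_j.
  move=> /andP[ij jN]; apply: clamp_mono.
  by apply: (sorted_leq_nth le_trans le_refl) => //; rewrite inE ?(leq_ltn_trans ij).
have bound (i : 'I_N) : `|clamp K s'`_i - clamp K s`_i| <= (G (i + 2 * r)%N - G i) + e.
  have lo : G i <= clamp K s`_i.
    rewrite /G; case: ltnP => // ri; rewrite ltn_addr//.
    by apply: mono; rewrite leq_subr ltn_ord.
  have hi : clamp K s`_i <= G (i + 2 * r)%N.
    rewrite /G mul2n -addnn addnA ltnNge leq_addl /= ltn_add2r.
    by case: ltnP => // h; rewrite addnK; apply: mono; rewrite leq_addr.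
  have lo' : G i - e <= clamp K s'`_i.
    rewrite /G; case: ltnP => ri; first by rewrite (le_trans _ (lowK _))// gerBl.
    rewrite ltn_addr// lerBlDr (le_trans _ (clampD _ _ e0))//; apply: clamp_mono.
    have := sorted_shift (i := i - r) ss' ss sh'; rewrite subnK// szE; apply.
    exact: ltn_ord.
  have hi' : clamp K s'`_i <= G (i + 2 * r)%N + e.
    rewrite /G mul2n -addnn addnA ltnNge leq_addl /= ltn_add2r.
    case: ltnP => h; last by rewrite (le_trans (upK _))// lerDl.
    rewrite addnK (le_trans _ (clampD _ _ e0))//; apply: clamp_mono.
    exact: sorted_shift.
  by rewrite ler_norml; apply/andP; split; lra.
apply: le_trans (ler_sum _ (fun i _ => bound i)) _.
rewrite big_split /= sumr_const card_ord -[e *+ N]mulr_natr lerD2r.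
rewrite (le_trans (sum_shift_le _ _ GK))// natrM le_eqVlt; apply/orP; left; apply/eqP.
by ring.
Qed.

Lemma lip_matching r e s s' K L (h : R -> R) : 0 <= K -> 0 <= e -> size s' = size s ->
  sorted <=%R s -> sorted <=%R s' -> spectral_shift r e s s' -> spectral_shift r e s' s ->
  0 <= L -> (forall x y, `|x| <= K -> `|y| <= K -> `|h x - h y| <= L * `|x - y|) ->
  `|\sum_(x <- s') h (clamp K x) - \sum_(x <- s) h (clamp K x)| <=
  L * ((4 * K) * r%:R + e * (size s)%:R).
Proof.
move=> K0 e0 szE ss ss' sh sh' L0 hL.
rewrite (big_nth 0) [X in _ - X](big_nth 0) szE !big_mkord -sumrB.
rewrite (le_trans (ler_norm_sum _ _ _))//.
rewrite (le_trans _ (ler_wpM2l L0 (clamp_matching K0 e0 szE ss ss' sh sh')))//.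
by rewrite mulr_sumr; apply: ler_sum => i _; apply: hL; exact: clamp_bound.
Qed.

End SortedShift.

(** * From moments to weak convergence *)

Section MomentsToWeak.
Context {R : realType}.
Implicit Types (f : R -> R) (s : seq R) (v K : R).

Lemma horner_continuous (p : {poly R}) : continuous (fun x => p.[x]).
Proof.
elim/poly_ind: p => [|p c IH].
  rewrite (_ : (fun x => _) = cst 0); first exact: cst_continuous.
  by apply/funext => x; rewrite horner0.
rewrite (_ : (fun x => _) = fun x => p.[x] * x + c); last first.
  by apply/funext => x; rewrite hornerMXaddC.
move=> x; apply: cvgD; last exact: cvg_cst.
by apply: cvgM; [exact: IH|exact: cvg_id].
Qed.

Lemma horner_lipschitz (p : {poly R}) K : 0 <= K ->
  exists2 L, 0 <= L & forall x y, `|x| <= K -> `|y| <= K -> `|p.[x] - p.[y]| <= L * `|x - y|.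
Proof.
move=> K0; elim/poly_ind: p => [|p c [L L0 IH]].
  by exists 0 => // x y _ _; rewrite !horner0 subrr normr0 mul0r.
have [M M0 pM] := continuous_bounded K0 (@horner_continuous p).
exists (L * K + M); first by rewrite addr_ge0// mulr_ge0.
move=> x y xK yK; rewrite !hornerMXaddC.
have -> : p.[x] * x + c - (p.[y] * y + c) = (p.[x] - p.[y]) * x + p.[y] * (x - y) by ring.
rewrite (le_trans (ler_normD _ _))// !normrM mulrDl lerD//.
  rewrite -mulrA [K * _]mulrC mulrA ler_pM//; exact: IH.
by rewrite ler_wpM2r// pM.
Qed.

Lemma horner_growth (p : {poly R}) : exists2 M, 0 <= M &
  forall x, 1 <= `|x| -> `|p.[x]| <= M * x ^+ (2 * size p).
Proof.
exists (\sum_(i < size p) `|p`_i|); first exact: sumr_ge0.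
move=> x x1; rewrite horner_coef (le_trans (ler_norm_sum _ _ _))// mulr_suml.
apply: ler_sum => i _; rewrite normrM ler_wpM2l// normrX.
rewrite exprM -(real_normK (num_real x)) -exprM ler_weXn2l//.
by rewrite mul2n -addnn ltnW// ltn_addr.
Qed.

Definition average s f : R := (size s)%:R^-1 * \sum_(x <- s) f x.

Lemma averageD s f g a : average s (fun x => a * f x + g x) = a * average s f + average s g.
Proof. by rewrite /average big_split /= -mulr_sumr; ring. Qed.

Lemma average_cst s (c : R) : (0 < size s)%N -> average s (fun=> c) = c.
Proof.
move=> s0; rewrite /average big_const_seq count_predT iter_addr addr0 -[c *+ _]mulr_natl.
by rewrite mulrA mulVf ?mul1r// pnatr_eq0 -lt0n.
Qed.

Lemma average_close s f g h : (forall x, `|f x - g x| <= h x) ->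
  `|average s f - average s g| <= average s h.
Proof.
move=> fgh; rewrite /average -mulrBr normrM ger0_norm ?invr_ge0// ler_wpM2l ?invr_ge0//.
by rewrite -sumrB (le_trans (ler_norm_sum _ _ _))//; apply: ler_sum.
Qed.

Lemma arc_close v f g (eta : R) : 0 <= v -> continuous f -> continuous g ->
  (forall x, `|x| <= 2 * Num.sqrt v -> `|f x - g x| <= eta) ->
  `|arc_integral v f - arc_integral v g| <= eta.
Proof.
move=> v0 cf cg fg; rewrite addrC -mulN1r -arc_integralD//.
apply: arc_integral_le => //.
  by move=> x; apply: cvgD; [apply: cvgM; [exact: cvg_cst|exact: cg]|exact: cf].
by move=> x xv; rewrite mulN1r addrC fg.
Qed.

Lemma average_poly v (p : {poly R}) s (delta : R) : 0 <= v -> 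
  (forall j, (j < size p)%N -> `|average s (fun x => x ^+ j) - ballot v 0 j| <= delta) ->
  `|average s (fun x => p.[x]) - arc_integral v (fun x => p.[x])| <=
  (\sum_(i < size p) `|p`_i|) * delta.
Proof.
move=> v0; suff H : forall n, (forall j, (j < n)%N -> `|average s (fun x => x ^+ j) - ballot v 0 j| <= delta) ->
  `|average s (fun x => \sum_(i < n) p`_i * x ^+ i) -
   arc_integral v (fun x => \sum_(i < n) p`_i * x ^+ i)| <= (\sum_(i < n) `|p`_i|) * delta.
  by move=> hj; have := H _ hj; under eq_fun do rewrite -horner_coef.
have csum : forall n, continuous (fun x : R => \sum_(i < n) p`_i * x ^+ i).
  move=> n; rewrite (_ : (fun x => _) = fun x => (\poly_(i < n) p`_i).[x]); last first.
    by apply/funext => x; rewrite horner_poly.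
  exact: horner_continuous.
elim=> [_|n IH hj].
  have E : (fun x : R => \sum_(i < 0) p`_i * x ^+ i) = cst 0.
    by apply/funext => x; rewrite big_ord0.
  rewrite big_ord0 mul0r E (_ : average s (cst 0) = 0) ?sub0r ?normrN.
    by apply: arc_integral_le => // [|x _]; [exact: cst_continuous|rewrite normr0].
  by rewrite /average big1 ?mulr0.
rewrite (_ : (fun x : R => \sum_(i < n.+1) p`_i * x ^+ i) =
    fun x => p`_n * x ^+ n + \sum_(i < n) p`_i * x ^+ i); last first.
  by apply/funext => x; rewrite big_ord_recr addrC.
rewrite averageD arc_integralD//; last exact: exprn_continuous.
rewrite arc_moment// big_ord_recr /= opprD addrACA -mulrBr mulrDl addrC.
rewrite (le_trans (ler_normD _ _))// lerD//.
  by apply: IH => j jn; rewrite hj// ltnW.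
by rewrite normrM ler_wpM2l// hj.
Qed.

(** A polynomial [p] approximates [f] on an interval larger than the support of the
    semicircle law. Outside of it, [f - p] is dominated by a multiple of a high even
    power, whose moment is exponentially small relative to the size of the
    interval. *)
Lemma average_close_of_moments v f (M eta : R) : 0 <= v -> continuous f ->
  (forall x, `|f x| <= M) -> 0 < eta -> exists k : nat, exists2 delta, 0 < delta &
  forall s, (forall j, (j < k)%N -> `|average s (fun x => x ^+ j) - ballot v 0 j| <= delta) ->
  (0 < size s)%N -> `|average s f - arc_integral v f| <= eta.
Proof.
move=> v0 cf fM e0; pose rho := 2 * Num.sqrt v; pose K := rho + 1.
have rho0 : 0 <= rho by rewrite mulr_ge0// sqrtr_ge0.
have K1 : 1 <= K by rewrite lerDr.
have K0 : 0 < K by rewrite (lt_le_trans ltr01).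
pose eta' := eta / 6; have e0' : 0 < eta' by rewrite divr_gt0.
have [p fp] := weierstrass K0 cf e0'.
have [Mp Mp0 pM] := horner_growth p.
have M0 : 0 <= M by rewrite (le_trans _ (fM 0)).
pose M' := M + Mp; have M'0 : 0 <= M' by rewrite addr_ge0.
pose d := (2 * size p)%N.
(* outside the support the tails are controlled by a high even moment *)
pose q := (rho / K) ^+ 2.
have q0 : 0 <= q by rewrite sqr_ge0.
have q1 : `|q| < 1.
  rewrite ger0_norm// expr_lt1 ?divr_ge0 ?(ltW K0)//.
  by rewrite ltr_pdivrMr// mul1r ltrDl.
have [L tail] : exists L, M' * rho ^+ d * q ^+ L <= eta'.
  have : (M' * rho ^+ d * q ^+ n) @[n --> \oo] --> M' * rho ^+ d * 0.
    by apply: cvgM; [exact: cvg_cst|exact: cvg_expr].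
  rewrite mulr0 => /cvgrPdist_le /(_ _ e0') [n _ /(_ n (leqnn n))] h.
  exists n; move: h; rewrite sub0r normrN; apply: le_trans; exact: ler_norm.
pose D := (d + 2 * L)%N.
pose P := \sum_(i < size p) `|p`_i|; have P0 : 0 <= P by exact: sumr_ge0.
pose delta := eta' / (1 + M' + P).
have den : 0 < 1 + M' + P by rewrite -addrA ltr_pwDl// addr_ge0.
have delta0 : 0 < delta by rewrite divr_gt0.
have deltaE : delta * (1 + M' + P) = eta' by rewrite /delta divfK// gt_eqF.
have M'd : M' * delta <= eta'.
  by rewrite -deltaE mulrC ler_wpM2l ?ltW//; lra.
have Pd : P * delta <= eta'.
  by rewrite -deltaE mulrC ler_wpM2l ?ltW//; lra.
exists (maxn (size p) D.+1); exists delta => // s hs s0.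
pose h x := M' * (K ^+ (2 * L))^-1 * x ^+ D + eta'.
have KL0 : 0 < K ^+ (2 * L) by rewrite exprn_gt0.
have xD0 x : 0 <= x ^+ D :> R.
  by rewrite /D /d -mulnDr exprM exprn_ge0// sqr_ge0.
have fph x : `|f x - p.[x]| <= h x.
  have [xK|xK] := leP `|x| K.
    rewrite (le_trans (fp _ xK))// lerDr mulr_ge0//.
    by rewrite mulr_ge0// invr_ge0 ltW.
  have x1 : 1 <= `|x| by rewrite (le_trans K1)// ltW.
  have xd1 : 1 <= x ^+ d.
    by rewrite /d exprM -(real_normK (num_real x)) -exprM exprn_ege1.
  apply: (@le_trans _ _ (M' * x ^+ d)).
    rewrite (le_trans (ler_normB _ _))// mulrDl lerD ?pM//.
    by rewrite (le_trans (fM x))// ler_peMr.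
  rewrite /h (@le_trans _ _ (M' * (K ^+ (2 * L))^-1 * x ^+ D))//; last first.
    by rewrite lerDl ltW.
  rewrite -mulrA ler_wpM2l// /D exprD mulrCA ler_peMr ?(le_trans ler01)//.
  rewrite mulrC ler_pdivlMr// mul1r exprM [leRHS]exprM.
  apply: lerXn2r; rewrite ?nnegrE ?sqr_ge0//.
  by rewrite -(real_normK (num_real x)) ler_pXn2r ?nnegrE// ltW.
have rhoK : rho <= K by rewrite lerDl.
have cp : continuous (fun x : R => p.[x]) by exact: horner_continuous.
have D0 : ballot v 0 D <= rho ^+ D.
  rewrite -arc_moment// (le_trans (ler_norm _))//.
  apply: arc_integral_le => //; first exact: exprn_continuous.
  by move=> x xr; rewrite normrX lerXn2r// nnegrE (le_trans (normr_ge0 x)).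
have avgD : average s (fun x => x ^+ D) <= rho ^+ D + delta.
  have /hs : (D < maxn (size p) D.+1)%N by rewrite leq_max ltnSn orbT.
  by rewrite ler_norml => /andP[_]; rewrite lerBlDl => /le_trans; apply; rewrite lerD2r.
have H1 : `|average s f - average s (fun x => p.[x])| <= 3 * eta'.
  rewrite (le_trans (average_close s fph))// /h averageD average_cst//.
  set c := M' * _; have c0 : 0 <= c by rewrite mulr_ge0// invr_ge0 ltW.
  have c1 : c * rho ^+ D <= eta'.
    apply: le_trans tail; rewrite /c /q /D exprD -exprM expr_div_n.
    move: (rho ^+ d) (rho ^+ (2 * L)) (K ^+ (2 * L))^-1 => u1 u2 u3.
    by rewrite le_eqVlt; apply/orP; left; apply/eqP; ring.
  have c2 : c * delta <= eta'.
    have c3 : c <= M' by apply: ler_piMr => //; rewrite invf_le1// exprn_ege1.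
    by apply: le_trans M'd; apply: ler_wpM2r => //; exact: ltW.
  have := ler_wpM2l c0 avgD; rewrite mulrDr; lra.
have H2 : `|average s (fun x => p.[x]) - arc_integral v (fun x => p.[x])| <= eta'.
  rewrite (le_trans _ Pd)//; apply: average_poly => // j jp.
  by apply: hs; rewrite leq_max jp.
have H3 : `|arc_integral v f - arc_integral v (fun x => p.[x])| <= eta'.
  by apply: arc_close => // x xr; rewrite fp// (le_trans xr).
have -> : eta = 6 * eta' by rewrite /eta'; field.
move: H1 H2 H3; rewrite !ler_norml => /andP[? ?] /andP[? ?] /andP[? ?].
by apply/andP; split; lra.
Qed.

End MomentsToWeak.

(** * Transfer of the limit between close spectra *)

Section Transfer.
Context {R : realType}.
Implicit Types (f : R -> R) (s : seq R) (v K : R).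

(** A continuous bound, together with [clamp], for the indicator of the points
    outside of the support of the semicircle law. *)
Definition excess (a y : R) : R := Num.max (`|y| - a) 0.

Lemma excess_lip a x y : `|excess a x - excess a y| <= `|x - y|.
Proof.
rewrite /excess !maxEle; have := ler_dist_dist x y; have := normr_ge0 (x - y).
by rewrite !ler_norml => ? /andP[? ?]; do !case: ifPn; rewrite -?ltNge => *; apply/andP; split; lra.
Qed.

Lemma excess_continuous a : continuous (excess a).
Proof.
move=> x; apply: (@continuous_max _ _ (fun x => `|x| - a) (fun=> 0)); last exact: cvg_cst.
by apply: cvgB; [apply: cvg_norm; exact: cvg_id|exact: cvg_cst].
Qed.

Lemma clamp_norm K x : 0 <= K -> K <= `|x| -> `|clamp K x| = K.
Proof.
move=> K0; rewrite ler_normr => /orP[Kx|Kx]; rewrite /clamp.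
  by rewrite min_r// max_r ?ger0_norm// (le_trans _ K0)// oppr_le0.
have xK : x <= - K by rewrite lerNr.
by rewrite min_l ?max_l ?normrN ?ger0_norm//; lra.
Qed.

Lemma average_matching r e s s' K L (h : R -> R) : 0 <= K -> 0 <= e ->
  (0 < size s)%N -> size s' = size s ->
  sorted <=%R s -> sorted <=%R s' -> spectral_shift r e s s' -> spectral_shift r e s' s ->
  0 <= L -> (forall x y, `|x| <= K -> `|y| <= K -> `|h x - h y| <= L * `|x - y|) ->
  `|average s' (h \o clamp K) - average s (h \o clamp K)| <=
  L * (4 * K * (r%:R / (size s)%:R) + e).
Proof.
move=> K0 e0 s0 szE ss ss' sh sh' L0 hL; rewrite /average szE -mulrBr normrM.
have N0 : 0 < (size s)%:R :> R by rewrite ltr0n.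
have NV : 0 <= (size s)%:R^-1 :> R by rewrite invr_ge0 ltW.
rewrite (ger0_norm NV) ler_pdivrMl//.
apply: le_trans (lip_matching K0 e0 szE ss ss' sh sh' L0 hL) _.
by rewrite le_eqVlt; apply/orP; left; apply/eqP; field; rewrite gt_eqF.
Qed.

(** Clamped Lipschitz functions have close averages over close spectra. Such a
    function [l] approximates [f] on an interval, and the proportion of eigenvalues
    outside of it is controlled by another one, [tau], whose integral is zero. *)
Lemma average_transfer v f (M eta : R) : 0 <= v -> continuous f ->
  (forall x, `|f x| <= M) -> 0 < eta -> exists k : nat, exists2 delta, 0 < delta &
  forall r e s s', (0 < size s)%N -> size s' = size s ->
  sorted <=%R s -> sorted <=%R s' -> spectral_shift r e s s' -> spectral_shift r e s' s ->
  r%:R / (size s)%:R <= delta -> 0 <= e <= delta ->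
  (forall j, (j < k)%N -> `|average s (fun x => x ^+ j) - ballot v 0 j| <= delta) ->
  `|average s' f - arc_integral v f| <= eta.
Proof.
move=> v0 cf fM e0; pose rho := 2 * Num.sqrt v; pose K := rho + 1.
have rho0 : 0 <= rho by rewrite mulr_ge0// sqrtr_ge0.
have K0 : 0 < K by rewrite ltr_wpDl.
have rhoK : rho <= K by rewrite lerDl.
pose eta1 := eta / 6; have e1 : 0 < eta1 by rewrite divr_gt0.
have [p fp] := weierstrass K0 cf e1.
have [Lp Lp0 pL] := horner_lipschitz p (ltW K0).
have M0 : 0 <= M by rewrite (le_trans _ (fM 0)).
pose M2 := 2 * M + eta1; have M20 : 0 <= M2 by rewrite addr_ge0 ?mulr_ge0// ltW.
pose l : R -> R := (fun x => p.[x]) \o clamp K.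
pose tau : R -> R := excess rho \o clamp K.
have cl : continuous l.
  by move=> x; apply: continuous_comp; [exact: clamp_continuous|exact: horner_continuous].
have ct : continuous tau.
  by move=> x; apply: continuous_comp; [exact: clamp_continuous|exact: excess_continuous].
have lM x : `|l x| <= M + eta1.
  have ck := clamp_bound x (ltW K0); have := fp _ ck; have := fM (clamp K x).
  by rewrite /l /= !ler_norml => /andP[? ?] /andP[? ?]; apply/andP; split; lra.
have t0 x : 0 <= tau x by rewrite /tau /excess /= le_max lexx orbT.
have tM x : `|tau x| <= 1.
  rewrite ger0_norm// /tau /excess /= ge_max ler01 andbT lerBlDr addrC.
  exact: (clamp_bound x (ltW K0)).
have close x : `|f x - l x| <= M2 * tau x + eta1.
  have [xK|Kx] := leP `|x| K.
    rewrite /l /= clamp_id// (le_trans (fp _ xK))// lerDr; exact: mulr_ge0.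
  have -> : tau x = 1.
    rewrite /tau /excess /= clamp_norm ?(ltW K0)// ?ltW//.
    by rewrite (_ : K - rho = 1) ?max_l// /K; ring.
  rewrite (le_trans (ler_normB _ _))// mulr1 (le_trans (lerD (fM x) (lM x)))//.
  by rewrite /M2; lra.
pose eta2 := eta1 / (M2 + 1); have M21 : 0 < M2 + 1 by rewrite ltr_wpDl.
have e2 : 0 < eta2 by rewrite divr_gt0.
have e2E : eta2 * (M2 + 1) = eta1 by rewrite /eta2 divfK// gt_eqF.
have [k1 [d1 d10 near_l]] := average_close_of_moments v0 cl lM e1.
have [k2 [d2 d20 near_t]] := average_close_of_moments v0 ct tM e2.
pose D := (4 * K + 1) * (Lp + M2 + 1).
have D0 : 0 < D by rewrite mulr_gt0// ltr_wpDl// ?addr_ge0// mulr_ge0// ltW.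
pose d3 := eta1 / D; have d30 : 0 < d3 by rewrite divr_gt0.
have d3E : d3 * D = eta1 by rewrite /d3 divfK// gt_eqF.
exists (maxn k1 k2); exists (Num.min d1 (Num.min d2 d3)); first by rewrite !lt_min d10 d20 d30.
move=> r e s s' s0 szE ss ss' sh sh' rd /andP[ee ed] mom.
have ld (x : R) : x <= Num.min d1 (Num.min d2 d3) -> [/\ x <= d1, x <= d2 & x <= d3].
  by rewrite !le_min => /and3P[].
have [_ _ rd3] := ld _ rd; have [_ _ ed3] := ld _ ed.
have avl : `|average s l - arc_integral v l| <= eta1.
  apply: near_l => // j jk; have /mom : (j < maxn k1 k2)%N by rewrite leq_max jk.
  by move/ld => [].
have avt : `|average s tau - arc_integral v tau| <= eta2.
  apply: near_t => // j jk; have /mom : (j < maxn k1 k2)%N by rewrite leq_max jk orbT.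
  by move/ld => [].
have arct : `|arc_integral v tau| <= 0.
  apply: arc_integral_le => // x xr; rewrite ger0_norm//.
  by rewrite /tau /excess /= clamp_id ?(le_trans xr)// ge_max lexx andbT subr_le0.
have arcl : `|arc_integral v f - arc_integral v l| <= eta1.
  apply: arc_close => // x xr; have xK : `|x| <= K by rewrite (le_trans xr).
  by rewrite /l /= clamp_id// fp.
have matl := average_matching (ltW K0) ee s0 szE ss ss' sh sh' Lp0 pL.
have matt := @average_matching r e s s' K 1 _ (ltW K0) ee s0 szE ss ss' sh sh' ler01
  (fun x y _ _ => le_trans (excess_lip rho x y) (eq_ind_r (fun z => `|x - y| <= z) (lexx _) (mul1r _))).
have s'0 : (0 < size s')%N by rewrite szE.
have fl := average_close s' close.
rewrite averageD average_cst// in fl.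
pose q := 4 * K * (r%:R / (size s)%:R) + e.
have K4 : 0 <= 4 * K by apply: mulr_ge0 => //; exact: ltW.
have q0 : 0 <= q by apply: addr_ge0 => //; apply: mulr_ge0 => //; apply: divr_ge0.
have qd : q * (Lp + M2 + 1) <= eta1.
  rewrite -d3E /D mulrA; apply: ler_wpM2r; first by apply: addr_ge0 => //; apply: addr_ge0.
  by have := ler_wpM2l K4 rd3; rewrite /q; lra.
have ql : Lp * q <= eta1 by apply: le_trans qd; rewrite mulrC ler_wpM2l//; lra.
have qt : M2 * q <= eta1 by apply: le_trans qd; rewrite mulrC ler_wpM2l//; lra.
have m2e : M2 * eta2 <= eta1 by rewrite -e2E mulrC ler_wpM2l ?(ltW e2)//; lra.
have tt : M2 * average s' tau <= eta1 + eta1.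
  have : average s' tau <= q + eta2.
    move: matt avt arct; rewrite mul1r -/q -/tau !ler_norml oppr0.
    by move=> /andP[? ?] /andP[? ?] /andP[? ?]; lra.
  by move/(ler_wpM2l M20); lra.
have -> : eta = 6 * eta1 by rewrite /eta1; field.
move: fl (le_trans matl ql) avl arcl; rewrite -/l !ler_norml.
by move=> /andP[? ?] /andP[? ?] /andP[? ?] /andP[? ?]; apply/andP; split; lra.
Qed.

End Transfer.

(** * Integrals against the empirical spectral measure *)

Section Empirical.
Context {R : realType} (N : nat).
Implicit Types (A : 'M[R]_N) (f g : R -> R).

Let ge0_integral_empirical A g : measurable_fun setT g -> (forall x, 0 <= g x) ->
  (\int[empirical_measure A]_x (g x)%:E =
   (N%:R^-1 * \sum_(k < N) g (eigenvalues A)`_k)%:E)%E.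
Proof.
move=> mg g0; have mEg : measurable_fun setT (EFin \o g) by apply/measurable_EFinP.
rewrite /empirical_measure ge0_integral_mscale//; last by move=> x _; rewrite lee_fin.
rewrite ge0_integral_measure_sum//; last by move=> x _; rewrite lee_fin.
rewrite EFinM -sumEFin; congr (_ * _)%E; apply: eq_bigr => k _.
by rewrite integral_dirac// diracT mul1e.
Qed.

Lemma Rintegral_empirical A f : A^T = A -> continuous f ->
  \int[empirical_measure A]_x f x = average (eigenvalues A) f.
Proof.
move=> symA cf; have mf : measurable_fun setT f by exact: continuous_measurable_fun.
have [szA _ _] := eigenvaluesP symA.
rewrite /Rintegral integralE.
rewrite (_ : (fun x => (f x)%:E)^\+%E = fun x => (Num.max (f x) 0)%:E); last first.
  by apply/funext => x; rewrite funeposE EFin_max.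
rewrite (_ : (fun x => (f x)%:E)^\-%E = fun x => (Num.max (- f x) 0)%:E); last first.
  by apply/funext => x; rewrite funenegE EFin_max EFinN.
have p0 g x : 0 <= Num.max (g x) 0 :> R by rewrite le_max lexx orbT.
have mp g : measurable_fun setT g -> measurable_fun setT (fun x : R => Num.max (g x : R) 0).
  by move=> mg; exact: measurable_maxr.
rewrite (ge0_integral_empirical A (mp _ mf) (p0 f)).
rewrite (ge0_integral_empirical A (mp _ (measurable_funN mf)) (p0 (fun x => - f x))).
rewrite -EFinB /= /average szA -mulrBr -sumrB (big_nth 0) szA big_mkord.
congr (_ * _); apply: eq_bigr => i _.
by rewrite !maxEle; do !case: ifPn; rewrite -?ltNge => *; lra.
Qed.

Lemma average_eigenvalues_poly A (p : {poly R}) : A^T = A ->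
  average (eigenvalues A) (fun x => p.[x]) =
  N%:R^-1 * \sum_(k < size p) p`_k * \tr (A ^+ k).
Proof.
move=> symA; have [szA _ _] := eigenvaluesP symA; rewrite /average szA; congr (_ * _).
under eq_bigr do rewrite horner_coef.
rewrite exchange_big /=; apply: eq_bigr => k _.
by rewrite -mulr_sumr trace_pow_eigenvalues.
Qed.

End Empirical.

Section MeasurableSpectrum.
Context d (T : measurableType d) {R : realType} (N : nat).
Variable A : T -> 'M[R]_N.
Hypothesis symA : forall t, (A t)^T = A t.
Hypothesis mA : forall i j, measurable_fun setT (fun t => A t i j).

Let measurable_pow k i j : measurable_fun setT (fun t => (A t ^+ k) i j).
Proof.
elim: k i j => [|k IH] i j.
  by rewrite (_ : (fun t => _) = cst ((1 : 'M[R]_N) i j)).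
rewrite (_ : (fun t => _) = fun t => \sum_l A t i l * (A t ^+ k) l j); last first.
  by apply/funext => t; rewrite exprS mxE.
by apply: measurable_sum => l; apply: measurable_funM.
Qed.

(** The spectrum depends measurably on the matrix: continuous functions are
    limits of polynomials, whose averages are combinations of traces. *)
Lemma measurable_average f : continuous f ->
  measurable_fun setT (fun t => average (eigenvalues (A t)) f).
Proof.
move=> cf; have approx n : exists p : {poly R}, forall x, `|x| <= n.+1%:R ->
    `|f x - p.[x]| <= n.+1%:R^-1.
  by apply: weierstrass => //; rewrite ?invr_gt0 ltr0n.
have [p fp] := choice approx.
apply: (measurable_fun_cvg (h := fun n t => average (eigenvalues (A t)) (fun x => (p n).[x]))).
  move=> n; rewrite (_ : (fun t => _) =
    fun t => N%:R^-1 * \sum_(k < size (p n)) (p n)`_k * \tr (A t ^+ k)); last first.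
    by apply/funext => t; exact: average_eigenvalues_poly.
  apply: measurable_funM => //; apply: measurable_sum => k.
  apply: measurable_funM => //; apply: measurable_sum => i; exact: measurable_pow.
move=> t _; rewrite /average; apply: cvgM; first exact: cvg_cst.
elim: (eigenvalues (A t)) => [|x s IH].
  rewrite big_nil (_ : (fun n => _) = cst 0); first exact: cvg_cst.
  by apply/funext => n; rewrite big_nil.
rewrite big_cons (_ : (fun n => _) =
  fun n => (p n).[x] + \sum_(y <- s) (p n).[y]); last first.
  by apply/funext => n; rewrite big_cons.
apply: cvgD IH; apply/cvgrPdist_le => eps e0.
near=> n; rewrite (le_trans (fp n x _))//.
  near: n; exists (Num.truncn `|x|).+1 => // n /= xn.
  by rewrite (le_trans (ltW (truncnS_gt _)))// ler_nat (leq_trans xn).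
near: n; exists (Num.truncn eps^-1).+1 => // n /= en.
rewrite -[leRHS]invrK lef_pV2 ?posrE ?invr_gt0 ?ltr0n//.
by rewrite (le_trans (ltW (truncnS_gt _)))// ler_nat (leq_trans en).
Unshelve. all: by end_near.
Qed.

End MeasurableSpectrum.

(** * Combinatorics of the bands *)

Section Counting.

Lemma sum_interval N a n : (\sum_(j < N) (a <= j < a + n) = minn N (a + n) - minn N a)%N.
Proof.
elim: N => [|N IH]; first by rewrite big_ord0 !min0n.
by rewrite big_ord_recr /= IH; case: leqP => ?; case: ltnP => ? /=; lia.
Qed.

Lemma sum_interval_le N a n : (\sum_(j < N) (a <= j < a + n) <= n)%N.
Proof. by rewrite sum_interval; lia. Qed.

Lemma sum_nat_le (T : finType) (F G : T -> nat) : (forall x, F x <= G x)%N ->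
  (\sum_x F x <= \sum_x G x)%N.
Proof. by move=> FG; apply: leq_sum. Qed.

Variable N : nat.
Implicit Types (i j : 'I_N) (c n b : nat).

Definition strict_dist i j := `|i - j|%N.
Definition periodic_dist i j := per_norm N `|i - j|%N.

Lemma strict_distC i j : strict_dist i j = strict_dist j i.
Proof. by rewrite /strict_dist distnC. Qed.

Lemma periodic_distC i j : periodic_dist i j = periodic_dist j i.
Proof. by rewrite /periodic_dist distnC. Qed.

Lemma strict_dist_lip i j i' j' :
  (strict_dist i j <= strict_dist i' j' + (`|i - i'| + `|j - j'|))%N.
Proof. rewrite /strict_dist; lia. Qed.

Lemma periodic_dist_lip i j i' j' :
  (periodic_dist i j <= periodic_dist i' j' + (`|i - i'| + `|j - j'|))%N.
Proof.
rewrite /periodic_dist /per_norm; move: (ltn_ord i) (ltn_ord j) (ltn_ord i') (ltn_ord j').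
lia.
Qed.

Lemma strict_dist_count i c n : (\sum_j (c <= strict_dist i j < c + n) <= 4 * n)%N.
Proof.
have H : (\sum_(j < N) (c <= strict_dist i j < c + n) <=
  \sum_(j < N) (i + c <= j < i + c + n) + \sum_(j < N) (i.+1 - (c + n) <= j < i.+1 - (c + n) + n))%N.
  rewrite -big_split; apply: sum_nat_le => j /=; rewrite /strict_dist.
  by do !case: andP => /=; lia.
rewrite (leq_trans H)// (leq_trans (leq_add (sum_interval_le _ _ _) (sum_interval_le _ _ _)))//.
lia.
Qed.

Lemma periodic_dist_count i c n : (\sum_j (c <= periodic_dist i j < c + n) <= 4 * n)%N.
Proof.
have H : (\sum_(j < N) (c <= periodic_dist i j < c + n) <=
  \sum_(j < N) (i + c <= j < i + c + n) + \sum_(j < N) (i.+1 - (c + n) <= j < i.+1 - (c + n) + n)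
  + (\sum_(j < N) (i + N.+1 - (c + n) <= j < i + N.+1 - (c + n) + n) +
     \sum_(j < N) (i + c - N <= j < i + c - N + n)))%N.
  rewrite -!big_split; apply: sum_nat_le => j /=; rewrite /periodic_dist /per_norm.
  move: (ltn_ord i) (ltn_ord j).
  by do !case: andP => /=; lia.
rewrite (leq_trans H)//.
have L := sum_interval_le N.
rewrite (leq_trans (leq_add (leq_add (L _ n) (L _ n)) (leq_add (L _ n) (L _ n))))//.
lia.
Qed.

Lemma strict_degree i b :
  (\sum_j (strict_dist i j <= b) = minn N (i + b).+1 - (i - b))%N.
Proof.
transitivity (\sum_(j < N) (i - b <= j < (i - b) + ((i + b).+1 - (i - b))))%N.
  by apply: eq_bigr => j _; congr nat_of_bool; rewrite /strict_dist; lia.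
rewrite sum_interval; move: (ltn_ord i); lia.
Qed.

Lemma strict_degree_le i b : (\sum_j (strict_dist i j <= b) <= minn N (2 * b + 1))%N.
Proof. rewrite strict_degree; move: (ltn_ord i); lia. Qed.

Lemma periodic_degree i b : (b < N)%N ->
  (\sum_j (periodic_dist i j <= b) = minn N (2 * b + 1))%N.
Proof.
move=> bN; have iN := ltn_ord i; have [full|part] := leqP N (2 * b + 1).
  rewrite (eq_bigr (fun=> 1%N)) ?sum1_card ?card_ord//; last first.
    move=> j _; rewrite /periodic_dist /per_norm; move: (ltn_ord j).
    by case: leqP => /=; lia.
transitivity (\sum_(j < N) (i - b <= j < (i - b) + ((i + b).+1 - (i - b))) +
  (\sum_(j < N) (i + N - b <= j < i + N - b + b) + \sum_(j < N) (0 <= j < 0 + (i + b).+1 - N)))%N.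
  rewrite -!big_split; apply: eq_bigr => j _ /=; have := ltn_ord j.
  rewrite /periodic_dist /per_norm add0n.
  by do !case: andP => /=; case: leqP => /=; lia.
rewrite !sum_interval; lia.
Qed.


Lemma periodic_total_defect b : (b < N)%N ->
  total_defect (fun i j : 'I_N => periodic_dist i j <= b)%N (minn N (2 * b + 1)) = 0%N.
Proof. by move=> bN; apply: big1 => i _; rewrite /defect periodic_degree// subnn. Qed.

Lemma strict_total_defect_boundary b :
  (total_defect (fun i j : 'I_N => strict_dist i j <= b)%N (minn N (2 * b + 1)) <=
   2 * b * minn N (2 * b + 1))%N.
Proof.
set w := minn _ _.
have H : (total_defect (fun i j : 'I_N => strict_dist i j <= b)%N w <=
  \sum_(i < N) ((0 <= i < 0 + b) + (N - b <= i < N - b + b)) * w)%N.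
  apply: leq_sum => i _; rewrite /defect strict_degree add0n.
  have [bulk|edge] := boolP (b <= i < N - b)%N.
    rewrite (_ : (w - _)%N = 0%N)//; rewrite /w; move: bulk; lia.
  rewrite (leq_trans (leq_subr _ _))// leq_pmull//; move: edge (ltn_ord i); lia.
rewrite (leq_trans H)// -big_distrl /= leq_mul2r; apply/orP; right.
rewrite big_split /= mul2n -addnn.
exact: leq_add (sum_interval_le N 0 b) (sum_interval_le N (N - b) b).
Qed.

Lemma strict_total_defect_corner b : (b < N)%N ->
  (total_defect (fun i j : 'I_N => strict_dist i j <= b)%N (minn N (2 * b + 1)) <=
   N * (N - b))%N.
Proof.
move=> bN; rewrite (_ : (N * (N - b) = \sum_(i < N) (N - b))%N); last first.
  by rewrite sum_nat_const card_ord.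
apply: leq_sum => i _.
rewrite /defect strict_degree; move: (ltn_ord i); lia.
Qed.

End Counting.

(** * Constant matrices on a band *)

Section ConstantBand.
Context {R : realType} (N : nat) (D : 'I_N -> 'I_N -> nat) (b L : nat) (a : R).
Hypothesis DC : forall i j, D i j = D j i.
Hypothesis D_lip : forall i j i' j',
  (D i j <= D i' j' + (`|i - i'| + `|j - j'|))%N.
Hypothesis D_count : forall i c n, (\sum_j (c <= D i j < c + n) <= 4 * n)%N.
Hypothesis L0 : (0 < L)%N.

Definition constant_band : 'M[R]_N := \matrix_(i, j) if (D i j <= b)%N then a else 0.

Let rep (i : 'I_N) : 'I_N := insubd i (L * (i %/ L))%N.

Let repE i : rep i = (L * (i %/ L))%N :> nat.
Proof.
rewrite /rep val_insubd; case: ifP => // /negbT; rewrite -leqNgt => h.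
have := leq_trunc_div i L; rewrite mulnC; move: h (ltn_ord i).
by move: (L * _)%N => q; lia.
Qed.

Let rep_dist (i : 'I_N) : (`|i - rep i| < L)%N.
Proof. rewrite repE {1}(divn_eq i L); have := ltn_pmod i L0; rewrite mulnC; lia. Qed.

Let coarse i j : R := if (D (rep i) (rep j) <= b)%N then a else 0.

Let fine_coarse : constant_band = \matrix_(i, j) coarse i j +
  (constant_band - \matrix_(i, j) coarse i j).
Proof. by rewrite addrC subrK. Qed.

Let Q : 'M[R]_(N, (N %/ L).+1) := \matrix_(i, k) ((i %/ L)%N == k)%:R.
Let T : 'M[R]_((N %/ L).+1, N) := \matrix_(k, j)
  if (D (insubd j (L * k)%N) (rep j) <= b)%N then a else 0.

Let coarse_rank : \matrix_(i, j) coarse i j = Q *m T.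
Proof.
apply/matrixP => i j; rewrite !mxE.
have iL : (i %/ L < (N %/ L).+1)%N by rewrite ltnS leq_div2r// ltnW.
rewrite (bigD1 (Ordinal iL))//= !mxE eqxx mul1r big1 ?addr0; last first.
  move=> k; rewrite mxE -val_eqE /= eq_sym => /negbTE ->; exact: mul0r.
rewrite /coarse (_ : insubd j _ = rep i)//; apply: val_inj.
by rewrite [RHS]repE val_insubd -(repE i) ltn_ord.
Qed.

Let error_rows i : \sum_j `|(constant_band - \matrix_(i, j) coarse i j) i j| <=
  (16 * L)%:R * `|a|.
Proof.
pose c := (b.+1 - 2 * L)%N.
apply: (@le_trans _ _ (\sum_j (c <= D i j < c + 4 * L)%N%:R * `|a|)).
  apply: ler_sum => j _; rewrite !mxE /coarse.
  have := D_lip i j (rep i) (rep j); have := D_lip (rep i) (rep j) i j.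
  have := rep_dist i; have := rep_dist j; rewrite ![`|rep _ - _|%N]distnC.
  move: (D i j) (D _ _) (`|i - _|)%N (`|j - _|)%N => x y e1 e2 ? ? ? ?.
  have [xb|bx] := leqP x b; have [yb|yb] := leqP y b; rewrite ?subrr ?normr0 ?mulr_ge0//.
    rewrite subr0 (_ : (_ <= _ < _)%N = true) ?mul1r// /c; lia.
  rewrite sub0r normrN (_ : (_ <= _ < _)%N = true) ?mul1r// /c; lia.
rewrite -mulr_suml ler_wpM2r// -natr_sum ler_nat (leq_trans (D_count _ _ _))//; lia.
Qed.

(** A band matrix with constant entries is nearly constant on square blocks of
    side [L]: blockwise rounding leaves a matrix of small rank, and an error
    that is supported near the rim of the band. *)
Lemma constant_band_shift (A : 'M[R]_N) : A^T = A ->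
  spectral_shift (N %/ L).+1 ((16 * L)%:R * `|a|) (eigenvalues A)
    (eigenvalues (A + constant_band)) /\
  spectral_shift (N %/ L).+1 ((16 * L)%:R * `|a|) (eigenvalues (A + constant_band))
    (eigenvalues A).
Proof.
move=> symA.
have symB : constant_band^T = constant_band.
  by apply/matrixP => i j; rewrite !mxE DC.
have symC : (\matrix_(i, j) coarse i j)^T = \matrix_(i, j) coarse i j.
  by apply/matrixP => i j; rewrite !mxE /coarse DC.
have symE : (constant_band - \matrix_(i, j) coarse i j)^T =
    constant_band - \matrix_(i, j) coarse i j.
  by rewrite linearB /= symB symC.
have symAB : (A + constant_band)^T = A + constant_band by rewrite linearD /= symA symB.
split=> x.
  apply: (eigenvalue_count_perturb (Q := Q) (T := T) x symA symAB symE _ error_rows).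
  by rewrite -coarse_rank -addrA -fine_coarse.
apply: (@eigenvalue_count_perturb _ _ _ _ _ (- (constant_band - \matrix_(i, j) coarse i j))
  Q (- T) _ x symAB symA).
- by rewrite linearN /= symE.
- by rewrite mulmxN -coarse_rank -addrA -opprD -fine_coarse addrK.
- move=> i; apply: le_trans (error_rows i); apply: ler_sum => j _.
  by rewrite [X in `|X|]mxE normrN.
Qed.

End ConstantBand.

(** * Convergence of band ensembles *)

Section BandLimit.
Context d (Omega : measurableType d) (R : realType) (P : probability Omega R).
Context (X : forall N : nat, 'I_N -> 'I_N -> {RV P >-> R}).
Context (rho : probability R R) (m v : R) (b : nat -> nat).
Hypothesis hX : wigner_ensemble X rho m v.
Hypothesis v0 : 0 <= v.
Hypothesis hb : forall N : nat, (1 <= N)%N -> (b N <= N - 1)%N.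
Hypothesis b_oo : b N @[N --> \oo] --> \oo.
Variable D : forall N, 'I_N -> 'I_N -> nat.
Hypothesis DC : forall N (i j : 'I_N), D i j = D j i.
Hypothesis D_lip : forall N (i j i' j' : 'I_N),
  (D i j <= D i' j' + (`|i - i'| + `|j - j'|))%N.
Hypothesis D_count : forall N (i : 'I_N) c n,
  (\sum_j (c <= D i j < c + n) <= 4 * n)%N.
Hypothesis D_degree : forall N (i : 'I_N), (b N < N)%N ->
  (\sum_j (D i j <= b N) <= bandwidth b N)%N.

Let B N : rel 'I_N := fun i j => (D i j <= b N)%N.

Hypothesis D_defect :
  ((total_defect (@B N) (bandwidth b N))%:R / (N * bandwidth b N)%:R : R)
  @[N --> \oo] --> 0.

Let s N : R := Num.sqrt (bandwidth b N)%:R.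

Definition scaled_band N (t : Omega) : 'M[R]_N :=
  (s N)^-1 *: band_matrix (@B N) (fun i j => X i j t).

Let mu := central_moment rho m.

Definition moment_event n (delta : R) N : set Omega :=
  [set t | (delta <= `|trace_moment (@X N) m (@B N) (s N) n.+1 t - ballot v 0 n.+1|)%R].

Let symB N : symmetric (@B N). Proof. by move=> i j; rewrite /B DC. Qed.

Let band_lt N : (0 < N)%N -> (b N < N)%N.
Proof. move=> N0; have := hb N0; lia. Qed.

Let width_gt N : (0 < N)%N -> (b N < bandwidth b N)%N.
Proof. move=> N0; have := hb N0; rewrite /bandwidth; lia. Qed.

Let s_sqr N : s N ^+ 2 = (bandwidth b N)%:R.
Proof. by rewrite sqr_sqrtr. Qed.

Let s_ge1 N : (0 < N)%N -> 1 <= s N.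
Proof.
move=> N0; rewrite -sqrtr1 ler_wsqrtr// ler1n.
by rewrite (leq_ltn_trans _ (width_gt N0)).
Qed.

Let near_pos : \forall N \near \oo, (0 < N)%N.
Proof. by exists 1%N. Qed.

Let near_large (C : R) : \forall N \near \oo, C <= N%:R.
Proof.
exists (Num.truncn C).+1 => // N /= CN.
by rewrite (le_trans (ltW (truncnS_gt _)))// ler_nat.
Qed.

Let near_width (C : R) : \forall N \near \oo, C <= s N.
Proof.
have /cvgnyPge /(_ (Num.truncn (C ^+ 2)).+1) bC := b_oo.
near=> N.
rewrite (le_trans (ler_norm C))// -sqrtr_sqr ler_wsqrtr//.
rewrite (le_trans (ltW (truncnS_gt _)))// ler_nat.
rewrite (@leq_trans (b N))//; first by near: N; exact: bC.
by rewrite ltnW// width_gt//; near: N.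
Unshelve. all: by end_near.
Qed.

Let near_rec_error (eps : R) : 0 < eps ->
  \forall N \near \oo, rec_error (@B N) (bandwidth b N) (s N) / N%:R <= eps.
Proof.
move=> e0; have e2 : 0 < eps / 2 by rewrite divr_gt0.
have /cvgrPdist_le /(_ _ e2) := D_defect => defect_small.
near=> N.
have N0 : (0 < N)%N by near: N.
have N0' : N%:R != 0 :> R by rewrite pnatr_eq0 -lt0n.
have w0 : (bandwidth b N)%:R != 0 :> R.
  by rewrite pnatr_eq0 -lt0n (leq_ltn_trans _ (width_gt N0)).
have s0 : 0 < s N by rewrite (lt_le_trans ltr01 (s_ge1 N0)).
have -> : rec_error (@B N) (bandwidth b N) (s N) / N%:R =
   (s N)^-1 + (total_defect (@B N) (bandwidth b N))%:R / (N * bandwidth b N)%:R.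
  rewrite /rec_error s_sqr natrM; move: (total_defect _ _)%:R (lt0r_neq0 s0) => T ?.
  by field; rewrite N0' w0.
rewrite [leRHS](splitr eps) lerD//.
  rewrite -[leRHS]invrK lef_pV2 ?posrE ?invr_gt0//.
  by near: N; exact: near_width.
rewrite (le_trans (ler_norm _))// -normrN -sub0r.
by near: N.
Unshelve. all: by end_near.
Qed.

Let event_const n (delta : R) : R := 4 / delta ^+ 2 * pair_bound mu n.+1.

Let event_const_ge0 n delta : 0 <= event_const n delta.
Proof. by rewrite mulr_ge0 ?pair_bound_ge0// divr_ge0// sqr_ge0. Qed.

Let rhoE := wigner_distribution hX.
Let rho_int := wigner_moments hX.
Let indX N := @wigner_independent _ _ _ _ _ _ _ _ hX N.

Let measurable_event n delta N : measurable (moment_event n delta N).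
Proof.
rewrite /moment_event -[X in measurable X]setTI.
apply: (@measurable_fun_le _ _ _ setT (cst delta)) => //.
apply: measurableT_comp => //; apply: measurable_funB => //.
exact: (@measurable_trace_moment _ _ _ P N (@X N) rho m (wigner_symmetric hX (N := N))
  (@indX N) (rhoE (N := N)) rho_int (@B N) (s N) n).
Qed.

Let near_event n (delta : R) : 0 < delta -> \forall N \near \oo,
  (P (moment_event n delta N) <= (event_const n delta / (N * bandwidth b N)%:R)%:E)%E.
Proof.
move=> delta0; set W := walk_const mu 0 n.+1.
have W1 : 0 < `|W| + 1 by rewrite ltr_wpDl.
have e0 : 0 < delta / 2 / (`|W| + 1) by rewrite !divr_gt0.
have small := near_rec_error e0.
near=> N.
have N0 : (0 < N)%N by near: N.
have w0 : (0 < bandwidth b N)%N by rewrite (leq_ltn_trans _ (width_gt N0)).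
apply: (trace_moment_deviation (wigner_symmetric hX (N := N))
  (@indX N) (rhoE (N := N)) rho_int (wigner_mean hX)
  (wigner_variance hX) (@symB N) w0 N0 _ (s_ge1 N0) (s_sqr N) delta0).
  by move=> x; exact: D_degree (band_lt N0).
have sm : rec_error (@B N) (bandwidth b N) (s N) / N%:R <= delta / 2 / (`|W| + 1).
  by near: N.
have r0 : 0 <= rec_error (@B N) (bandwidth b N) (s N) / N%:R.
  rewrite divr_ge0// addr_ge0// divr_ge0// ?sqr_ge0//.
  by rewrite (le_trans ler01 (s_ge1 N0)).
rewrite -/mu -/W (@le_trans _ _ ((`|W| + 1) * (rec_error (@B N) (bandwidth b N) (s N) / N%:R)))//.
  by rewrite ler_wpM2r// (le_trans (ler_norm W))// lerDl.
by rewrite mulrC -ler_pdivlMr.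
Unshelve. all: by end_near.
Qed.

Let scaled_band_sym N t : (scaled_band N t)^T = scaled_band N t.
Proof.
apply/matrixP => i j; rewrite !mxE symB; case: ifP => // _.
by rewrite (wigner_symmetric hX).
Qed.

Let centered_band_sym N t : (centered_band (@X N) m (@B N) (s N) t)^T =
  centered_band (@X N) m (@B N) (s N) t.
Proof.
apply/matrixP => i j; rewrite !mxE symB; case: ifP => // _.
by rewrite /centered (wigner_symmetric hX).
Qed.

Let scaled_band_split N t : scaled_band N t =
  centered_band (@X N) m (@B N) (s N) t + constant_band (@D N) (b N) (m / s N).
Proof.
apply/matrixP => i j; rewrite !mxE /B /centered; case: ifP => _; last by rewrite mulr0 addr0.
ring.
Qed.

(** Outside of finitely many deviation events, the moments of the centered matrix
    are close to those of the semicircle law, and the constant part has a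
    negligible effect for bands that are wide compared with the blocks. *)
Lemma near_average f (M eps : R) : continuous f -> (forall x, `|f x| <= M) -> 0 < eps ->
  exists k : nat, exists2 delta, 0 < delta &
  \forall N \near \oo, forall t, (forall n, (n < k)%N -> ~ moment_event n delta N t) ->
  `|average (eigenvalues (scaled_band N t)) f - arc_integral v f| <= eps.
Proof.
move=> cf fM e0; have [k [delta delta0 transfer]] := average_transfer v0 cf fM e0.
exists k; exists delta => //.
(* blocks so large that at most [delta * N / 2] of them fit in *)
pose L := (Num.truncn (2 / delta)).+1.
have L_large : L%:R^-1 <= delta / 2.
  rewrite -[leRHS]invrK lef_pV2 ?posrE ?invr_gt0 ?divr_gt0 ?ltr0n//.
  by rewrite invf_div ltW// truncnS_gt.
near=> N => t good.
have N0 : (0 < N)%N by near: N.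
have N0' : 0 < N%:R :> R by rewrite ltr0n.
have s0 : 0 < s N by rewrite (lt_le_trans ltr01 (s_ge1 N0)).
have [sz1 sort1 _] := eigenvaluesP (centered_band_sym N t).
have [sz2 sort2 _] := eigenvaluesP (scaled_band_sym N t).
have [sh1 sh2] := constant_band_shift (b N) (m / s N) (@DC N) (@D_lip N) (@D_count N)
  (ltn0Sn _ : (0 < L)%N) (centered_band_sym N t).
rewrite -scaled_band_split in sh1 sh2.
apply: (transfer _ _ _ _ _ _ sort1 sort2 sh1 sh2); rewrite ?sz1 ?sz2//.
- rewrite -natr1 mulrDl [leRHS](splitr delta) lerD//.
    apply: le_trans L_large; rewrite ler_pdivrMr// mulrC ler_pdivlMr ?ltr0n//.
    by rewrite -natrM ler_nat leq_trunc_div.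
  rewrite mul1r -[leRHS]invrK lef_pV2 ?posrE ?invr_gt0 ?divr_gt0//.
  by near: N; exact: near_large.
- apply/andP; split; first by rewrite mulr_ge0.
  rewrite normrM normfV (gtr0_norm s0) mulrA ler_pdivrMr// [leRHS]mulrC -ler_pdivrMr//.
  by near: N; exact: near_width.
- move=> [_|n nk].
    have -> : (fun x : R => x ^+ 0) = fun=> 1 by apply/funext => x; rewrite expr0.
    by rewrite average_cst ?sz1// /ballot eqxx subrr normr0 ltW.
  have := good n (ltnW nk); rewrite /moment_event /= => /negP; rewrite -ltNge => /ltW.
  rewrite /trace_moment trace_pow_eigenvalues; last exact: centered_band_sym.
  by rewrite /average sz1.
Unshelve. all: by end_near.
Qed.

Let bounded_bound (f : R -> R) : bounded_fun f -> exists M, forall x, `|f x| <= M.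
Proof. by move=> [M [_ fM]]; exists (M + 1) => x; apply: fM => //; rewrite ltrDl. Qed.

Let integral_band f N t : continuous f ->
  \int[empirical_measure (scaled_band N t)]_x f x - \int[semicircle_law v]_x f x =
  average (eigenvalues (scaled_band N t)) f - arc_integral v f.
Proof. by move=> cf; rewrite Rintegral_empirical// Rintegral_semicircle. Qed.

Theorem scaled_band_probability : weak_cvg_in_probability P
  (fun N t => empirical_measure (scaled_band N t)) (fun=> semicircle_law v).
Proof.
move=> f cf /bounded_bound[M fM] eps e0.
have [k [delta delta0 close]] := near_average cf fM e0.
pose C := \sum_(n < k) event_const n delta.
have C0 : 0 <= C by apply: sumr_ge0 => n _.
apply: (@squeeze_cvge _ _ _ _ (cst 0%E) _ (fun N => (C / N%:R)%:E)).
- have events : \forall N \near \oo, forall n : 'I_k,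
      (P (moment_event n delta N) <= (event_const n delta / (N * bandwidth b N)%:R)%:E)%E.
    by apply: filter_forall => n; exact: near_event.
  near=> N; rewrite measure_ge0 /=.
  have N0 : (0 < N)%N by near: N.
  under eq_set do rewrite integral_band//.
  apply: (@le_trans _ _ (P (\big[setU/set0]_(n < k) moment_event n delta N))).
    apply: le_measure; rewrite ?inE.
    + rewrite (_ : [set t | _] = [set: Omega] `&`
          (fun t => `|average (eigenvalues (scaled_band N t)) f - arc_integral v f|)
            @^-1` `]eps, +oo[%classic); last first.
        by rewrite setTI; apply/seteqP; split => t /=; rewrite in_itv /= andbT.
      suff mf : measurable_fun setT
          (fun t => `|average (eigenvalues (scaled_band N t)) f - arc_integral v f|).
        by apply: mf => //; exact: measurable_itv.
      apply: measurableT_comp => //; apply: measurable_funB => //.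
      apply: measurable_average => // i j.
      rewrite (_ : (fun t => _) = fun t => (s N)^-1 * (if B i j then X i j t else 0)).
        by case: (B i j) => //; apply: measurable_funM.
      by apply/funext => t; rewrite !mxE.
    + by apply: bigsetU_measurable => n _; exact: measurable_event.
    + rewrite -(bigcup_mkord k (fun n => moment_event n delta N)) => t /= far; apply: contrapT => good.
      suff : `|average (eigenvalues (scaled_band N t)) f - arc_integral v f| <= eps.
        by rewrite leNgt far.
      move: t good {far}; near: N; apply: filterS close => N closeN t good.
      by apply: closeN => n nk bad; apply: good; exists n.
  apply: (le_trans (@Boole_inequality _ _ _ P (fun n => moment_event n delta N) k _)); first by move=> n _; exact: measurable_event.
  have N0' : 0 < N%:R :> R by rewrite ltr0n.
  have w1 : (1 <= bandwidth b N)%N by rewrite (leq_ltn_trans _ (width_gt N0)).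
  apply: (@le_trans _ _ (\sum_(n < k) (event_const n delta / N%:R)%:E)%E).
    apply: lee_sum => n _; apply: (@le_trans _ _ (event_const n delta / (N * bandwidth b N)%:R)%:E).
      by move: n; near: N.
    rewrite lee_fin ler_wpM2l// lef_pV2 ?posrE ?ltr0n ?muln_gt0 ?N0//.
    by rewrite ler_nat leq_pmulr.
  by rewrite sumEFin lee_fin /C mulr_suml.
- exact: cvg_cst.
- apply: cvg_EFin; first by near=> N.
  apply/cvgrPdist_le => eps' e'0; near=> N.
  have N0 : (0 < N)%N by near: N.
  rewrite sub0r normrN ger0_norm ?divr_ge0// ler_pdivrMr ?ltr0n// mulrC -ler_pdivrMr//.
  by near: N; exact: near_large.
Unshelve. all: by end_near.
Qed.

Hypothesis summable :
  (\sum_(1 <= N <oo | (1 <= b N)%N) (((N * b N)%:R)^-1 : R)%:E < +oo)%E.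

(** The first Borel-Cantelli lemma, after discarding the finitely many indices at
    which the estimate of the probabilities may fail. *)
Let event_rare n (delta : R) : 0 < delta ->
  P (lim_sup_set (moment_event n delta)) = 0%E.
Proof.
move=> delta0.
have /cvgnyPge /(_ 1%N) b1 := b_oo.
have [N0 _ N0P] : \forall N \near \oo, (0 < N)%N /\ (1 <= b N)%N /\
    (P (moment_event n delta N) <= (event_const n delta / (N * bandwidth b N)%:R)%:E)%E.
  have ev := near_event n delta0.
  by near=> N; split; [|split]; near: N.
pose F N := if (N0 <= N)%N then moment_event n delta N else set0.
have mF N : measurable (F N) by rewrite /F; case: ifP => // _; exact: measurable_event.
have FE : lim_sup_set (moment_event n delta) = lim_sup_set F.
  apply/seteqP; split => t tF k _.
    have [j /= kj tj] := tF (maxn k N0) I; move: kj; rewrite geq_max => /andP[kj Nj].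
    by exists j => //; rewrite /F Nj.
  by have [j /= kj] := tF k I; rewrite /F; case: ifP => // _ tj; exists j.
rewrite FE; apply: lim_sup_set_cvg0 => //.
pose u N : \bar R := if (1 <= b N)%N && (1 <= N)%N then (((N * b N)%:R)^-1 : R)%:E else 0%E.
have u0 N : (0 <= u N)%E by rewrite /u; case: ifP => // _; rewrite lee_fin invr_ge0.
apply: (@le_lt_trans _ _ (\sum_(0 <= N <oo) ((event_const n delta)%:E * u N))%E).
  apply: lee_nneseries => [N _ _|N _]; first exact: measure_ge0.
  rewrite /F; case: ifP => [/N0P[N1 [bN1 /le_trans]]|_]; last first.
    by rewrite measure0 mule_ge0// lee_fin.
  apply; rewrite /u bN1 N1 -EFinM lee_fin ler_wpM2l// lef_pV2 ?posrE ?ltr0n ?muln_gt0 ?N1//=.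
  - by rewrite ler_nat leq_mul2l ltnW ?orbT// width_gt.
  - by rewrite (leq_ltn_trans _ (width_gt N1)).
rewrite nneseriesZl//; move: summable; rewrite eseries_cond eseries_mkcond -/u.
set S := (\sum_(0 <= N <oo) u N)%E => Soo.
have S0 : (0 <= S)%E by exact: nneseries_ge0.
have -> : S = (fine S)%:E by rewrite fineK// ge0_fin_numE.
by rewrite -EFinM ltry.
Unshelve. all: by end_near.
Qed.

(** The exceptional set must not depend on the test function: it is enough to
    exclude the deviations of each moment by the inverse of each integer. *)
Theorem scaled_band_almost_surely : weak_cvg_almost_surely P
  (fun N t => empirical_measure (scaled_band N t)) (fun=> semicircle_law v).
Proof.
pose Z := \bigcup_n \bigcup_q lim_sup_set (moment_event n (q.+1%:R^-1)).
have mL n q : measurable (lim_sup_set (moment_event n (q.+1%:R^-1))).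
  apply: bigcap_measurable => [|k _]; first by exists 0%N.
  by apply: bigcup_measurable => j _; exact: measurable_event.
have mZ : measurable Z.
  by apply: bigcup_measurable => n _; apply: bigcup_measurable => q _; exact: mL.
have nZ : P.-negligible Z.
  apply: negligible_bigcup => n; apply: negligible_bigcup => q.
  apply/negligibleP; first exact: mL.
  by apply: event_rare; rewrite invr_gt0 ltr0n.
exists (~` Z); split; first exact: measurableC.
  have PZ : P Z = 0%E by apply/negligibleP.
  by apply: (etrans (probability_setC _ mZ)); rewrite PZ sube0.
move=> t tZ f cf /bounded_bound[M fM].
apply/cvgrPdist_le => eps e0.
have [k [delta delta0 close]] := near_average cf fM e0.
pose q := Num.truncn delta^-1.
have qd : q.+1%:R^-1 <= delta.
  rewrite -[leRHS]invrK lef_pV2 ?posrE ?invr_gt0 ?ltr0n//.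
  by rewrite ltW// truncnS_gt.
have good : \forall N \near \oo, forall n : 'I_k, ~ moment_event n delta N t.
  apply: filter_forall => n; apply: contrapT => bad; apply: tZ; exists n => //; exists q => //.
  move=> j _; apply: contrapT => notin; apply: bad; exists j => // N /= jN ev.
  by apply: notin; exists N => //; rewrite /moment_event /=; exact: le_trans ev.
near=> N; rewrite distrC integral_band//.
have closeN : forall t, (forall n, (n < k)%N -> ~ moment_event n delta N t) ->
  `|average (eigenvalues (scaled_band N t)) f - arc_integral v f| <= eps by near: N.
apply: closeN => n nk.
have goodN : forall n : 'I_k, ~ moment_event n delta N t by near: N.
exact: (goodN (Ordinal nk)).
Unshelve. all: by end_near.
Qed.

End BandLimit.

(** * Periodic and strict bands *)

Section Defects.
Context {R : realType} (b : nat -> nat).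
Hypothesis hb : forall N : nat, (1 <= N)%N -> (b N <= N - 1)%N.

Let near_pos : \forall N \near \oo, (0 < N)%N.
Proof. by exists 1%N. Qed.

Lemma periodic_defect_cvg :
  ((total_defect (fun i j : 'I_N => periodic_dist i j <= b N)%N (bandwidth b N))%:R /
   (N * bandwidth b N)%:R : R) @[N --> \oo] --> 0.
Proof.
apply: cvg_near_cst; near=> N.
have N0 : (0 < N)%N by near: N.
rewrite /bandwidth periodic_total_defect ?mul0r//; have := hb N0; lia.
Unshelve. all: by end_near.
Qed.

Let defect N : R :=
  (total_defect (fun i j : 'I_N => strict_dist i j <= b N)%N (bandwidth b N))%:R /
   (N * bandwidth b N)%:R.

Let defect_ge0 N : 0 <= defect N. Proof. by rewrite divr_ge0. Qed.

(** A vertex of the strict band misses neighbours only within distance [b N] of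
    the ends, which is negligible for narrow bands, and at most [N - b N] of them,
    which is negligible for full bands. *)
Lemma strict_defect_cvg :
  ((b N)%:R / N%:R : R) @[N --> \oo] --> (0 : R) \/
  ((b N)%:R / N%:R : R) @[N --> \oo] --> (1 : R) ->
  ((total_defect (fun i j : 'I_N => strict_dist i j <= b N)%N (bandwidth b N))%:R /
   (N * bandwidth b N)%:R : R) @[N --> \oo] --> 0.
Proof.
have width N : (0 < N)%N -> (0 < bandwidth b N)%N by rewrite /bandwidth; lia.
case=> hbN.
  have up : (2 * ((b N)%:R / N%:R) : R) @[N --> \oo] --> 0.
    by rewrite -(mulr0 2); apply: cvgM => //; exact: cvg_cst.
  apply: (squeeze_cvgr _ (cvg_cst 0) up); near=> N; rewrite defect_ge0 /=.
  have N0 : (0 < N)%N by near: N.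
  have Nw : 0 < (N * bandwidth b N)%:R :> R by rewrite ltr0n muln_gt0 N0 width.
  rewrite ler_pdivrMr// (_ : _ * _ = (2 * b N * bandwidth b N)%:R).
    by rewrite ler_nat strict_total_defect_boundary.
  by rewrite !natrM; field; rewrite pnatr_eq0 -lt0n.
have up : (1 - (b N)%:R / N%:R : R) @[N --> \oo] --> 0.
  by rewrite -(subrr 1); apply: cvgB => //; exact: cvg_cst.
apply: (squeeze_cvgr _ (cvg_cst 0) up).
have half : \forall N \near \oo, 2^-1 <= (b N)%:R / N%:R :> R.
  have h : 2^-1 < 1 :> R by rewrite invf_lt1// ltr1n.
  by apply: filterS (cvgr_gt _ hbN _ h) => N /ltW.
near=> N; rewrite defect_ge0 /=.
have N0 : (0 < N)%N by near: N.
have N0' : 0 < N%:R :> R by rewrite ltr0n.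
have full : bandwidth b N = N.
  have : 2^-1 <= (b N)%:R / N%:R :> R by near: N.
  rewrite ler_pdivlMr// mulrC ler_pdivrMr// -natrM ler_nat /bandwidth; lia.
have bN : (b N < N)%N by have := hb N0; lia.
have := strict_total_defect_corner bN; rewrite /defect -/(bandwidth b N) full => le.
rewrite ler_pdivrMr ?ltr0n ?muln_gt0 ?N0//.
rewrite (_ : (1 - _) * _ = (N * (N - b N))%:R) ?ler_nat//.
by rewrite natrM mulnC natrM natrB ?(ltnW bN)//; field; rewrite gt_eqF.
Unshelve. all: by end_near.
Qed.

End Defects.
Theorem theorem10 (R : realType) (d : measure_display)
    (Omega : measurableType d) (P : probability Omega R)
    (X : forall N : nat, 'I_N -> 'I_N -> {RV P >-> R})
    (rho : probability R R) (m v : R) (b : nat -> nat)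
    (hX : wigner_ensemble X rho m v) (hv : 0 <= v)
    (hb : forall N : nat, (1 <= N)%N -> (b N <= N - 1)%N)
    (hboo : b N @[N --> \oo] --> \oo) :
  (* a) *)
  ( (* (1) *)
    weak_cvg_in_probability P (periodic_band_esd X b)
      (fun _ => semicircle_law v)
    /\
    (* (2) *)
    (((b N)%:R / N%:R : R) @[N --> \oo] --> (0 : R) \/
     ((b N)%:R / N%:R : R) @[N --> \oo] --> (1 : R) ->
     weak_cvg_in_probability P (strict_band_esd X b)
       (fun _ => semicircle_law v)) )
  /\
  (* b) *)
  ((\sum_(1 <= N <oo | (1 <= b N)%N) (((N * b N)%:R)^-1 : R)%:E < +oo)%E ->
    weak_cvg_almost_surely P (periodic_band_esd X b)
      (fun _ => semicircle_law v)
    /\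
    (((b N)%:R / N%:R : R) @[N --> \oo] --> (0 : R) \/
     ((b N)%:R / N%:R : R) @[N --> \oo] --> (1 : R) ->
     weak_cvg_almost_surely P (strict_band_esd X b)
       (fun _ => semicircle_law v))).
Proof.
have bN N : (b N < N)%N -> (minn N (2 * b N + 1) = bandwidth b N)%N by [].
have per_degree N (i : 'I_N) : (b N < N)%N ->
    (\sum_j (periodic_dist i j <= b N) <= bandwidth b N)%N.
  by move=> h; rewrite periodic_degree.
have str_degree N (i : 'I_N) : (b N < N)%N ->
    (\sum_j (strict_dist i j <= b N) <= bandwidth b N)%N.
  by move=> _; exact: strict_degree_le.
have per_defect := @periodic_defect_cvg R b hb.
split; first split.
- exact: (scaled_band_probability hX hv hb hboo (D := @periodic_dist)
    periodic_distC periodic_dist_lip periodic_dist_count per_degree per_defect).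
- move=> /(strict_defect_cvg hb) str_defect.
  exact: (scaled_band_probability hX hv hb hboo (D := @strict_dist)
    strict_distC strict_dist_lip strict_dist_count str_degree str_defect).
move=> summable; split.
- exact: (scaled_band_almost_surely hX hv hb hboo (D := @periodic_dist)
    periodic_distC periodic_dist_lip periodic_dist_count per_degree per_defect summable).
move=> /(strict_defect_cvg hb) str_defect.
exact: (scaled_band_almost_surely hX hv hb hboo (D := @strict_dist)
  strict_distC strict_dist_lip strict_dist_count str_degree str_defect summable).
Qed.
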